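(* Let $\Sigma=(\mathbf{x},\mathbf{ex},B)$ be a seed which is mutation-equivalent to a finite skew-symmetric acyclic seed. Then for any $x\in\mathbf{x}$, we have $\sigma_{x,1}(\mathcal{A}(\Sigma))\subset\mathcal{A}(\Sigma\setminus\{x\})\otimes_{\mathbb{Z}}\mathbb{Q}$.
   Context: A seed is a triple $\Sigma=(\mathbf{x},\mathbf{ex},B)$ where $\mathbf{x}$ is a countable (cardinality at most $\aleph_0$) set of indeterminates over $\mathbb{Z}$ (the cluster), $\mathbf{ex}\subset\mathbf{x}$ is the set of exchangeable variables (those in $\mathbf{x}\setminus\mathbf{ex}$ are frozen), and $B=(b_{xy})_{x,y\in\mathbf{x}}$ is an integer matrix which is locally finite (each row and column has finite support) and skew-symmetrisable (there are positive integers $d_x$ with $d_xb_{xy}=-d_yb_{yx}$). Put $\mathcal{F}_\Sigma=\mathbb{Q}(x\mid x\in\mathbf{x})$. For $x\in\mathbf{ex}$ the mutation $\mu_x(\Sigma)=(\mathbf{x}',\mathbf{ex}',B')$ is obtained by replacing $x$ in $\mathbf{x}$ and in $\mathbf{ex}$ by $x'\in\mathcal{F}_\Sigma$ with $xx'=\prod_{b_{xy}>0}y^{b_{xy}}+\prod_{b_{xy}<0}y^{-b_{xy}}$, and (identifying the index $x'$ with $x$) $b'_{yz}=-b_{yz}$ if $x\in\{y,z\}$ and $b'_{yz}=b_{yz}+\frac12(|b_{yx}|b_{xz}+b_{yx}|b_{xz}|)$ otherwise. A sequence $(x_1,\dots,x_l)$ is $\Sigma$-admissible if $x_1$ is exchangeable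 in $\Sigma$ and each $x_i$ ($i\ge2$) is exchangeable in $\mu_{x_{i-1}}\circ\cdots\circ\mu_{x_1}(\Sigma)$. $\mathrm{Mut}(\Sigma)$ is the set of seeds obtained from $\Sigma$ by mutating along finite (possibly empty) admissible sequences; seeds in the same mutation class are mutation-equivalent. The rooted cluster algebra $\mathcal{A}(\Sigma)$ is the $\mathbb{Z}$-subalgebra of $\mathcal{F}_\Sigma$ generated by all variables in clusters of seeds in $\mathrm{Mut}(\Sigma)$; by the Laurent phenomenon it is contained in $\mathbb{Z}[x^{\pm1}\mid x\in\mathbf{x}]$. A seed is finite if $\mathbf{x}$ is finite, and skew-symmetric if $B$ is. The valued quiver $Q_B$ has vertex set $\mathbf{x}$ and an arrow $y\to z$ (with valuation $(b_{yz},-b_{zy})$) whenever $b_{yz}>0$. A seed is acyclic if the valued quiver obtained from $Q_B$ by deleting the arrows between frozen vertices has no oriented cycles. For $x\in\mathbf{x}$, $\Sigma\setminus\{x\}=(\mathbf{x}\setminus\{x\},\mathbf{ex}\setminus\{x\},(b_{yz})_{y,z\in\mathbf{x}\setminus\{x\}})$, and $\sigma_{x,1}$ is the ring homomorphism on Laurent polynomials in $\mathbf{x}$ sending $x$ to $1$ and $z$ to $z$ for $z\in\mathbf{x}\setminus\{x\}$. Here $\mathcal{A}(\Sigma\setminus\{x\})\otimes_{\mathbb{Z}}\mathbb{Q}$ is identified with the $\mathbb{Q}$-subalgebra of $\mathcal{F}_{\Sigma\setminus\{x\}}$ spanned by $\mathcal{A}(\Sigma\setminus\{x\})$. *)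

(* Defs.v *)
From HB Require Import structures.
From mathcomp Require Import all_boot all_order all_algebra finmap.
From mathcomp Require Import boolp classical_sets functions cardinality fsbigop.
From mathcomp Require Import monalg.

Set Implicit Arguments.
Unset Strict Implicit.
Unset Printing Implicit Defensive.

Import Order.TTheory GRing.Theory Num.Theory.

Local Open Scope classical_set_scope.
Local Open Scope ring_scope.

(** Polynomials over [int] in (possibly infinitely many) indeterminates indexed
    by [I] are elements of [{malg int[{cmonom I}]}]. *)

Definition cmonom_eval (F : fieldType) (I : choiceType) (v : I -> F)
    (m : {cmonom I}) : F :=
  \prod_(j <- finsupp m) v j ^+ m j.

Definition poly_eval (F : fieldType) (I : choiceType) (v : I -> F)
    (p : {malg int[{cmonom I}]}) : F :=
  mmap intr (cmonom_eval v) p.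

(** Coefficients are integers, so this also forces [F] to have characteristic 0. *)
Definition alg_independent (F : fieldType) (I : choiceType) (v : I -> F) : Prop :=
  forall p, poly_eval v p = 0 -> p = 0.

(** Every seed of a mutation class, and every seed obtained by deleting
    variables, lives in one fixed ambient field [F].  The elements of the
    cluster are labelled by a countable type [I], and mutation keeps the labels:
    this is the identification of the index x' with x.  The function field of
    the seed is the subfield of [F] generated by the cluster. *)

Record seed_data (F : fieldType) (I : countType) := SeedData {
  cluster : I -> F;
  exch : pred I;
  emat : I -> I -> int }.

Section Seeds.
Variables (F : fieldType) (I : countType).
Implicit Types (S T : seed_data F I) (i j k : I).

Definition locally_finite (B : I -> I -> int) : Prop :=
  (forall j, finite_set [set k | B j k != 0]) /\
  (forall k, finite_set [set j | B j k != 0]).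

Definition skew_symmetrisable (B : I -> I -> int) : Prop :=
  exists d : I -> int,
    (forall j, 0 < d j) /\ (forall j k, d j * B j k = - (d k * B k j)).

Definition is_seed S : Prop :=
  [/\ alg_independent (cluster S), locally_finite (emat S)
    & skew_symmetrisable (emat S)].

Definition mutated_variable S i : F :=
  (\big[*%R/1]_(k \in [set k | 0 < emat S i k])
      cluster S k ^+ `|emat S i k|%N
   + \big[*%R/1]_(k \in [set k | emat S i k < 0])
      cluster S k ^+ `|emat S i k|%N) / cluster S i.

(** The division by 2 is exact. *)
Definition mutated_matrix (B : I -> I -> int) i j k : int :=
  if (i == j) || (i == k) then - B j k
  else B j k + ((`|B j i| * B i k + B j i * `|B i k|) %/ 2)%Z.

Definition mutate S i : seed_data F I :=
  {| cluster := fun j => if j == i then mutated_variable S i else cluster S j;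
     exch := exch S;
     emat := mutated_matrix (emat S) i |}.

Fixpoint admissible S (s : seq I) : bool :=
  if s is i :: s' then exch S i && admissible (mutate S i) s' else true.

Definition mutate_seq S (s : seq I) : seed_data F I := foldl mutate S s.

Definition Mut S : set (seed_data F I) :=
  [set mutate_seq S s | s in [set s | admissible S s]].

Definition mutation_equivalent S T : Prop := Mut S T.

Definition subring_generated (G : set F) : set F :=
  smallest [set A : set F | subring_closed (mem A)] G.

Definition cluster_variables S : set F :=
  \bigcup_(T in Mut S) range (cluster T).

Definition cluster_algebra S : set F :=
  subring_generated (cluster_variables S).

Definition finite_seed S : Prop := finite_set (range (cluster S)).

Definition skew_symmetric_seed S : Prop :=
  forall j k, emat S j k = - emat S k j.

(** Arrows of the valued quiver, without those between two frozen vertices. *)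
Definition mobile_arrow S : rel I :=
  fun j k => (0 < emat S j k) && (exch S j || exch S k).

Definition acyclic_seed S : Prop :=
  forall c : seq I, cycle (mobile_arrow S) c -> c = [::].

Definition laurent_ring S : set F :=
  subring_generated (range (cluster S) `|` range (fun j => (cluster S j)^-1)).

(** [f] restricts to the ring homomorphism from the Laurent polynomials in the
    cluster of [S] that sends the variable [i] to 1 and fixes the others; its
    values outside of the Laurent ring are irrelevant. *)
Definition is_specialisation S i (f : F -> F) : Prop :=
  [/\ f 1 = 1,
      forall a b, laurent_ring S a -> laurent_ring S b -> f (a + b) = f a + f b,
      forall a b, laurent_ring S a -> laurent_ring S b -> f (a * b) = f a * f b,
      f (cluster S i) = 1
    & forall j, j != i -> f (cluster S j) = cluster S j].

(** Well defined on the Laurent ring: see [specialisationP] and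
    [specialisation_unique] below. *)
Definition specialisation S i : F -> F :=
  fun a => xget 0 [set b | exists2 f, is_specialisation S i f & f a = b].

Definition delete S i : seed_data F {j : I | j != i} :=
  SeedData (fun j : {j : I | j != i} => cluster S (val j))
    (fun j : {j : I | j != i} => exch S (val j))
    (fun j k : {j : I | j != i} => emat S (val j) (val k)).

End Seeds.

(** For a subring [A] of a field of characteristic 0, the Q-span of [A] is the
    image of the tensor product of [A] with Q. *)
Definition rat_span (F : fieldType) (A : set F) : set F :=
  [set b | exists n (q : 'I_n -> rat) (a : 'I_n -> F),
     (forall k, A (a k)) /\ b = \sum_(k < n) ratr (q k) * a k].

Section Evaluation.
Variables (F : fieldType) (I : choiceType).
Implicit Types (v : I -> F) (m : {cmonom I}).

Lemma cmonom_evalEw v m (E : {fset I}) : (finsupp m `<=` E)%fset ->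
  cmonom_eval v m = \prod_(j <- E) v j ^+ m j.
Proof.
move=> mE; rewrite /cmonom_eval; apply: big_fset_incl => // j _ jm.
by move: jm; rewrite memNfinsupp => /eqP ->.
Qed.

Lemma cmonom_eval1 v : cmonom_eval v mone = 1.
Proof. by rewrite /cmonom_eval mdom1 big_seq_fset0. Qed.

Lemma cmonom_evalM v : {morph cmonom_eval v : m1 m2 / mmul m1 m2 >-> m1 * m2}.
Proof.
move=> m1 m2; set E := (finsupp m1 `|` finsupp m2 `|` finsupp (mmul m1 m2))%fset.
rewrite !(@cmonom_evalEw _ _ E); last 3 first.
- by apply/fsubsetP => j jm; rewrite !inE jm ?orbT.
- by apply/fsubsetP => j jm; rewrite !inE jm ?orbT.
- by apply/fsubsetP => j jm; rewrite !inE jm ?orbT.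
by rewrite -big_split /=; apply: eq_bigr => j _; rewrite cmM exprD.
Qed.

HB.instance Definition _ v :=
  isMultiplicative.Build {cmonom I} F (cmonom_eval v)
    (cmonom_evalM v, cmonom_eval1 v).

Lemma cmonom_evalU v j : cmonom_eval v (ucm j) = v j.
Proof. by rewrite /cmonom_eval mdomU big_seq_fset1 cmUU expr1. Qed.

Lemma cmonom_eval_neq0 v m : (forall j, v j != 0) -> cmonom_eval v m != 0.
Proof.
move=> v0; rewrite /cmonom_eval prodf_seq_neq0; apply/allP => j _ /=.
by rewrite expf_neq0.
Qed.

Lemma poly_evalM v : {morph poly_eval v : p q / p * q}.
Proof. by move=> p q; exact: rmorphM. Qed.

Lemma poly_evalB v : {morph poly_eval v : p q / p - q}.
Proof. by move=> p q; exact: rmorphB. Qed.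

Lemma poly_evalD v : {morph poly_eval v : p q / p + q}.
Proof. by move=> p q; exact: rmorphD. Qed.

Lemma poly_eval1 v : poly_eval v 1 = 1.
Proof. exact: rmorph1. Qed.

Lemma poly_evalU v m : poly_eval v << m >> = cmonom_eval v m.
Proof. by rewrite /poly_eval mmapU /= mulr1z mul1r. Qed.

Lemma poly_evalMU v p m :
  poly_eval v (p * << m >>) = poly_eval v p * cmonom_eval v m.
Proof. by rewrite (poly_evalM v p << m >>) poly_evalU. Qed.

Definition laurent_eval v p m : F := poly_eval v p / cmonom_eval v m.

Lemma laurent_eval1 v : laurent_eval v 1 mone = 1.
Proof. by rewrite /laurent_eval poly_eval1 cmonom_eval1 divr1. Qed.

Lemma laurent_evalU v j : laurent_eval v << ucm j >> mone = v j.
Proof. by rewrite /laurent_eval poly_evalU cmonom_evalU cmonom_eval1 divr1. Qed.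

Lemma laurent_evalV v j : laurent_eval v 1 (ucm j) = (v j)^-1.
Proof. by rewrite /laurent_eval poly_eval1 cmonom_evalU div1r. Qed.

Lemma laurent_evalM v p q m n :
  laurent_eval v (p * q) (mmul m n) = laurent_eval v p m * laurent_eval v q n.
Proof.
rewrite {2 3}/laurent_eval mulf_div -cmonom_evalM.
by congr (_ / _); exact: poly_evalM.
Qed.

Lemma laurent_evalD v p q m n : (forall j, v j != 0) ->
  laurent_eval v (p * << n >> + q * << m >>) (mmul m n)
  = laurent_eval v p m + laurent_eval v q n.
Proof.
move=> v0; rewrite {2 3}/laurent_eval addf_div ?cmonom_eval_neq0 //.
rewrite -cmonom_evalM; congr (_ / _).
exact: etrans (poly_evalD _ _ _) (congr2 +%R (poly_evalMU _ _ _) (poly_evalMU _ _ _)).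
Qed.

Lemma laurent_evalN v p m : laurent_eval v (- p) m = - laurent_eval v p m.
Proof. by rewrite /laurent_eval -mulNr; congr (_ / _); exact: rmorphN. Qed.

Lemma laurent_eval_eq v p q m n : (forall j, v j != 0) ->
  laurent_eval v p m = laurent_eval v q n
  <-> poly_eval v (p * << n >>) = poly_eval v (q * << m >>).
Proof.
move=> v0; have eM := poly_evalMU v.
have E : laurent_eval v p m = laurent_eval v q n <->
    poly_eval v p * cmonom_eval v n = poly_eval v q * cmonom_eval v m.
  rewrite /laurent_eval; split=> [/eqP|/eqP e].
    by rewrite eqr_div ?cmonom_eval_neq0 // => /eqP.
  by apply/eqP; rewrite eqr_div ?cmonom_eval_neq0.
split=> [/E e|e].
  exact: etrans (eM p n) (etrans e (esym (eM q m))).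
by apply/E; exact: etrans (esym (eM p n)) (etrans e (eM q m)).
Qed.

Lemma alg_independent_neq0 v j : alg_independent v -> v j != 0.
Proof.
move=> vfree; apply/eqP => vj0.
have /(congr1 (mcoeff (ucm j))) : << ucm j >> = 0 :> {malg int[{cmonom I}]}.
  by apply: vfree; rewrite poly_evalU cmonom_evalU.
by rewrite mcoeffUU mcoeff0.
Qed.

End Evaluation.

Section Specialisation.
Variables (F : fieldType) (I : countType) (S : seed_data F I) (i : I).

Lemma subring_generated_closed (G : set F) :
  subring_closed (mem (subring_generated G)).
Proof.
split.
- by rewrite in_setE => A [[A1 _ _] _]; rewrite -in_setE.
- move=> a b; rewrite !in_setE => Ga Gb A AP.
  by case: (AP) => -[_ AB _] _; rewrite -in_setE; apply: AB; rewrite in_setE;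
    [exact: Ga | exact: Gb].
- move=> a b; rewrite !in_setE => Ga Gb A AP.
  by case: (AP) => -[_ _ AM] _; rewrite -in_setE; apply: AM; rewrite in_setE;
    [exact: Ga | exact: Gb].
Qed.

Let x := cluster S.
Let x1 j := if j == i then 1 else x j.

Lemma laurent_ringE a : alg_independent x -> laurent_ring S a ->
  exists p m, a = laurent_eval x p m.
Proof.
move=> xfree; have x0 j : x j != 0 by exact: alg_independent_neq0.
apply: (@smallest_sub _ _ _ [set a | exists p m, a = laurent_eval x p m]) => /=.
  split.
  - by rewrite in_setE; exists 1, mone; rewrite laurent_eval1.
  - move=> a' b'; rewrite !in_setE => -[p [m ->]] [q [n ->]].
    exists (p * << n >> + - q * << m >>), (mmul m n).
    by rewrite (laurent_evalD p (- q) m n x0) (laurent_evalN x q n).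
  - move=> a' b'; rewrite !in_setE => -[p [m ->]] [q [n ->]].
    by exists (p * q), (mmul m n); rewrite (laurent_evalM x p q m n).
move=> _ [[j _ <-]|[j _ <-]].
  by exists << ucm j >>, mone; rewrite laurent_evalU.
by exists 1, (ucm j); rewrite laurent_evalV.
Qed.

Lemma specialisation_exists : is_seed S -> exists f, is_specialisation S i f.
Proof.
case=> xfree _ _; have x0 j : x j != 0 by exact: alg_independent_neq0.
have x10 j : x1 j != 0 by rewrite /x1; case: ifP; rewrite ?oner_eq0.
pose P a b := exists p m, a = laurent_eval x p m /\ b = laurent_eval x1 p m.
pose f a := xget 0 [set b | P a b].
have fE p m : f (laurent_eval x p m) = laurent_eval x1 p m.
  apply: xget_unique; first by exists p, m.
  move=> _ [q [n [/(laurent_eval_eq p q m n x0) pq ->]]].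
  suff e : p * << n >> = q * << m >>.
    by apply/(laurent_eval_eq q p n m x10); exact: (congr1 _ (esym e)).
  apply/eqP; rewrite -subr_eq0; apply/eqP/xfree.
  apply: (etrans (poly_evalB x (p * << n >>) (q * << m >>))).
  by apply/eqP; rewrite subr_eq0; apply/eqP.
exists f; split.
- by have := fE 1 mone; rewrite !laurent_eval1.
- move=> a b /(laurent_ringE xfree)[p [m ->]] /(laurent_ringE xfree)[q [n ->]].
  rewrite (fE p m) (fE q n) -(laurent_evalD p q m n x0).
  by rewrite -(laurent_evalD p q m n x10); exact: fE.
- move=> a b /(laurent_ringE xfree)[p [m ->]] /(laurent_ringE xfree)[q [n ->]].
  rewrite (fE p m) (fE q n) -(laurent_evalM x p q m n).
  by rewrite -(laurent_evalM x1 p q m n); exact: fE.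
- by have := fE << ucm i >> mone; rewrite !laurent_evalU /x1 eqxx.
- by move=> j ji; have := fE << ucm j >> mone; rewrite !laurent_evalU /x1 (negPf ji).
Qed.

Lemma specialisation_unique f g : is_seed S ->
  is_specialisation S i f -> is_specialisation S i g ->
  forall a, laurent_ring S a -> f a = g a.
Proof.
case=> xfree _ _ fP gP.
have x0 j : x j != 0 by exact: alg_independent_neq0.
case: (subring_generated_closed
  (range x `|` range (fun j => (x j)^-1))) => L1 LB LM.
have L0 : laurent_ring S 0 by rewrite -in_setE -(subrr 1); exact: LB.
have LN a : laurent_ring S a -> laurent_ring S (- a).
  by move=> La; rewrite -in_setE -sub0r; apply: LB; rewrite in_setE.
have Lx j : laurent_ring S (x j) by apply: sub_gen_smallest; left; exists j.
have LV j : laurent_ring S (x j)^-1 by apply: sub_gen_smallest; right; exists j.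
have hN h a : is_specialisation S i h -> laurent_ring S a -> h (- a) = - h a.
  case=> _ hD _ _ _ La.
  have h0 : h 0 = 0 by apply: (@addrI _ (h 0)); rewrite -hD // !addr0.
  by apply: (@addrI _ (h a)); rewrite -hD ?subrr //; exact: LN.
have fg j : f (x j) = g (x j).
  case: (eqVneq j i) => [->|ji].
    by case: fP gP => _ _ _ -> _ [].
  by case: fP gP => _ _ _ _ fx [_ _ _ _ gx]; rewrite fx ?gx.
have hx h j : is_specialisation S i h -> h (x j) * h (x j)^-1 = 1.
  by case=> h1 _ hM _ _; rewrite -hM // divff.
have fgV j : f (x j)^-1 = g (x j)^-1.
  have fx0 : f (x j) != 0.
    by apply/eqP => e; move: (hx _ j fP); rewrite e mul0r => /esym/eqP; rewrite oner_eq0.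
  by apply: (mulfI fx0); rewrite (hx _ _ fP) fg (hx _ _ gP).
suff H : laurent_ring S `<=` [set a | laurent_ring S a /\ f a = g a].
  by move=> a /H[].
apply: smallest_sub.
  split.
  - by rewrite in_setE; split; [rewrite -in_setE | case: fP gP => -> _ _ _ _ []].
  - move=> a b; rewrite !in_setE => -[La fga] [Lb fgb]; split.
      by rewrite -in_setE; apply: LB; rewrite in_setE.
    have [[_ fD _ _ _] [_ gD _ _ _]] := (fP, gP).
    by rewrite fD ?gD ?fga ?(hN f) ?(hN g) ?fgb //; exact: LN.
  - move=> a b; rewrite !in_setE => -[La fga] [Lb fgb]; split.
      by rewrite -in_setE; apply: LM; rewrite in_setE.
    have [[_ _ fM _ _] [_ _ gM _ _]] := (fP, gP).
    by rewrite fM ?gM ?fga ?fgb.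
by move=> _ [[j _ <-]|[j _ <-]]; split.
Qed.

Lemma specialisationE f a : is_seed S -> is_specialisation S i f ->
  laurent_ring S a -> specialisation S i a = f a.
Proof.
move=> Sseed fP La; apply: xget_unique; first by exists f.
by move=> _ [g gP <-]; exact: (specialisation_unique Sseed gP fP).
Qed.

Lemma specialisationP : is_seed S ->
  is_specialisation S i (specialisation S i).
Proof.
move=> Sseed; have [f fP] := specialisation_exists Sseed.
have [L1 LB LM] := subring_generated_closed
  (range (cluster S) `|` range (fun j => (cluster S j)^-1)).
have E := specialisationE Sseed fP.
have Lx j : laurent_ring S (cluster S j).
  by apply: sub_gen_smallest; left; exists j.
case: (fP) => f1 fD fM fi fj; split.
- by rewrite E // -in_setE.
- move=> a b La Lb; rewrite !E ?fD // -in_setE -[b]opprK; apply: (LB).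
    by rewrite in_setE.
  by rewrite -sub0r; apply: (LB); [rewrite -(subrr 1); apply: (LB) | rewrite in_setE].
- by move=> a b La Lb; rewrite !E ?fM // -in_setE; apply: LM; rewrite in_setE.
- by rewrite E.
- by move=> j ji; rewrite E // fj.
Qed.

End Specialisation.

(* Main.v *)
(** Setting the variable x to 1 in the seeds reached from Sigma without mutating
    at x gives the seeds of Sigma \ {x}.  A cluster variable f of Sigma is a
    Laurent polynomial in each cluster of Sigma, polynomial in the frozen
    variables, so its value at x = 1 is such a Laurent polynomial in each
    cluster of Sigma \ {x} that is reached in this way.  If a seed T of
    Sigma \ {x} is acyclic, an element that is Laurent in the clusters
    obtained from T by mutating at pairwise unlinked vertices is a polynomial
    in the variables of T and of its neighbours: this is the comparison of the
    upper and lower bounds of Berenstein, Fomin and Zelevinsky, here with frozen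
    variables that are not inverted.

    It remains to find T.  The exchange matrices mutation-equivalent to an
    acyclic one are antisymmetrised Euler forms of exceptional sequences of
    representations, possibly shifted, of an acyclic quiver.  While there are
    nonzero maps from shifted terms to unshifted ones (for terms exchangeable
    and different from x), mutating at the smallest term that occurs in such a
    map decreases the total dimension; once there are no such maps, mutation
    makes all the terms unshifted, and the order of the sequence is then a rank
    function. *)

From HB Require Import structures.
Require Import Defs.
From mathcomp Require Import all_boot all_order all_algebra finmap.
From mathcomp Require Import boolp classical_sets functions cardinality fsbigop.
From mathcomp Require Import monalg.
From mathcomp Require Import zify lra.
From Stdlib Require Import Ring.

Set Implicit Arguments.
Unset Strict Implicit.
Unset Printing Implicit Defensive.

Import Order.TTheory GRing.Theory Num.Theory.

Local Open Scope classical_set_scope.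
Local Open Scope ring_scope.

(** * Representations of quivers *)

(** The acyclic seed of the class may be reachable only by mutating at x, which is not allowed in
    Sigma \ {x}; the deletion needs an acyclic seed of its own, reached without x. The signed
    classes of the exceptional terms obey the mutation rule of c-vectors, so only signs and
    dimensions have to be controlled along a word. The descent rests on one inequality: mutation at
    an unshifted N replaces the dimension of a shifted M that maps to N by |e dim N - dim M|, where
    e is the Euler pairing of M and N, and this is smaller than dim M when 0 < e dim N < 2 dim M.
    Arrows between frozen vertices escape the acyclicity hypothesis; they do not influence the other
    entries and are replaced by 0. Setting x = 1 in a field is only partially defined. It is encoded
    by a subring of a product of two fields, localised where the second component does not vanish.
    The same device shows that exchange polynomials do not vanish, that frozen variables need not be
    inverted, and that an auxiliary frozen variable may be added in the Laurent phenomenon and set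
    to 1 afterwards. *)

Lemma subACA (V : zmodType) (x y z t : V) : x - y - (z - t) = x - z - (y - t).
Proof. by rewrite !opprD !opprK addrACA. Qed.

(** * Idempotent matrices and the families of maps between their images *)

Section IdempotentRank.
Variable (K : fieldType).

Lemma idem_row_col n (e : 'M[K]_n) : e *m e = e -> row_base e *m col_base e = 1%:M.
Proof.
move=> ee; have e1 := mulmx_base e.
have rf : row_free (row_base e) by exact: row_base_free.
have cf : row_full (col_base e) by exact: col_base_full.
apply: (row_full_inj cf); apply: (row_free_inj rf).
by rewrite mulmx1 mulmxA e1 -mulmxA e1.
Qed.

Lemma idem_col n (e : 'M[K]_n) : e *m e = e -> e *m col_base e = col_base e.
Proof.
move=> ee; have := mulmx_base e; have := idem_row_col ee.
move: (col_base e) (row_base e) => L R F E.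
have -> : e *m L = L *m R *m L by rewrite E.
by rewrite -mulmxA F mulmx1.
Qed.

Lemma idem_row n (e : 'M[K]_n) : e *m e = e -> row_base e *m e = row_base e.
Proof.
move=> ee; have := mulmx_base e; have := idem_row_col ee.
move: (col_base e) (row_base e) => L R F E.
have -> : R *m e = R *m (L *m R) by rewrite E.
by rewrite mulmxA F mul1mx.
Qed.

(** Ranks of idempotents are added through the trace, which is linear; the identity holds in the
    field, and becomes one between integers in characteristic 0. *)
Lemma idem_rank_tr n (e : 'M[K]_n) : e *m e = e -> (\rank e)%:R = \tr e.
Proof. by move=> ee; rewrite -{2}(mulmx_base e) mxtrace_mulC idem_row_col // mxtrace1. Qed.

End IdempotentRank.

Section FamilyDim.
Variables (K : fieldType) (I A : finType) (s t : A -> I) (m n : nat).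
Variables (e : I -> 'M[K]_m) (e' : I -> 'M[K]_n).
Hypotheses (ee : forall i, e i *m e i = e i) (ee' : forall i, e' i *m e' i = e' i).

Definition fam_proj (phi : {ffun A -> 'M[K]_(m, n)}) : {ffun A -> 'M[K]_(m, n)} :=
  [ffun a => e (s a) *m phi a *m e' (t a)].
Fact fam_proj_linear : linear fam_proj.
Proof.
by move=> c u v; apply/ffunP => a; rewrite !ffunE mulmxDr mulmxDl -scalemxAr -scalemxAl.
Qed.
HB.instance Definition _ := GRing.isLinear.Build K _ _ _ fam_proj fam_proj_linear.

(** Both terms of the two-term complex that computes Hom and Ext have this form: the vertices with
    [s] and [t] the identity, and the arrows. *)
Definition fam_space : {vspace {ffun A -> 'M[K]_(m, n)}} := limg (linfun fam_proj).

Lemma fam_spaceP (phi : {ffun A -> 'M[K]_(m, n)}) : reflect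
  (forall a, e (s a) *m phi a = phi a /\ phi a *m e' (t a) = phi a)
  (phi \in fam_space).
Proof.
apply: (iffP idP) => [/memv_imgP[u _ ->] a|H].
  by rewrite lfunE /= !ffunE !mulmxA ee -!mulmxA ee'.
apply/memv_imgP; exists phi; rewrite ?memvf // lfunE /=; apply/ffunP => a.
by rewrite ffunE; have [-> ->] := H a.
Qed.

Definition fam_inj (a : A) (g : 'M[K]_(\rank (e (s a)), \rank (e' (t a)))) :
    {ffun A -> 'M[K]_(m, n)} :=
  [ffun b => if b == a then col_base (e (s a)) *m g *m row_base (e' (t a)) else 0].
Fact fam_inj_linear a : linear (@fam_inj a).
Proof.
move=> c u v; apply/ffunP => b; rewrite !ffunE; case: ifP => _; last by rewrite scaler0 addr0.
by rewrite mulmxDr mulmxDl -scalemxAr -scalemxAl.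
Qed.
HB.instance Definition _ a := GRing.isLinear.Build K _ _ _ (@fam_inj a) (@fam_inj_linear a).

Lemma dim_fam_inj a :
  \dim (limg (linfun (@fam_inj a))) = (\rank (e (s a)) * \rank (e' (t a)))%N.
Proof.
rewrite limg_dim_eq ?dimvf ?dim_matrix //; apply/eqP; rewrite capfv; apply/lker0P => u v.
rewrite !lfunE /= => /ffunP/(_ a); rewrite !ffunE eqxx => E.
have rf : row_free (row_base (e' (t a))) by exact: row_base_free.
have cf : row_full (col_base (e (s a))) by exact: col_base_full.
by apply: (row_full_inj cf); apply: (row_free_inj rf).
Qed.

Lemma dim_fam_space :
  \dim fam_space = (\sum_(a : A) \rank (e (s a)) * \rank (e' (t a)))%N.
Proof.
have -> : fam_space = (\sum_a limg (linfun (@fam_inj a)))%VS.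
  apply/eqP; rewrite eqEsubv; apply/andP; split; apply/subvP => phi.
    move=> /fam_spaceP H; apply/memv_sumP.
    exists (fun a => linfun (@fam_inj a) (row_base (e (s a)) *m phi a *m col_base (e' (t a)))).
      by move=> a _; rewrite memv_img ?memvf.
    apply/ffunP => a; rewrite sum_ffunE (bigD1 a) //= big1 ?addr0; last first.
      by move=> b ba; rewrite lfunE /= ffunE eq_sym (negPf ba).
    rewrite lfunE /= ffunE eqxx; have := mulmx_base (e (s a)); have := mulmx_base (e' (t a)).
    move: (col_base _) (row_base _) (col_base _) (row_base _) => L' R' L R E' E.
    by have [Hl Hr] := H a; rewrite !mulmxA E -!mulmxA E' Hr Hl.
  move=> /memv_sumP[u uP ->]; apply: memv_suml => a _.
  have /memv_imgP[g _ ->] := uP a isT; apply/fam_spaceP => b.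
  rewrite lfunE /= ffunE; case: eqP => [->|_]; last by rewrite mulmx0 mul0mx.
  split; first by rewrite 2!mulmxA idem_col.
  by rewrite -mulmxA idem_row.
have /directvP -> : directv (\sum_a limg (linfun (@fam_inj a))).
  apply/directv_sum_independent => u uP u0 a _.
  have /memv_imgP[g _ E] := uP a isT; apply/ffunP => b.
  have uE c : c != b -> u c b = 0.
    have /memv_imgP[g' _ ->] := uP c isT; rewrite lfunE /= ffunE eq_sym => /negPf -> //.
  have [->|/uE ->] := eqVneq a b; last by rewrite ffunE.
  move/ffunP: u0 => /(_ b); rewrite sum_ffunE (bigD1 b) //= big1 ?addr0 //.
by rewrite /=; apply: eq_bigr => a _; exact: dim_fam_inj.
Qed.
End FamilyDim.

Section Rep.
Variables (K : numFieldType) (I Ar : finType).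

Section Def.
Variables (s t : Ar -> I).
(** The spaces at the vertices are summands of one space of row vectors, cut out by orthogonal
    idempotents. A morphism is then a single matrix acting on the right, and no matrix type depends
    on a vertex. *)
Record rep := Rep {
  rdim : nat;
  re : I -> 'M[K]_rdim;
  rf : Ar -> 'M[K]_rdim;
  _ : forall i j, re i *m re j = if i == j then re i else 0;
  _ : \sum_i re i = 1%:M;
  _ : forall a, re (s a) *m rf a = rf a;
  _ : forall a, rf a *m re (t a) = rf a }.

Implicit Types (M N X A B C : rep).
Lemma reM M i j : re M i *m re M j = if i == j then re M i else 0. Proof. by case: M. Qed.
Lemma reMi M i : re M i *m re M i = re M i. Proof. by rewrite reM eqxx. Qed.
Lemma re_sum M : \sum_i re M i = 1%:M. Proof. by case: M. Qed.
Lemma rfs M a : re M (s a) *m rf M a = rf M a. Proof. by case: M. Qed.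
Lemma rft M a : rf M a *m re M (t a) = rf M a. Proof. by case: M. Qed.

Definition graded M N (h : 'M[K]_(rdim M, rdim N)) := forall i, re M i *m h = h *m re N i.
Definition ishom M N h := @graded M N h /\ forall a, rf M a *m h = h *m rf N a.
Definition hom0 M N := forall h, @ishom M N h -> h = 0.
Definition cochain M N (phi : Ar -> 'M[K]_(rdim M, rdim N)) :=
  forall a, re M (s a) *m phi a = phi a /\ phi a *m re N (t a) = phi a.
(** Over a path algebra, Ext^1 is the cokernel of the map from graded maps to cochains; its
    vanishing is expressed without forming the quotient. *)
Definition ext0 M N := forall phi, @cochain M N phi ->
  exists2 h, @graded M N h & forall a, phi a = rf M a *m h - h *m rf N a.

(** Exactness is witnessed by splittings [ro] and [si] that respect the grading but need not commute
    with the arrows. *)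
Definition ses A B C := exists (io : 'M[K]_(rdim A, rdim B)) (pi : 'M[K]_(rdim B, rdim C))
   (ro : 'M[K]_(rdim B, rdim A)) (si : 'M[K]_(rdim C, rdim B)),
  [/\ ishom io, ishom pi, graded ro & graded si] /\
  [/\ io *m ro = 1%:M, si *m pi = 1%:M, io *m pi = 0, si *m ro = 0
    & ro *m io + pi *m si = 1%:M].

Definition dimv M i : nat := \rank (re M i).
Definition euler_form (u v : I -> int) : int :=
  \sum_i u i * v i - \sum_a u (s a) * v (t a).
Definition cl M i : int := dimv M i.

Lemma graded_comp M N X (f : 'M_(rdim M, rdim N)) (g : 'M_(rdim N, rdim X)) :
  graded f -> graded g -> graded (f *m g).
Proof. by move=> fP gP i; rewrite mulmxA fP -mulmxA gP mulmxA. Qed.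
Lemma ishom_comp M N X (f : 'M_(rdim M, rdim N)) (g : 'M_(rdim N, rdim X)) :
  ishom f -> ishom g -> ishom (f *m g).
Proof.
move=> [f1 f2] [g1 g2]; split; first exact: graded_comp.
by move=> a; rewrite mulmxA f2 -mulmxA g2 mulmxA.
Qed.
Lemma graded1 M : graded (1%:M : 'M_(rdim M, rdim M)).
Proof. by move=> i; rewrite mulmx1 mul1mx. Qed.
Lemma ishom1 M : ishom (1%:M : 'M_(rdim M, rdim M)).
Proof. by split; [exact: graded1 | move=> a; rewrite mulmx1 mul1mx]. Qed.
Lemma gradedB M N (f g : 'M_(rdim M, rdim N)) : graded f -> graded g -> graded (f - g).
Proof. by move=> fP gP i; rewrite mulmxBr mulmxBl fP gP. Qed.
Lemma gradedD M N (f g : 'M_(rdim M, rdim N)) : graded f -> graded g -> graded (f + g).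
Proof. by move=> fP gP i; rewrite mulmxDr mulmxDl fP gP. Qed.
Lemma ishomD M N (f g : 'M_(rdim M, rdim N)) : ishom f -> ishom g -> ishom (f + g).
Proof.
move=> [f1 f2] [g1 g2]; split; first exact: gradedD.
by move=> a; rewrite mulmxDr mulmxDl f2 g2.
Qed.
Lemma ishomZ M N c (f : 'M_(rdim M, rdim N)) : ishom f -> ishom (c *: f).
Proof.
by move=> [f1 f2]; split=> a; rewrite -scalemxAr -scalemxAl ?f1 ?f2.
Qed.
Lemma ishomB M N (f g : 'M_(rdim M, rdim N)) : ishom f -> ishom g -> ishom (f - g).
Proof. by move=> fP gP; rewrite -scaleN1r; apply: ishomD => //; exact: ishomZ. Qed.
Lemma ishom0 M N : ishom (0 : 'M_(rdim M, rdim N)).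
Proof. by split=> a; rewrite mulmx0 mul0mx. Qed.

Lemma cochain_d M N (h : 'M_(rdim M, rdim N)) : graded h ->
  cochain (fun a => rf M a *m h - h *m rf N a).
Proof.
move=> hP a; split.
  by rewrite mulmxBr mulmxA rfs mulmxA hP -mulmxA rfs.
by rewrite mulmxBl -(mulmxA _ _ (re N _)) -hP mulmxA rft -mulmxA rft.
Qed.
Lemma cochain_l M N X (f : 'M_(rdim M, rdim N)) (phi : Ar -> 'M_(rdim N, rdim X)) :
  graded f -> cochain phi -> cochain (fun a => f *m phi a).
Proof.
by move=> fP pP a; have [p1 p2] := pP a; rewrite mulmxA fP -!mulmxA p1 p2.
Qed.
Lemma cochain_r M N X (f : 'M_(rdim N, rdim X)) (phi : Ar -> 'M_(rdim M, rdim N)) :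
  graded f -> cochain phi -> cochain (fun a => phi a *m f).
Proof.
by move=> fP pP a; have [p1 p2] := pP a; rewrite -mulmxA -fP !mulmxA p1 p2.
Qed.

(** * The long exact sequences of Hom and Ext, for vanishing only *)

Section Ses.
Variables (A B C X : rep).
Hypothesis S : ses A B C.

Lemma hom0_subr : hom0 X B -> hom0 X A.
Proof.
have [io [pi [ro [si [[Hi Hp Hr Hs] [ir sp ip sr rp]]]]]] := S => H h hP.
by rewrite -[h]mulmx1 -ir mulmxA (H _ (ishom_comp hP Hi)) mul0mx.
Qed.
Lemma hom0_quol : hom0 B X -> hom0 C X.
Proof.
have [io [pi [ro [si [[Hi Hp Hr Hs] [ir sp ip sr rp]]]]]] := S => H h hP.
by rewrite -[h]mul1mx -sp -mulmxA (H _ (ishom_comp Hp hP)) mulmx0.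
Qed.
Lemma hom0_extr : hom0 X A -> hom0 X C -> hom0 X B.
Proof.
have [io [pi [ro [si [[Hi Hp Hr Hs] [ir sp ip sr rp]]]]]] := S => HA HC h hP.
have hp : h *m pi = 0 by apply: HC; exact: ishom_comp.
have E : h = h *m ro *m io.
  by rewrite -{1}[h]mulmx1 -rp mulmxDr !mulmxA hp mul0mx addr0.
suff H : h *m ro = 0 by rewrite E H mul0mx.
apply: HA; split; first by apply: graded_comp => //; case: hP.
move=> a; rewrite -[RHS]mulmx1 -ir !mulmxA.
rewrite -(mulmxA _ (rf A a) io); case: Hi => _ ->; rewrite mulmxA -E.
by rewrite -(proj2 hP).
Qed.
Lemma hom0_extl : hom0 A X -> hom0 C X -> hom0 B X.
Proof.
have [io [pi [ro [si [[Hi Hp Hr Hs] [ir sp ip sr rp]]]]]] := S => HA HC h hP.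
have hp : io *m h = 0 by apply: HA; exact: ishom_comp.
have E : h = pi *m (si *m h).
  by rewrite -{1}[h]mul1mx -rp mulmxDl -!mulmxA hp mulmx0 add0r.
suff H : si *m h = 0 by rewrite E H mulmx0.
apply: HC; split; first by apply: graded_comp => //; case: hP.
move=> a; rewrite -[LHS]mul1mx -sp -mulmxA (mulmxA pi).
by rewrite -(proj2 Hp) -(mulmxA (rf B a)) -E (proj2 hP) mulmxA.
Qed.
Lemma ext0_quor : ext0 X B -> ext0 X C.
Proof.
have [io [pi [ro [si [[Hi Hp Hr Hs] [ir sp ip sr rp]]]]]] := S => H phi phiP.
have [h hg hE] := H _ (cochain_r Hs phiP); exists (h *m pi).
  by apply: graded_comp => //; case: Hp.
move=> a; have := congr1 (mulmx^~ pi) (hE a).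
by rewrite /= -mulmxA sp mulmx1 => ->; rewrite mulmxBl -!mulmxA (proj2 Hp).
Qed.
Lemma ext0_subl : ext0 B X -> ext0 A X.
Proof.
have [io [pi [ro [si [[Hi Hp Hr Hs] [ir sp ip sr rp]]]]]] := S => H phi phiP.
have [h hg hE] := H _ (cochain_l Hr phiP); exists (io *m h).
  by apply: graded_comp => //; case: Hi.
move=> a; have := congr1 (mulmx io) (hE a).
by rewrite /= mulmxA ir mul1mx => ->; rewrite mulmxBr !mulmxA (proj2 Hi).
Qed.
(** Composing a map X -> C with the section [si] leaves a defect with values in A. Since Ext(X, A) =
    0, it can be corrected to a lift X -> B, and this lift is zero. *)
Lemma hom0_connr : hom0 X B -> ext0 X A -> hom0 X C.
Proof.
have [io [pi [ro [si [[Hi Hp Hr Hs] [ir sp ip sr rp]]]]]] := S => H E h hP.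
have hsg : graded (h *m si) by apply: graded_comp => //; case: hP.
have [g gg gE] := E _ (cochain_r Hr (cochain_d hsg)).
have pE a : (rf X a *m (h *m si) - h *m si *m rf B a) *m pi = 0.
  rewrite mulmxBl -!mulmxA sp mulmx1 (proj2 Hp) (mulmxA si) sp mul1mx (proj2 hP).
  by rewrite subrr.
have k0 : h *m si - g *m io = 0.
  apply: H; split; first by apply: gradedB => //; apply: graded_comp => //; case: Hi.
  move=> a; apply/eqP; rewrite -subr_eq0 mulmxBr mulmxBl subACA.
  have -> : rf X a *m (h *m si) - h *m si *m rf B a =
      (rf X a *m (h *m si) - h *m si *m rf B a) *m ro *m io.
    by rewrite -[LHS]mulmx1 -rp mulmxDr [_ *m (pi *m _)]mulmxA pE mul0mx addr0 mulmxA.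
  by rewrite gE mulmxBl -!mulmxA -(proj2 Hi) !mulmxA subrr.
have hE : h *m si = g *m io by apply/eqP; rewrite -subr_eq0 k0.
by rewrite -[h]mulmx1 -sp mulmxA hE -mulmxA ip mulmx0.
Qed.
Lemma ext0_connr : ext0 X B -> hom0 X C -> ext0 X A.
Proof.
have [io [pi [ro [si [[Hi Hp Hr Hs] [ir sp ip sr rp]]]]]] := S => E H phi phiP.
have [h hg hE] := E _ (cochain_r (proj1 Hi) phiP).
have hp : h *m pi = 0.
  apply: H; split; first by apply: graded_comp => //; case: Hp.
  move=> a; have := congr1 (mulmx^~ pi) (hE a).
  rewrite /= -mulmxA ip mulmx0 mulmxBl -!mulmxA (proj2 Hp) => /esym/eqP.
  by rewrite subr_eq0 => /eqP.
have hE' : h = h *m ro *m io by rewrite -{1}[h]mulmx1 -rp mulmxDr !mulmxA hp mul0mx addr0.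
exists (h *m ro); first exact: graded_comp.
move=> a; rewrite -[LHS]mulmx1 -ir mulmxA hE mulmxBl !mulmxA; congr (_ - _).
by rewrite {1}hE' -!mulmxA (mulmxA io) -(proj2 Hi) -mulmxA ir mulmx1.
Qed.
Lemma hom0_connl : hom0 B X -> ext0 C X -> hom0 A X.
Proof.
have [io [pi [ro [si [[Hi Hp Hr Hs] [ir sp ip sr rp]]]]]] := S => H E h hP.
have hsg : graded (ro *m h) by apply: graded_comp => //; case: hP.
have [g gg gE] := E _ (cochain_l Hs (cochain_d hsg)).
have pE a : io *m (rf B a *m (ro *m h) - ro *m h *m rf X a) = 0.
  rewrite mulmxBr !mulmxA ir mul1mx -(proj2 Hi) -(mulmxA _ io) ir mulmx1 (proj2 hP).
  by rewrite subrr.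
have k0 : ro *m h - pi *m g = 0.
  apply: H; split; first by apply: gradedB => //; apply: graded_comp => //; case: Hp.
  move=> a; apply/eqP; rewrite -subr_eq0 mulmxBr mulmxBl subACA.
  have -> : rf B a *m (ro *m h) - ro *m h *m rf X a =
      pi *m (si *m (rf B a *m (ro *m h) - ro *m h *m rf X a)).
    by rewrite -[LHS]mul1mx -rp mulmxDl -[ro *m _ *m _]mulmxA pE mulmx0 add0r -mulmxA.
  by rewrite gE mulmxBr !mulmxA (proj2 Hp) subrr.
have hE : ro *m h = pi *m g by apply/eqP; rewrite -subr_eq0 k0.
by rewrite -[h]mul1mx -ir -mulmxA hE mulmxA ip mul0mx.
Qed.
Lemma ext0_connl : ext0 B X -> hom0 A X -> ext0 C X.
Proof.
have [io [pi [ro [si [[Hi Hp Hr Hs] [ir sp ip sr rp]]]]]] := S => E H phi phiP.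
have [h hg hE] := E _ (cochain_l (proj1 Hp) phiP).
have hp : io *m h = 0.
  apply: H; split; first by apply: graded_comp => //; case: Hi.
  move=> a; have := congr1 (mulmx io) (hE a).
  rewrite /= mulmxA ip mul0mx mulmxBr !mulmxA -(proj2 Hi) => /esym/eqP.
  by rewrite subr_eq0 => /eqP.
have hE' : h = pi *m (si *m h) by rewrite -{1}[h]mul1mx -rp mulmxDl -!mulmxA hp mulmx0 add0r.
exists (si *m h); first exact: graded_comp.
move=> a; rewrite -[LHS]mul1mx -sp -mulmxA hE mulmxBr !mulmxA; congr (_ - _).
by rewrite {1}hE' !mulmxA -(mulmxA si) (proj2 Hp) !mulmxA sp mul1mx.
Qed.
Lemma ext0_extr : ext0 X A -> ext0 X C -> ext0 X B.
Proof.
have [io [pi [ro [si [[Hi Hp Hr Hs] [ir sp ip sr rp]]]]]] := S => HA HC phi phiP.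
have [h hg hE] := HC _ (cochain_r (proj1 Hp) phiP).
pose psi a := phi a - (rf X a *m (h *m si) - h *m si *m rf B a).
have hsg : graded (h *m si) by apply: graded_comp.
have psiP : cochain psi.
  move=> a; have [p1 p2] := phiP a; have [q1 q2] := cochain_d hsg a.
  by rewrite /psi mulmxBr mulmxBl p1 p2 q1 q2.
have psi0 a : psi a *m pi = 0.
  rewrite /psi mulmxBl hE mulmxBl -!mulmxA sp mulmx1 (proj2 Hp) (mulmxA si) sp mul1mx.
  by rewrite subrr.
have [g gg gE] := HA _ (cochain_r Hr psiP).
exists (g *m io + h *m si).
  by apply: gradedD => //; apply: graded_comp => //; case: Hi.
move=> a; have -> : phi a = psi a + (rf X a *m (h *m si) - h *m si *m rf B a).
  by rewrite /psi subrK.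
have -> : psi a = psi a *m ro *m io.
  by rewrite -[LHS]mulmx1 -rp mulmxDr !mulmxA psi0 mul0mx addr0.
rewrite gE mulmxBl mulmxDr mulmxDl -!mulmxA -(proj2 Hi) !mulmxA.
by rewrite opprD addrACA.
Qed.
Lemma ext0_extl : ext0 A X -> ext0 C X -> ext0 B X.
Proof.
have [io [pi [ro [si [[Hi Hp Hr Hs] [ir sp ip sr rp]]]]]] := S => HA HC phi phiP.
have [h hg hE] := HA _ (cochain_l (proj1 Hi) phiP).
pose psi a := phi a - (rf B a *m (ro *m h) - ro *m h *m rf X a).
have hsg : graded (ro *m h) by apply: graded_comp.
have psiP : cochain psi.
  move=> a; have [p1 p2] := phiP a; have [q1 q2] := cochain_d hsg a.
  by rewrite /psi mulmxBr mulmxBl p1 p2 q1 q2.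
have psi0 a : io *m psi a = 0.
  rewrite /psi mulmxBr hE mulmxBr !mulmxA ir mul1mx -(proj2 Hi) -(mulmxA _ io) ir mulmx1.
  by rewrite subrr.
have [g gg gE] := HC _ (cochain_l Hs psiP).
exists (pi *m g + ro *m h).
  by apply: gradedD => //; apply: graded_comp => //; case: Hp.
move=> a; have -> : phi a = psi a + (rf B a *m (ro *m h) - ro *m h *m rf X a).
  by rewrite /psi subrK.
have -> : psi a = pi *m (si *m psi a).
  by rewrite -[LHS]mul1mx -rp mulmxDl -(mulmxA ro) psi0 mulmx0 add0r -mulmxA.
rewrite gE mulmxBr mulmxDr mulmxDl !mulmxA (proj2 Hp).
by rewrite opprD addrACA.
Qed.
Lemma cl_ses i : cl B i = cl A i + cl C i.
Proof.
have [io [pi [ro [si [[Hi Hp Hr Hs] [ir sp ip sr rp]]]]]] := S.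
rewrite /cl -PoszD; congr Posz; apply/eqP; rewrite -(@eqr_nat K) natrD /dimv.
rewrite !idem_rank_tr ?reMi //.
rewrite -[re B i]mulmx1 -rp mulmxDr linearD /= !mulmxA Hr (proj1 Hp).
rewrite -!mulmxA mxtrace_mulC -mulmxA ir mulmx1.
by rewrite mxtrace_mulC -mulmxA sp mulmx1.
Qed.
End Ses.

(** * The Euler form as dim Hom - dim Ext *)

Section Euler.
Variables M N : rep.
Let C0 := @fam_space K I I id id _ _ (re M) (re N).
Let C1 := @fam_space K I Ar s t _ _ (re M) (re N).

Definition diff_fam (phi : {ffun I -> 'M[K]_(rdim M, rdim N)}) :
    {ffun Ar -> 'M[K]_(rdim M, rdim N)} :=
  [ffun a => rf M a *m phi (t a) - phi (s a) *m rf N a].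
Fact diff_fam_linear : linear diff_fam.
Proof.
move=> c u v; apply/ffunP => a; rewrite !ffunE !mulmxDr !mulmxDl -!scalemxAr -!scalemxAl.
by rewrite scalerBr opprD addrACA.
Qed.
HB.instance Definition _ := GRing.isLinear.Build K _ _ _ diff_fam diff_fam_linear.

Definition sum_fam (phi : {ffun I -> 'M[K]_(rdim M, rdim N)}) : 'M[K]_(rdim M, rdim N) :=
  \sum_i phi i.
Fact sum_fam_linear : linear sum_fam.
Proof.
move=> c u v; rewrite /sum_fam scaler_sumr -big_split /=; apply: eq_bigr => i _.
by rewrite !ffunE.
Qed.
HB.instance Definition _ := GRing.isLinear.Build K _ _ _ sum_fam sum_fam_linear.

Definition hom_space : {vspace 'M[K]_(rdim M, rdim N)} :=
  (linfun sum_fam @: (C0 :&: lker (linfun diff_fam)))%VS.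

Let C0P (phi : {ffun I -> 'M[K]_(rdim M, rdim N)}) : phi \in C0 <->
  forall i, re M i *m phi i = phi i /\ phi i *m re N i = phi i.
Proof. by split=> [/(fam_spaceP _ _ (reMi M) (reMi N)) | ?]; last apply/(fam_spaceP _ _ (reMi M) (reMi N)). Qed.
Let C1P (phi : {ffun Ar -> 'M[K]_(rdim M, rdim N)}) : phi \in C1 <->
  forall a, re M (s a) *m phi a = phi a /\ phi a *m re N (t a) = phi a.
Proof. by split=> [/(fam_spaceP _ _ (reMi M) (reMi N)) | ?]; last apply/(fam_spaceP _ _ (reMi M) (reMi N)). Qed.

Let fam_of (h : 'M[K]_(rdim M, rdim N)) := [ffun i => re M i *m h].
Let fam_ofP h : graded h -> fam_of h \in C0.
Proof.
by move=> hP; apply/C0P => i; rewrite ffunE mulmxA reMi -mulmxA -hP mulmxA reMi.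
Qed.
Let fam_ofK h : sum_fam (fam_of h) = h.
Proof.
rewrite /sum_fam -[RHS]mul1mx -(re_sum M) mulmx_suml.
by apply: eq_bigr => i _; rewrite ffunE.
Qed.
Let sum_re phi i : phi \in C0 -> re M i *m sum_fam phi = phi i.
Proof.
move=> /C0P P; rewrite /sum_fam mulmx_sumr (bigD1 i) //= big1 ?addr0 ?(proj1 (P i)) //.
by move=> j ji; rewrite -(proj1 (P j)) mulmxA reM eq_sym (negPf ji) mul0mx.
Qed.
Let sum_re' phi i : phi \in C0 -> sum_fam phi *m re N i = phi i.
Proof.
move=> /C0P P; rewrite /sum_fam mulmx_suml (bigD1 i) //= big1 ?addr0 ?(proj2 (P i)) //.
by move=> j ji; rewrite -(proj2 (P j)) -mulmxA reM (negPf ji) mulmx0.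
Qed.
Let sum_graded phi : phi \in C0 -> graded (sum_fam phi).
Proof. by move=> P i; rewrite sum_re // sum_re'. Qed.
Let diff_sum phi a : phi \in C0 ->
  diff_fam phi a = rf M a *m sum_fam phi - sum_fam phi *m rf N a.
Proof.
move=> P; rewrite ffunE -{2}(rft M) -{2}(rfs N) -mulmxA sum_re // mulmxA sum_re' //.
Qed.

Lemma hom_spaceP (h : 'M[K]_(rdim M, rdim N)) : reflect (ishom h) (h \in hom_space).
Proof.
apply: (iffP memv_imgP) => [[phi]|[hg hh]].
  rewrite memv_cap memv_ker lfunE /= => /andP[P /eqP D] ->; rewrite lfunE /=.
  split; first exact: sum_graded.
  by move=> a; apply/eqP; rewrite -subr_eq0 -diff_sum // D ffunE.
exists (fam_of h); last by rewrite lfunE /= fam_ofK.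
rewrite memv_cap fam_ofP // memv_ker lfunE /=; apply/eqP/ffunP => a.
by rewrite diff_sum ?fam_ofP // fam_ofK hh subrr ffunE.
Qed.

Let im_sub : (linfun diff_fam @: C0 <= C1)%VS.
Proof.
apply/subvP => _ /memv_imgP[phi P ->]; rewrite lfunE /=; apply/C1P => a.
by rewrite diff_sum //; exact: (cochain_d (sum_graded P)).
Qed.

Lemma ext0P : ext0 M N <-> (linfun diff_fam @: C0)%VS = C1.
Proof.
split=> [H|H phi P].
  apply/eqP; rewrite eqEsubv im_sub; apply/subvP => phi /C1P P.
  have [h hg hE] := H _ P; apply/memv_imgP; exists (fam_of h); first exact: fam_ofP.
  by apply/ffunP => a; rewrite lfunE /= diff_sum ?fam_ofP // fam_ofK -hE.
have : [ffun a => phi a] \in C1 by apply/C1P => a; rewrite !ffunE; exact: P.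
rewrite -H => /memv_imgP[psi psiP E]; exists (sum_fam psi); first exact: sum_graded.
by move=> a; have /ffunP/(_ a) := E; rewrite lfunE /= ffunE diff_sum.
Qed.

Definition ext_dim : nat := (\dim C1 - \dim (linfun diff_fam @: C0))%N.

Lemma dim_hom_space : \dim hom_space = \dim (C0 :&: lker (linfun diff_fam)).
Proof.
apply: limg_dim_eq; apply/eqP; rewrite -subv0; apply/subvP => phi.
rewrite !memv_cap !memv_ker !lfunE /= -andbA => /and3P[P _ /eqP E].
rewrite memv0; apply/eqP/ffunP => i.
by rewrite -(sum_re _ P) E mulmx0 ffunE.
Qed.

(** Rank-nullity for the differential of the two-term complex, whose terms have the two dimensions
    that occur in the Euler form. *)
Lemma euler_dim : (\dim hom_space)%:Z - ext_dim%:Z = euler_form (cl M) (cl N).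
Proof.
rewrite dim_hom_space /ext_dim -subzn ?dimvS //.
have <- : (\dim C0)%:Z - (\dim C1)%:Z = euler_form (cl M) (cl N).
  rewrite /C0 /C1 !dim_fam_space //; try exact: reMi.
  rewrite /euler_form !(big_morph Posz PoszD (erefl _)).
  by congr (_ - _); apply: eq_bigr => i _; rewrite PoszM.
by rewrite -(limg_ker_dim (linfun diff_fam) C0) PoszD opprB addrA.
Qed.
End Euler.

Definition chi M N := euler_form (cl M) (cl N).

Lemma hom0P M N : hom0 M N <-> \dim (hom_space M N) = 0%N.
Proof.
split=> [H|/eqP]; last first.
  by rewrite dimv_eq0 => /eqP E h /hom_spaceP; rewrite E memv0 => /eqP.
apply/eqP; rewrite dimv_eq0 -subv0; apply/subvP => h /hom_spaceP/H ->; exact: mem0v.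
Qed.

Lemma ext_dimP M N : ext0 M N <-> ext_dim M N = 0%N.
Proof.
rewrite /ext_dim; split=> [/ext0P->|/eqP]; first by rewrite subnn.
rewrite subn_eq0 => H; apply/ext0P/eqP; rewrite eqEdim H andbT.
apply/subvP => _ /memv_imgP[phi P ->]; rewrite lfunE /=.
move/(fam_spaceP _ _ (reMi M) (reMi N)): P => P.
apply/(fam_spaceP _ _ (reMi M) (reMi N)) => a; rewrite ffunE mulmxBr mulmxBl.
have [p1 p2] := P (s a); have [q1 q2] := P (t a).
rewrite /= in p1 p2 q1 q2.
by rewrite !mulmxA rfs p1 -!mulmxA q2 rft.
Qed.

Lemma chi_le0 M N : hom0 M N -> chi M N <= 0.
Proof. by move=> /hom0P h; rewrite /chi -euler_dim h sub0r oppr_le0. Qed.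
Lemma chi_ge0 M N : ext0 M N -> 0 <= chi M N.
Proof. by move=> /ext_dimP h; rewrite /chi -euler_dim h subr0. Qed.
Lemma ext0_chi M N : hom0 M N -> chi M N = 0 -> ext0 M N.
Proof. by move=> /hom0P h; rewrite /chi -euler_dim h => e; apply/ext_dimP; lia. Qed.
Lemma hom0_chi M N : ext0 M N -> chi M N = 0 -> hom0 M N.
Proof. by move=> /ext_dimP h; rewrite /chi -euler_dim h => e; apply/hom0P; lia. Qed.

Definition exc M := ext0 M M /\ chi M M = 1.

Lemma exc_dim M : exc M -> \dim (hom_space M M) = 1%N.
Proof. by move=> [/ext_dimP h]; rewrite /chi -euler_dim h; lia. Qed.

(** Vanishing of Ext and chi = 1 leave a one-dimensional space of endomorphisms, spanned by the
    identity. *)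
Lemma exc_scalar M (h : 'M_(rdim M, rdim M)) : exc M -> ishom h -> exists c, h = c%:M.
Proof.
move=> /exc_dim d /hom_spaceP hP.
have m1 : (1%:M : 'M[K]_(rdim M)) \in hom_space M M by apply/hom_spaceP; exact: ishom1.
have n1 : (1%:M : 'M[K]_(rdim M)) != 0.
  apply: contraTneq (isT) => E; have /eqP := d.
  have -> : hom_space M M = 0%VS.
    apply/eqP; rewrite -subv0; apply/subvP => g _; rewrite memv0.
    by rewrite -[g]mulmx1 E mulmx0.
  by rewrite dimv0.
have E : (<[1%:M : 'M[K]_(rdim M)]> = hom_space M M)%VS.
  by apply/eqP; rewrite eqEdim -memvE m1 dim_vline n1 d.
by move: hP; rewrite -E => /vlineP[c ->]; exists c; rewrite scalemx1.
Qed.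

Definition nullrep M := rdim M = 0%N.

Lemma null_hom0l M X : nullrep M -> hom0 M X.
Proof. by move=> M0 h _; apply/matrixP => i; have := ltn_ord i; rewrite {2}M0. Qed.
Lemma null_hom0r M X : nullrep M -> hom0 X M.
Proof. by move=> M0 h _; apply/matrixP => i j; have := ltn_ord j; rewrite {2}M0. Qed.
Lemma null_ext0l M X : nullrep M -> ext0 M X.
Proof.
move=> M0 phi _; exists 0; first by case: (ishom0 M X).
by move=> a; apply/matrixP => i; have := ltn_ord i; rewrite {2}M0.
Qed.
Lemma null_ext0r M X : nullrep M -> ext0 X M.
Proof.
move=> M0 phi _; exists 0; first by case: (ishom0 X M).
by move=> a; apply/matrixP => i j; have := ltn_ord j; rewrite {2}M0.
Qed.

Lemma sum_dimv M : (\sum_i dimv M i)%N = rdim M.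
Proof.
apply/eqP; rewrite -(@eqr_nat K) natr_sum.
under eq_bigr => i _ do rewrite idem_rank_tr ?reMi //.
by rewrite -linear_sum re_sum /= mxtrace1.
Qed.

Lemma nullP M : nullrep M <-> \sum_i cl M i = 0.
Proof.
by rewrite /nullrep -sum_dimv /cl -(big_morph Posz PoszD (erefl _)); split=> [-> //|[]].
Qed.

(** * Images, kernels, cokernels and extensions *)

Lemma row_base_pinv m n (A : 'M[K]_(m, n)) : exists r (R : 'M_(r, n)) (R' : 'M_(n, r)),
  [/\ (R :=: A)%MS, row_free R, R *m R' = 1%:M &
      forall p (X : 'M_(p, n)), (X <= R)%MS -> X *m R' *m R = X].
Proof.
have Rf : row_free (row_base A) by exact: row_base_free.
exists _, (row_base A), (pinvmx (row_base A)); split=> //; first exact: eq_row_base.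
  exact: mulmxVp.
by move=> p X; exact: mulmxKpV.
Qed.

Section Sub.
Variables (M : rep) (r : nat) (ka : 'M[K]_(r, rdim M)).
Variable ka' : 'M[K]_(rdim M, r).
Hypothesis kaK : ka *m ka' = 1%:M.
Hypothesis kae' : forall i, ka *m re M i *m ka' *m ka = ka *m re M i.
Hypothesis kaf' : forall a, ka *m rf M a *m ka' *m ka = ka *m rf M a.

Fact sub_reM i j : (ka *m re M i *m ka') *m (ka *m re M j *m ka') =
  if i == j then ka *m re M i *m ka' else 0.
Proof.
rewrite !mulmxA kae' -(mulmxA ka) reM; case: ifP => // _.
by rewrite mulmx0 mul0mx.
Qed.
Fact sub_re_sum : \sum_i (ka *m re M i *m ka') = 1%:M.
Proof. by rewrite -mulmx_suml -mulmx_sumr re_sum mulmx1. Qed.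
Fact sub_rfs a : (ka *m re M (s a) *m ka') *m (ka *m rf M a *m ka') = ka *m rf M a *m ka'.
Proof. by rewrite !mulmxA kae' -(mulmxA ka) rfs. Qed.
Fact sub_rft a : (ka *m rf M a *m ka') *m (ka *m re M (t a) *m ka') = ka *m rf M a *m ka'.
Proof. by rewrite !mulmxA kaf' -(mulmxA ka) rft. Qed.

Definition subrep := Rep sub_reM sub_re_sum sub_rfs sub_rft.
Lemma subrep_hom : @ishom subrep M ka.
Proof. by split=> [i|a] /=; [exact: kae' | exact: kaf']. Qed.
End Sub.

Lemma image_factor M N (h : 'M_(rdim M, rdim N)) : ishom h ->
  exists J (p : 'M_(rdim M, rdim J)) (i : 'M_(rdim J, rdim N)),
    [/\ ishom p, ishom i, h = p *m i, row_full p & row_free i].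
Proof.
move=> [hg hh]; have [r [R [R' [RE Rf RR' RX]]]] := row_base_pinv h.
have st (X : 'M_(rdim M)) (Y : 'M_(rdim N)) : X *m h = h *m Y -> (R *m Y <= R)%MS.
  move=> E; rewrite (eqmxMr _ RE) RE -E; exact: submxMl.
have Re i : (R *m re N i <= R)%MS by apply: st; exact: hg.
have Rr a : (R *m rf N a <= R)%MS by apply: st; exact: hh.
have hR : h *m R' *m R = h by apply: RX; rewrite RE.
exists (subrep RR' (fun i => RX _ _ (Re i)) (fun a => RX _ _ (Rr a))), (h *m R'), R; split=> //.
- split=> [i|a] /=; rewrite !mulmxA hR; first by rewrite hg.
  by rewrite hh.
- exact: subrep_hom.
- rewrite /row_full eqn_leq rank_leq_col /=.
  have rR : \rank R = r by apply/eqP.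
  suff : (\rank R <= \rank (h *m R'))%N by rewrite rR.
  by rewrite RE -{1}hR mxrankM_maxl.
Qed.

(** A linear retraction becomes graded after averaging over the idempotents. The complementary
    idempotent [1 - ro io] then factors as [L R] through its image, which carries the cokernel. *)
Lemma mono_ses A B (io : 'M_(rdim A, rdim B)) : ishom io -> row_free io ->
  exists C (pi : 'M_(rdim B, rdim C)) (ro : 'M_(rdim B, rdim A)) (si : 'M_(rdim C, rdim B)),
  [/\ ishom io, ishom pi, graded ro & graded si] /\
  [/\ io *m ro = 1%:M, si *m pi = 1%:M, io *m pi = 0, si *m ro = 0
    & ro *m io + pi *m si = 1%:M].
Proof.
move=> Hi iof; have : io *m pinvmx io = 1%:M by exact: mulmxVp.
move: (pinvmx io) => io' iK; pose ro := \sum_i re B i *m io' *m re A i.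
have rog : graded ro.
  move=> j; rewrite mulmx_sumr mulmx_suml (bigD1 j) //= [RHS](bigD1 j) //= !big1 ?addr0.
  - by rewrite !mulmxA reMi -!mulmxA reMi.
  - by move=> i ij; rewrite -mulmxA reM (negPf ij) mulmx0.
  - by move=> i ij; rewrite !mulmxA reM eq_sym (negPf ij) !mul0mx.
have ir : io *m ro = 1%:M.
  rewrite mulmx_sumr -(re_sum A); apply: eq_bigr => i _.
  by rewrite !mulmxA -(proj1 Hi) -(mulmxA _ io) iK mulmx1 reMi.
pose p := 1%:M - ro *m io.
have pp : p *m p = p.
  rewrite /p mulmxBl mul1mx mulmxBr mulmx1 -!mulmxA (mulmxA io) ir mul1mx.
  by rewrite subrr subr0.
have pE : col_base p *m row_base p = p := mulmx_base p.
have RL := idem_row_col pp.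
move: (\rank p) (col_base p) (row_base p) pE RL => r L R pE RL.
have iop : io *m p = 0 by rewrite /p mulmxBr mulmx1 mulmxA ir mul1mx subrr.
have iL : io *m L = 0.
  by rewrite -[L]mulmx1 -RL (mulmxA L) pE mulmxA iop mul0mx.
have Rro : R *m ro = 0.
  have pro : p *m ro = 0 by rewrite /p mulmxBl mul1mx -mulmxA ir mulmx1 subrr.
  by rewrite -[R]mul1mx -RL -(mulmxA R) pE -mulmxA pro mulmx0.
have pg i : re B i *m p = p *m re B i.
  by rewrite mulmxBr mulmxBl mulmx1 mul1mx mulmxA rog -!mulmxA (proj1 Hi).
have eL i : L *m (R *m re B i *m L) = re B i *m L.
  by rewrite !mulmxA pE -pg -mulmxA -pE -(mulmxA L) RL mulmx1.
have eR i : R *m re B i *m L *m R = R *m re B i.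
  by rewrite -!mulmxA pE pg mulmxA -pE !mulmxA RL mul1mx.
have fL a : L *m (R *m rf B a *m L) = rf B a *m L.
  rewrite !mulmxA pE /p mulmxBl mul1mx mulmxBl -!mulmxA (mulmxA io) -(proj2 Hi).
  by rewrite -mulmxA iL !mulmx0 subr0.
have reC i j : (R *m re B i *m L) *m (R *m re B j *m L) =
    if i == j then R *m re B i *m L else 0.
  by rewrite !mulmxA eR -(mulmxA R) reM; case: ifP => // _; rewrite mulmx0 mul0mx.
have sumC : \sum_i R *m re B i *m L = 1%:M.
  by rewrite -mulmx_suml -mulmx_sumr re_sum mulmx1.
have sC a : (R *m re B (s a) *m L) *m (R *m rf B a *m L) = R *m rf B a *m L.
  by rewrite !mulmxA eR -(mulmxA R) rfs.
have tC a : (R *m rf B a *m L) *m (R *m re B (t a) *m L) = R *m rf B a *m L.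
  by rewrite -(mulmxA _ L) eL !mulmxA -(mulmxA R) rft.
exists (Rep reC sumC sC tC), L, ro, R; split; split=> //=.
- by split=> [i|a] /=; [rewrite eL | rewrite fL].
- by have -> : L *m R = 1%:M - ro *m io := pE; rewrite addrC subrK.
Qed.

Lemma epi_ses B C (pi : 'M_(rdim B, rdim C)) : ishom pi -> row_full pi ->
  exists A (io : 'M_(rdim A, rdim B)) (ro : 'M_(rdim B, rdim A)) (si : 'M_(rdim C, rdim B)),
  [/\ ishom io, ishom pi, graded ro & graded si] /\
  [/\ io *m ro = 1%:M, si *m pi = 1%:M, io *m pi = 0, si *m ro = 0
    & ro *m io + pi *m si = 1%:M].
Proof.
move=> Hp pif; have : pinvmx pi *m pi = 1%:M by exact: mulVpmx.
move: (pinvmx pi) => pi' pK; pose si := \sum_i re C i *m pi' *m re B i.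
have sig : graded si.
  move=> j; rewrite mulmx_sumr mulmx_suml (bigD1 j) //= [RHS](bigD1 j) //= !big1 ?addr0.
  - by rewrite !mulmxA reMi -!mulmxA reMi.
  - by move=> i ij; rewrite -mulmxA reM (negPf ij) mulmx0.
  - by move=> i ij; rewrite !mulmxA reM eq_sym (negPf ij) !mul0mx.
have sp : si *m pi = 1%:M.
  rewrite mulmx_suml -(re_sum C); apply: eq_bigr => i _.
  by rewrite -!mulmxA (proj1 Hp) (mulmxA pi') pK mul1mx reMi.
have [r [R [R' [RE Rf RR' RX]]]] := row_base_pinv (kermx pi).
have Rpi : R *m pi = 0 by apply/sub_kermxP; rewrite RE.
have Re i : (R *m re B i <= R)%MS.
  by rewrite RE; apply/sub_kermxP; rewrite -mulmxA (proj1 Hp) mulmxA Rpi mul0mx.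
have Rr a : (R *m rf B a <= R)%MS.
  by rewrite RE; apply/sub_kermxP; rewrite -mulmxA (proj2 Hp) mulmxA Rpi mul0mx.
have [A [io [Hi iof iopi [ro roR]]]] : exists A (io : 'M_(rdim A, rdim B)),
    [/\ ishom io, row_free io, io *m pi = 0 &
       exists ro : 'M_(rdim B, rdim A), ro *m io = 1%:M - pi *m si].
  exists (subrep RR' (fun i => RX _ _ (Re i)) (fun a => RX _ _ (Rr a))), R; split=> //.
    exact: subrep_hom.
  exists ((1%:M - pi *m si) *m R'); apply: (RX _ (1%:M - pi *m si)).
  rewrite RE; apply/sub_kermxP.
  by rewrite mulmxBl mul1mx -mulmxA sp mulmx1 subrr.
exists A, io, ro, si; split; split=> //.
- move=> i; apply: (row_free_inj iof); rewrite -!mulmxA roR (proj1 Hi) mulmxA roR.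
  by rewrite mulmxBr mulmxBl mulmx1 mul1mx mulmxA (proj1 Hp) -!mulmxA sig.
- by apply: (row_free_inj iof); rewrite -mulmxA roR mulmxBr mulmx1 mulmxA iopi mul0mx subr0 mul1mx.
- by apply: (row_free_inj iof); rewrite -mulmxA roR mulmxBr mulmx1 mulmxA sp mul1mx subrr mul0mx.
- by rewrite roR subrK.
Qed.

Section Extension.
Variables (M N : rep) (phi : Ar -> 'M[K]_(rdim M, rdim N)).
Hypothesis phiP : cochain phi.
Let e i : 'M[K]_(rdim M + rdim N) := block_mx (re M i) 0 0 (re N i).
Let f a : 'M[K]_(rdim M + rdim N) := block_mx (rf M a) (phi a) 0 (rf N a).
Fact extn_reM i j : e i *m e j = if i == j then e i else 0.
Proof.
rewrite /e mulmx_block !mulmx0 !mul0mx !addr0 !add0r !reM.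
by case: ifP => _ //; rewrite block_mx0.
Qed.
Fact extn_re_sum : \sum_i e i = 1%:M.
Proof.
have E (r : seq I) : \sum_(i <- r) e i =
    block_mx (\sum_(i <- r) re M i) 0 0 (\sum_(i <- r) re N i).
  elim: r => [|i r IH]; first by rewrite !big_nil block_mx0.
  by rewrite !big_cons IH /e add_block_mx !addr0.
by rewrite E !re_sum -scalar_mx_block.
Qed.
Fact extn_rfs a : e (s a) *m f a = f a.
Proof.
rewrite /e /f mulmx_block !mulmx0 !mul0mx !addr0 !add0r !rfs.
by rewrite (proj1 (phiP a)).
Qed.
Fact extn_rft a : f a *m e (t a) = f a.
Proof.
rewrite /e /f mulmx_block !mulmx0 !mul0mx !addr0 !add0r !rft.
by rewrite (proj2 (phiP a)).
Qed.
Definition extn := Rep extn_reM extn_re_sum extn_rfs extn_rft.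
Definition extn_in : 'M[K]_(rdim N, rdim extn) := row_mx 0 1%:M.
Definition extn_out : 'M[K]_(rdim extn, rdim M) := col_mx 1%:M 0.
Definition extn_ret : 'M[K]_(rdim extn, rdim N) := col_mx 0 1%:M.
Definition extn_sec : 'M[K]_(rdim M, rdim extn) := row_mx 1%:M 0.

Lemma extn_ses :
  [/\ ishom extn_in, ishom extn_out, graded extn_ret & graded extn_sec] /\
  [/\ extn_in *m extn_ret = 1%:M, extn_sec *m extn_out = 1%:M, extn_in *m extn_out = 0,
      extn_sec *m extn_ret = 0 & extn_ret *m extn_in + extn_out *m extn_sec = 1%:M].
Proof.
rewrite /extn_in /extn_out /extn_ret /extn_sec; split; split; try split=> [i|a]; rewrite /= /e /f.
- by rewrite mul_mx_row mul_row_block !mulmx0 !mul0mx !addr0 !add0r mulmx1 mul1mx.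
- by rewrite mul_mx_row mul_row_block !mulmx0 !mul0mx !addr0 !add0r mulmx1 mul1mx.
- by rewrite mul_block_col mul_col_mx !mulmx0 !mul0mx !addr0 mulmx1 mul1mx.
- by rewrite mul_block_col mul_col_mx !mulmx0 !mul0mx !addr0 mulmx1 mul1mx.
- by move=> i; rewrite /= /e mul_block_col mul_col_mx !mulmx0 !mul0mx !addr0 !add0r mulmx1 mul1mx.
- by move=> i; rewrite /= /e mul_mx_row mul_row_block !mulmx0 !mul0mx !addr0 mulmx1 mul1mx.
- by rewrite mul_row_col mulmx0 mulmx1 add0r.
- by rewrite mul_row_col mulmx0 mulmx1 addr0.
- by rewrite mul_row_col mulmx0 mul0mx addr0.
- by rewrite mul_row_col mulmx0 mul0mx addr0.
- rewrite !mul_col_row !mulmx0 !mul0mx !mulmx1 add_block_mx !addr0 !add0r.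
  by rewrite -scalar_mx_block.
Qed.
End Extension.

Lemma sesI A B C (io : 'M_(rdim A, rdim B)) (pi : 'M_(rdim B, rdim C))
    (ro : 'M_(rdim B, rdim A)) (si : 'M_(rdim C, rdim B)) :
  [/\ ishom io, ishom pi, graded ro & graded si] /\
  [/\ io *m ro = 1%:M, si *m pi = 1%:M, io *m pi = 0, si *m ro = 0
    & ro *m io + pi *m si = 1%:M] -> ses A B C.
Proof. by move=> H; exists io, pi, ro, si. Qed.

Definition ext_closed (P : rep -> Prop) :=
  (forall Z, nullrep Z -> P Z) /\ (forall A B C, ses A B C -> P A -> P C -> P B).

(* Kill [Ext(M, N)] one dimension at a time. *)
Lemma universal_ext M N : exc N -> hom0 M N ->
  exists B (a : nat), [/\ chi M N = - a%:Z, forall i, cl B i = cl M i + a%:Z * cl N i,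
    hom0 B N, ext0 B N & forall P, ext_closed P -> P M -> P N -> P B].
Proof.
move=> eN; have [k] := ubnP (absz (chi M N)).
elim: k M => // k IH M kM hMN.
have [/eqP c0|c0] := boolP (chi M N == 0).
  exists M, 0%N; rewrite c0; split=> //; last exact: ext0_chi.
  by move=> i; rewrite mul0r addr0.
have cneg : chi M N < 0 by rewrite lt_neqAle c0 chi_le0.
have nE : ~ ext0 M N by move=> /chi_ge0; rewrite leNgt cneg.
have [phi [phiP phiN]] : exists phi, @cochain M N phi /\
   ~ exists2 h, @graded M N h & forall a, phi a = rf M a *m h - h *m rf N a.
  apply: contrapT => H; apply: nE => phi P; apply: contrapT => Q.
  by apply: H; exists phi.
have S := extn_ses phiP; set B := extn phiP in S.
have SB : ses N B M := sesI S.
have [[Hi Hp Hr Hs] [ir sp ip sr rp]] := S.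
(* A map B -> N restricts to a scalar c on N. If c is nonzero, a multiple of the map is a
   retraction, against the choice of [phi]; if c = 0, the map factors through M. *)
have hBN : hom0 B N.
  move=> h hP; have [c cE] := exc_scalar eN (ishom_comp Hi hP).
  have c0' : c = 0.
    apply: contrapT => /eqP cn0; apply: phiN; pose h' := c^-1 *: h.
    have h'P : ishom h' by exact: ishomZ.
    have ih' : extn_in phiP *m h' = 1%:M.
      by rewrite -scalemxAr cE scale_scalar_mx mulVf.
    exists (- (extn_sec phiP *m h')).
      move=> i; rewrite mulmxN mulNmx; congr (- _).
      by apply: graded_comp => //; case: h'P.
    move=> a; have /(congr1 (mulmx (extn_sec phiP))) := proj2 h'P a.
    rewrite mulmxN mulNmx opprK mulmxA (mulmxA _ h').
    have -> : extn_sec phiP *m rf B a = rf M a *m extn_sec phiP + phi a *m extn_in phiP.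
      rewrite /extn_sec /extn_in /= mul_row_block !mul_mx_row !mulmx0 !mul0mx !addr0 !mul1mx !mulmx1.
      by rewrite add_row_mx add0r addr0.
    rewrite mulmxDl -!mulmxA ih' mulmx1 !mulmxA => <-.
    by rewrite addKr.
  have ih0 : extn_in phiP *m h = 0.
    by rewrite cE c0'; apply/matrixP => x y; rewrite !mxE mul0rn.
  have hE : h = extn_out phiP *m (extn_sec phiP *m h).
    by rewrite -{1}[h]mul1mx -rp mulmxDl -!mulmxA ih0 mulmx0 add0r.
  suff H : extn_sec phiP *m h = 0 by rewrite hE H mulmx0.
  apply: hMN; split; first by apply: graded_comp => //; case: hP.
  move=> a; rewrite -[LHS]mul1mx -sp -mulmxA (mulmxA (extn_out _)).
  by rewrite -(proj2 Hp) -(mulmxA (rf B a)) -hE (proj2 hP) mulmxA.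
have cB : chi B N = chi M N + 1.
  rewrite -(proj2 eN) /chi /euler_form addrACA -opprD -!big_split /=.
  by congr (_ - _); apply: eq_bigr => i _; rewrite (cl_ses SB) mulrDl addrC.
have [|B' [a [aE clE h1 h2 h3]]] := IH B _ hBN; first by rewrite cB; lia.
exists B', a.+1; split=> //; first by move: aE; rewrite cB; lia.
  by move=> i; rewrite clE (cl_ses SB) -addn1 PoszD; lra.
by move=> P Pc PM PN; apply: h3 => //; apply: (proj2 Pc) SB PN PM.
Qed.

Lemma hom_extend A B C X (io : 'M_(rdim A, rdim B)) (pi : 'M_(rdim B, rdim C))
    (ro : 'M_(rdim B, rdim A)) (si : 'M_(rdim C, rdim B)) (h : 'M_(rdim A, rdim X)) :
  [/\ ishom io, ishom pi, graded ro & graded si] /\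
  [/\ io *m ro = 1%:M, si *m pi = 1%:M, io *m pi = 0, si *m ro = 0
    & ro *m io + pi *m si = 1%:M] ->
  ext0 C X -> ishom h -> exists2 h' : 'M_(rdim B, rdim X), ishom h' & io *m h' = h.
Proof.
move=> [[Hi Hp Hr Hs] [ir sp ip sr rp]] E hP.
have hsg : graded (ro *m h) by apply: graded_comp => //; case: hP.
have [g gg gE] := E _ (cochain_l Hs (cochain_d hsg)).
have pE a : io *m (rf B a *m (ro *m h) - ro *m h *m rf X a) = 0.
  rewrite mulmxBr !mulmxA ir mul1mx -(proj2 Hi) -(mulmxA _ io) ir mulmx1 (proj2 hP).
  by rewrite subrr.
exists (ro *m h - pi *m g); last by rewrite mulmxBr !mulmxA ir ip mul1mx mul0mx subr0.
split; first by apply: gradedB => //; apply: graded_comp => //; case: Hp.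
move=> a; apply/eqP; rewrite -subr_eq0 mulmxBr mulmxBl subACA.
have -> : rf B a *m (ro *m h) - ro *m h *m rf X a =
    pi *m (si *m (rf B a *m (ro *m h) - ro *m h *m rf X a)).
  by rewrite -[LHS]mul1mx -rp mulmxDl -[ro *m _ *m _]mulmxA pE mulmx0 add0r -mulmxA.
by rewrite gE mulmxBr !mulmxA (proj2 Hp) subrr.
Qed.

(* Lifting the extension of the cokernel by the image along [M ->> image] (the source has
   no extension with the target) produces an endomorphism of the brick [M]. *)
Lemma mono_or_split M V (F : 'M_(rdim M, rdim V)) : exc M -> ext0 V M -> ishom F ->
  row_free F \/ exists J (p : 'M_(rdim M, rdim J)) (i : 'M_(rdim J, rdim V))
    (P : 'M_(rdim V, rdim J)),
    [/\ F = p *m i, row_full p, ishom p, ishom i & ishom P] /\ i *m P = 1%:M.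
Proof.
move=> eM eVM /image_factor[J [p [i [pP iP FE pf inj]]]].
have [C [pi [ro [si [[_ Hp Hr Hs] [ir sp ip sr rp]]]]]] := mono_ses iP inj.
have [L [_ [_ [s' [[_ _ _ sg] [_ s'p _ _ _]]]]]] := epi_ses pP pf.
have [h hg hE] := eVM _ (cochain_r sg (cochain_d Hr)).
have di a : i *m (rf V a *m ro - ro *m rf J a) = 0.
  by rewrite mulmxBr !mulmxA ir mul1mx -(proj2 iP) -mulmxA ir mulmx1 subrr.
have ihP : ishom (i *m h).
  split; first by apply: graded_comp => //; case: iP.
  move=> a; have := congr1 (mulmx i) (hE a); rewrite /= mulmxA di mul0mx mulmxBr !mulmxA.
  by rewrite -(proj2 iP) => /esym/eqP; rewrite subr_eq0 => /eqP.
have [c cE] := exc_scalar eM (ishom_comp pP ihP).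
have [c0|c0] := eqVneq c 0; last first.
  left; rewrite FE /row_free; apply/row_freeP.
  have [i' ii'] : exists i', i *m i' = 1%:M by apply/row_freeP.
  exists (i' *m (c^-1 *: (i *m h))); rewrite mulmxA -(mulmxA p) ii' mulmx1.
  by rewrite -scalemxAr cE scale_scalar_mx mulVf.
right; have ih0 : i *m h = 0.
  apply: (row_full_inj pf); rewrite cE c0 mulmx0.
  by apply/matrixP => x y; rewrite !mxE mul0rn.
exists J, p, i, (ro - h *m p); split; last first.
  by rewrite mulmxBr ir mulmxA ih0 mul0mx subr0.
split=> //; split; first by apply: gradedB => //; apply: graded_comp => //; case: pP.
move=> a; apply/eqP; rewrite -subr_eq0 mulmxBr mulmxBl subACA.
have -> : rf V a *m (h *m p) - h *m p *m rf J a = (rf V a *m h - h *m rf M a) *m p.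
  by rewrite mulmxBl -!mulmxA (proj2 pP).
by rewrite -hE -mulmxA s'p mulmx1 subrr.
Qed.

(** In the split case the image is a nonzero summand of the brick N, hence all of N: the idempotent
    [P i] is a scalar c with c i = i. *)
Lemma exc_pair_map M N : exc M -> exc N -> ext0 N M -> ~ hom0 M N ->
  (exists K', ses K' M N) \/ (exists C, ses M N C).
Proof.
move=> eM eN eNM nH.
have [F FP F0] : exists2 F : 'M_(rdim M, rdim N), ishom F & F <> 0.
  apply: contrapT => H; apply: nH => h hP; apply: contrapT => h0; apply: H.
  by exists h.
have [Ff|[J [p [i [P [[FE pf pP iP PP] iP1]]]]]] := mono_or_split eM eNM FP.
  by right; have [C [pi [ro [si H]]]] := mono_ses FP Ff; exists C; exists F, pi, ro, si.
left; have [c cE] := exc_scalar eN (ishom_comp PP iP).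
have ci : c *: i = i by rewrite -mul_mx_scalar -cE mulmxA iP1 mul1mx.
have c1 : c = 1.
  apply/eqP; rewrite -subr_eq0; apply/eqP; apply: contrapT => /eqP c1; apply: F0.
  have : (c - 1) *: i = 0 by rewrite scalerBl ci scale1r subrr.
  by move=> /eqP; rewrite scaler_eq0 (negPf c1) /= => /eqP i0; rewrite FE i0 mulmx0.
have Ff : row_full F.
  apply/row_fullP; have [p' pp'] : exists p', p' *m p = 1%:M by apply/row_fullP.
  by exists (P *m p'); rewrite FE mulmxA -(mulmxA P) pp' mulmx1 cE c1.
by have [K' [io [ro [si H]]]] := epi_ses FP Ff; exists K'; exists io, F, ro, si.
Qed.

Lemma image_ses M N : ~ hom0 M N ->
  exists K' J C, [/\ ses K' M J, ses J N C & ~ nullrep J].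
Proof.
move=> nH.
have [F FP F0] : exists2 F : 'M_(rdim M, rdim N), ishom F & F <> 0.
  apply: contrapT => H; apply: nH => h hP; apply: contrapT => h0; apply: H.
  by exists h.
have [J [p [i [pP iP FE pf inj]]]] := image_factor FP.
have [K' [io [ro [si H]]]] := epi_ses pP pf.
have [C [pi' [ro' [si' H']]]] := mono_ses iP inj.
exists K', J, C; split; first by exists io, p, ro, si.
  by exists i, pi', ro', si'.
by move=> J0; apply: F0; rewrite FE (null_hom0l J0 iP) mulmx0.
Qed.

Fact zero_reM (i j : I) : (0 : 'M[K]_0) *m (0 : 'M[K]_0) = if i == j then (0 : 'M[K]_0) else 0.
Proof. by rewrite mulmx0 if_same. Qed.
Fact zero_re_sum : \sum_(i : I) (0 : 'M[K]_0) = 1%:M.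
Proof. by apply/matrixP => -[]. Qed.
Fact zero_rfs (a : Ar) : (0 : 'M[K]_0) *m (0 : 'M[K]_0) = 0. Proof. by rewrite mulmx0. Qed.
Definition zero_rep := Rep zero_reM zero_re_sum zero_rfs zero_rfs.

(** [V] is the power of N with one factor for each element of [hs], built by iterated split
    extensions, and [F] has the components [hs]. The last four clauses keep what is needed of the
    projections and inclusions of the factors. *)
Lemma power_map M N (hs : seq 'M[K]_(rdim M, rdim N)) :
  exc N -> (forall h, h \in hs -> ishom h) ->
  exists V (F : 'M_(rdim M, rdim V)),
  [/\ ishom F, forall i, cl V i = (size hs)%:Z * cl N i &
      forall P, ext_closed P -> P N -> P V] /\
  [/\ forall h, h \in hs -> exists2 g : 'M_(rdim V, rdim N), ishom g & F *m g = h,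
      forall g : 'M_(rdim V, rdim N), ishom g -> exists c : nat -> K,
        F *m g = \sum_(j < size hs) c j *: hs`_j /\
        ((forall j, (j < size hs)%N -> c j = 0) -> g = 0),
      forall X (k : 'M_(rdim X, rdim V)), ishom k ->
        (forall g : 'M_(rdim V, rdim N), ishom g -> k *m g = 0) -> k = 0 &
      hs <> [::] -> forall X, ext0 X V -> ext0 X N].
Proof.
move=> eN; elim: hs => [|h hs IH] hsP.
  exists zero_rep, 0; split; split.
  - exact: ishom0.
  - by move=> i; rewrite mul0r /cl /dimv mxrank0.
  - by move=> P [P0 _] _; apply: P0.
  - by [].
  - move=> g _; exists (fun=> 0); split; first by rewrite mul0mx big_ord0.
    by move=> _; apply/matrixP => -[].
  - by move=> X k _ _; apply/matrixP => i -[].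
  - by [].
have hP : ishom h by apply: hsP; rewrite mem_head.
have [V [F [[FP clV PV] [V1 V2 V3 V4]]]] : exists V (F : 'M_(rdim M, rdim V)),
  [/\ ishom F, forall i, cl V i = (size hs)%:Z * cl N i &
      forall P, ext_closed P -> P N -> P V] /\
  [/\ forall h, h \in hs -> exists2 g : 'M_(rdim V, rdim N), ishom g & F *m g = h,
      forall g : 'M_(rdim V, rdim N), ishom g -> exists c : nat -> K,
        F *m g = \sum_(j < size hs) c j *: hs`_j /\
        ((forall j, (j < size hs)%N -> c j = 0) -> g = 0),
      forall X (k : 'M_(rdim X, rdim V)), ishom k ->
        (forall g : 'M_(rdim V, rdim N), ishom g -> k *m g = 0) -> k = 0 &
      hs <> [::] -> forall X, ext0 X V -> ext0 X N].
  by apply: IH => h' h'P; apply: hsP; rewrite in_cons h'P orbT.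
have phiP : @cochain N V (fun=> 0) by move=> a; rewrite mulmx0 mul0mx.
have S := extn_ses phiP; set W := extn phiP in S.
have SB : ses V W N := sesI S.
have [[Hi Hp Hr Hs] [ir sp ip sr rp]] := S.
have HrP : ishom (extn_ret phiP).
  split=> // a; rewrite /extn_ret /= mul_block_col mul_col_mx !mulmx0 !mul0mx.
  by rewrite !mulmx1 !mul1mx !add0r.
have HsP : ishom (extn_sec phiP).
  split=> // a; rewrite /extn_sec /= mul_row_block mul_mx_row !mulmx0 !mul0mx.
  by rewrite !mulmx1 !mul1mx !addr0.
exists W, (h *m extn_sec phiP + F *m extn_in phiP).
have FWr (X : rep) (g : 'M_(rdim W, rdim X)) :
  (h *m extn_sec phiP + F *m extn_in phiP) *m g =
   h *m (extn_sec phiP *m g) + F *m (extn_in phiP *m g).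
  by rewrite mulmxDl !mulmxA.
split; split.
- by apply: ishomD; apply: ishom_comp.
- by move=> i; rewrite (cl_ses SB) clV /= -addn1 PoszD mulrDl mul1r.
- by move=> P Pc PN; apply: (proj2 Pc _ _ _ SB) => //; exact: PV.
- move=> h'; rewrite in_cons => /orP[/eqP->|/V1[g gP gE]].
    by exists (extn_out phiP) => //; rewrite FWr sp ip mulmx1 mulmx0 addr0.
  exists (extn_ret phiP *m g); first exact: ishom_comp.
  by rewrite FWr (mulmxA (extn_sec phiP)) sr (mulmxA (extn_in phiP)) ir mul0mx mulmx0 add0r mul1mx.
- move=> g gP; have [c cE] := exc_scalar eN (ishom_comp HsP gP).
  have [d [dE d0]] := V2 _ (ishom_comp Hi gP).
  exists (fun j => if j is j'.+1 then d j' else c); split.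
    by rewrite FWr cE dE big_ord_recl /= mul_mx_scalar.
  move=> z; have igz : extn_in phiP *m g = 0 by apply: d0 => j jlt; exact: (z j.+1 jlt).
  rewrite -[g]mul1mx -rp mulmxDl -!mulmxA cE igz.
  have -> : c = 0 by have := z 0%N isT.
  rewrite mulmx0 add0r; have -> : 0%:M = 0 :> 'M[K]_(rdim N).
    by apply/matrixP => x y; rewrite !mxE mul0rn.
  by rewrite mulmx0.
- move=> X k kP kg; rewrite -[k]mulmx1 -rp mulmxDr !mulmxA (kg _ Hp) mul0mx addr0.
  rewrite (V3 _ (k *m extn_ret phiP)) ?mul0mx //; first exact: ishom_comp.
  by move=> g gP; rewrite -mulmxA; apply: kg; exact: ishom_comp.
- by move=> _ X; exact: ext0_quor SB.
Qed.

(** [F : M -> V] has for components a basis of Hom(M, N), so composition with [F] is a bijection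
    from Hom(V, N) to Hom(M, N); this is why the kernel or the cokernel has no map to N. *)
Lemma universal_map M N : exc M -> exc N -> ext0 N M -> ~ hom0 M N ->
  exists V (e : nat), [/\ ext0 M N, chi M N = e%:Z, forall i, cl V i = e%:Z * cl N i,
    forall P, ext_closed P -> P N -> P V &
    (exists2 K', ses K' M V & hom0 K' N) \/ (exists2 C, ses M V C & hom0 C N)].
Proof.
move=> eM eN eNM nH; pose hs := vbasis (hom_space M N).
have hsP h : h \in (hs : seq _) -> ishom h by move=> /vbasis_mem/hom_spaceP.
have fr : free hs := basis_free (vbasisP _).
have [V [F [[FP clV PV] [V1 V2 V3 V4]]]] := power_map eN hsP.
have sz : size hs = \dim (hom_space M N) by rewrite size_tuple.
have hsN : (hs : seq _) <> [::].
  by move=> E; apply: nH; apply/hom0P; rewrite -sz E.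
have inj g : @ishom V N g -> F *m g = 0 -> g = 0.
  move=> gP gF; have [c [cE c0]] := V2 _ gP; apply: c0 => j jlt.
  have E : \sum_(j < size hs) (fun j : 'I__ => c j) j *: hs`_j = 0 by rewrite -cE.
  have fr' : free (in_tuple (hs : seq _)) by [].
  by have /freeP/(_ (fun j => c j) E (Ordinal jlt)) := fr'.
have homP (h : 'M_(rdim M, rdim N)) : ishom h ->
    exists2 g : 'M_(rdim V, rdim N), ishom g & F *m g = h.
  move=> /hom_spaceP hP; rewrite (coord_vbasis hP).
  elim: (index_enum _) => [|j r [g gP gE]].
    by exists 0; [exact: ishom0 | rewrite big_nil mulmx0].
  have [g' g'P g'E] : exists2 g' : 'M_(rdim V, rdim N), ishom g' & F *m g' = hs`_j.
    by apply: V1; rewrite mem_nth // size_tuple.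
  exists (coord hs j h *: g' + g); first by apply: ishomD => //; exact: ishomZ.
  by rewrite big_cons mulmxDr -scalemxAr g'E gE.
have eVM : ext0 V M.
  apply: (PV (fun X => ext0 X M)) => //; split; first by move=> Z /null_ext0l.
  by move=> A B C S; exact: ext0_extl S.
have eVN : ext0 V N.
  apply: (PV (fun X => ext0 X N)); last by case: eN.
  by split; [move=> Z /null_ext0l | move=> A B C S; exact: ext0_extl S].
suff H : ext0 M N /\
    ((exists2 K', ses K' M V & hom0 K' N) \/ (exists2 C, ses M V C & hom0 C N)).
  exists V, (size hs); split=> //; try by case: H.
  by rewrite sz /chi -euler_dim; case: H => /ext_dimP -> _; rewrite subr0.
have [Ff|[J [p [i [P [[FE pf pP iP PP] iP1]]]]]] := mono_or_split eM eVM FP.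
  have [C [pi [ro [si H]]]] := mono_ses FP Ff; have S := sesI H.
  split; first exact: (ext0_subl S).
  right; exists C => // g gP; have [[Hi Hp Hr Hs] [ir sp ip sr rp]] := H.
  rewrite -[g]mul1mx -sp -mulmxA (inj (pi *m g)) ?mulmx0 //; first exact: ishom_comp.
  by rewrite mulmxA ip mul0mx.
(* [P i - 1] is killed by all maps V -> N, and these separate maps into a power of N. *)
have Pi1 : P *m i = 1%:M.
  apply/eqP; rewrite -subr_eq0; apply/eqP/V3.
    by apply: ishomB; [exact: ishom_comp | exact: ishom1].
  move=> g gP; apply: inj.
    by apply: ishom_comp => //; apply: ishomB; [exact: ishom_comp | exact: ishom1].
  rewrite FE -!mulmxA (mulmxA i) mulmxBr mulmx1 (mulmxA i P) iP1 mul1mx subrr.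
  by rewrite mul0mx mulmx0.
have Ff : row_full F.
  apply/row_fullP; have [p' pp'] : exists p', p' *m p = 1%:M by apply/row_fullP.
  by exists (P *m p'); rewrite FE mulmxA -(mulmxA P) pp' mulmx1 Pi1.
have [K' [io [ro [si H]]]] := epi_ses FP Ff; have S := sesI H.
(* Ext(M, M) = 0 and M maps onto V, so Ext(M, V) = 0; N is a summand of V. *)
split; first by apply: V4 => //; apply: (ext0_quor S); case: eM.
left; exists K' => // h hP; have [h' h'P <-] := hom_extend H eVN hP.
have [g gP <-] := homP _ h'P.
by case: H => _ [_ _ iF _ _]; rewrite mulmxA iF mul0mx.
Qed.
End Def.

(** * Duality, which exchanges the two arguments of Hom and Ext *)

Section Dual.
Variables (s t : Ar -> I).
Implicit Types (M N A B C : rep s t).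
Fact dual_reM M i j : (re M i)^T *m (re M j)^T = if i == j then (re M i)^T else 0.
Proof. by rewrite -trmx_mul reM eq_sym; case: eqP => [->|_] //; rewrite trmx0. Qed.
Fact dual_re_sum M : \sum_i (re M i)^T = 1%:M.
Proof. by rewrite -linear_sum re_sum /= trmx1. Qed.
Fact dual_rfs M a : (re M (t a))^T *m (rf M a)^T = (rf M a)^T.
Proof. by rewrite -trmx_mul rft. Qed.
Fact dual_rft M a : (rf M a)^T *m (re M (s a))^T = (rf M a)^T.
Proof. by rewrite -trmx_mul rfs. Qed.
Definition dual M : rep t s := Rep (dual_reM M) (dual_re_sum M) (dual_rfs M) (dual_rft M).

Lemma cl_dual M : cl (dual M) = cl M.
Proof. by apply/funext => i; rewrite /cl /dimv /= mxrank_tr. Qed.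

Lemma graded_dual M N (h : 'M_(rdim M, rdim N)) :
  graded h -> @graded t s (dual N) (dual M) h^T.
Proof. by move=> hP i; rewrite /= -!trmx_mul hP. Qed.
Lemma ishom_dual M N (h : 'M_(rdim M, rdim N)) :
  ishom h -> @ishom t s (dual N) (dual M) h^T.
Proof. by move=> [hP hh]; split=> [|a]; [exact: graded_dual | rewrite /= -!trmx_mul hh]. Qed.

Lemma hom0_dual1 M N : hom0 (dual N) (dual M) -> hom0 M N.
Proof. by move=> H h /ishom_dual/H /(congr1 trmx); rewrite trmxK trmx0. Qed.

Lemma ses_dual A B C : ses A B C -> ses (dual C) (dual B) (dual A).
Proof.
move=> [io [pi [ro [si [[Hi Hp Hr Hs] [ir sp ip sr rp]]]]]].
exists pi^T, io^T, si^T, ro^T; split; split; try exact: ishom_dual.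
- exact: graded_dual.
- exact: graded_dual.
- by rewrite -trmx_mul sp trmx1.
- by rewrite -trmx_mul ir trmx1.
- by rewrite -trmx_mul ip trmx0.
- by rewrite -trmx_mul sr trmx0.
- by rewrite -!trmx_mul addrC -linearD /= rp trmx1.
Qed.
End Dual.

Lemma rep_eq s t d (e e' : I -> 'M[K]_d) (f f' : Ar -> 'M[K]_d) H1 H2 H3 H4 H1' H2' H3' H4' :
  e = e' -> f = f' ->
  @Rep s t d e f H1 H2 H3 H4 = @Rep s t d e' f' H1' H2' H3' H4'.
Proof. by move=> E1 E2; subst e' f'; congr Rep; exact: Prop_irrelevance. Qed.

Lemma dualK s t (M : rep s t) : dual (dual M) = M.
Proof.
case: M => d e f H1 H2 H3 H4; apply: rep_eq.
  by apply/funext => i /=; rewrite trmxK.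
by apply/funext => i /=; rewrite trmxK.
Qed.

Lemma hom0_dual s t (M N : rep s t) : hom0 (dual N) (dual M) <-> hom0 M N.
Proof.
split; first exact: hom0_dual1.
by rewrite -{1}(dualK M) -{1}(dualK N); exact: hom0_dual1.
Qed.

Lemma ext0_dual1 s t (M N : rep s t) : ext0 (dual N) (dual M) -> ext0 M N.
Proof.
move=> H phi P; have [|h hg hE] := H (fun a => - (phi a)^T).
  by move=> a; have [p1 p2] := P a; rewrite mulmxN mulNmx -!trmx_mul p1 p2.
exists h^T; first by move=> i; apply: trmx_inj; rewrite !trmx_mul !trmxK -(hg i).
move=> a; have /(congr1 trmx) := hE a; rewrite linearN /= trmxK linearB /= !trmx_mul !trmxK.
by move=> /(congr1 -%R); rewrite opprK opprB.
Qed.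
Lemma ext0_dual s t (M N : rep s t) : ext0 (dual N) (dual M) <-> ext0 M N.
Proof.
split; first exact: ext0_dual1.
by rewrite -{1}(dualK M) -{1}(dualK N); exact: ext0_dual1.
Qed.
End Rep.

(** * Seeds of a hereditary category *)

Definition pospart (x : int) : int := if 0 <= x then x else 0.
Lemma pospartP x : (0 <= x /\ pospart x = x) \/ (x <= 0 /\ pospart x = 0).
Proof. rewrite /pospart; case: ifP => H; [by left | right; split=> //; lia]. Qed.

Lemma pospart_nat (n : nat) : pospart n%:Z = n%:Z. Proof. by []. Qed.

(** The mutation rule in a form without division; [mutated_matrixE] identifies it with the rule of
    the seeds. *)
Definition matmut (I : eqType) (B : I -> I -> int) (k i j : I) : int :=
  if (k == i) || (k == j) then - B i j
  else B i j + pospart (B i k) * pospart (B k j) - pospart (- B i k) * pospart (- B k j).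

Section Hereditary.
Variable I : finType.

(* [h0] and [x0] stand for the vanishing of Hom and of Ext^1, [hses] for the existence of a
   short exact sequence, [hform] for the Euler form. *)
Record hdata := HData {
  ob : Type;
  hcl : ob -> I -> int;
  hform : (I -> int) -> (I -> int) -> int;
  h0 : ob -> ob -> Prop;
  x0 : ob -> ob -> Prop;
  hses : ob -> ob -> ob -> Prop }.

Definition opd (D : hdata) : hdata :=
  @HData (ob D) (@hcl D) (fun u v => hform D v u) (fun M N => h0 N M) (fun M N => x0 N M)
    (fun A B C => hses C B A).

Definition hchi D (M N : ob D) := hform D (hcl M) (hcl N).
Definition hexc D (M : ob D) := x0 M M /\ hchi M M = 1.
Definition hdim D (M : ob D) : int := \sum_i hcl M i.
Definition hclosed D (P : ob D -> Prop) :=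
  (forall Z, hdim Z = 0 -> P Z) /\ (forall A B C, hses A B C -> P A -> P C -> P B).

(* The axioms concerning the second argument of Hom and Ext; those for the first argument
   are the axioms of the opposite category. *)
Record half (D : hdata) : Prop := Half {
  cl_ge0 : forall (M : ob D) i, 0 <= hcl M i;
  form_lin : forall u w (c : int) v,
    hform D (fun i => u i + c * w i) v = hform D u v + c * hform D w v;
  ses_cl : forall (A B C : ob D), hses A B C -> forall i, hcl B i = hcl A i + hcl C i;
  h0_sub : forall (A B C X : ob D), hses A B C -> h0 X B -> h0 X A;
  h0_ext : forall (A B C X : ob D), hses A B C -> h0 X A -> h0 X C -> h0 X B;
  x0_quo : forall (A B C X : ob D), hses A B C -> x0 X B -> x0 X C;
  x0_ext : forall (A B C X : ob D), hses A B C -> x0 X A -> x0 X C -> x0 X B;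
  h0_conn : forall (A B C X : ob D), hses A B C -> h0 X B -> x0 X A -> h0 X C;
  x0_conn : forall (A B C X : ob D), hses A B C -> x0 X B -> h0 X C -> x0 X A;
  chi_h0 : forall (M N : ob D), h0 M N -> hchi M N <= 0;
  chi_x0 : forall (M N : ob D), x0 M N -> 0 <= hchi M N;
  h0_chi : forall (M N : ob D), x0 M N -> hchi M N = 0 -> h0 M N;
  x0_chi : forall (M N : ob D), h0 M N -> hchi M N = 0 -> x0 M N;
  null_h0 : forall (X Z : ob D), hdim Z = 0 -> h0 X Z;
  null_x0 : forall (X Z : ob D), hdim Z = 0 -> x0 X Z;
  h0_null : forall (X : ob D), h0 X X -> hdim X = 0;
  uext : forall (M N : ob D), hexc N -> h0 M N -> exists B (a : nat),
    [/\ hchi M N = - a%:Z, forall i, hcl B i = hcl M i + a%:Z * hcl N i,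
      h0 B N, x0 B N & forall P, hclosed P -> P M -> P N -> P B];
  umap : forall (M N : ob D), hexc M -> hexc N -> x0 N M -> ~ h0 M N ->
    exists V (e : nat), [/\ x0 M N, hchi M N = e%:Z, forall i, hcl V i = e%:Z * hcl N i,
      forall P, hclosed P -> P N -> P V &
      (exists2 K', hses K' M V & h0 K' N) \/ (exists2 C, hses M V C & h0 C N)];
  pmap : forall (M N : ob D), hexc M -> hexc N -> x0 N M -> ~ h0 M N ->
    (exists K', hses K' M N) \/ (exists C, hses M N C);
  imap : forall (M N : ob D), ~ h0 M N ->
    exists K' J C, [/\ hses K' M J, hses J N C & hdim J <> 0] }.

Definition hereditary D := half D /\ half (opd D).

Lemma hereditary_op D : hereditary D -> hereditary (opd D).
Proof. by case: D => O c f h x s [H1 H2]; split. Qed.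

(* The objects, shifted when [spos] is false and ordered by [srk], form a signed exceptional
   sequence; [gvec] is the class of an object with this sign, and the exchange matrix is the
   antisymmetrised Euler form of these classes. *)
Record state D := State { sob : I -> ob D; spos : I -> bool; srk : I -> nat }.

Definition gvec D (S : state D) i : I -> int :=
  fun l => (if spos S i then 1 else -1) * hcl (sob S i) l.

Definition orth D (M N : ob D) := h0 M N /\ x0 M N.

Definition is_state D (S : state D) (B : I -> I -> int) :=
  [/\ forall i, hexc (sob S i), injective (srk S),
      forall i j, spos S i = false -> spos S j -> (srk S i < srk S j)%N,
      forall i j, (srk S i < srk S j)%N -> orth (sob S j) (sob S i)
    & forall i j, (srk S i < srk S j)%N -> spos S i = spos S j -> h0 (sob S i) (sob S j)]
  /\ (forall i j, B i j = hform D (gvec S i) (gvec S j) - hform D (gvec S j) (gvec S i))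
  /\ (forall v : I -> int, exists c : I -> int,
        forall l, v l = \sum_j c j * hcl (sob S j) l).

(** Passing to the opposite category exchanges shifted and unshifted terms and reverses the order,
    so that mutation at a shifted term reduces to mutation at an unshifted one. *)
Definition state_op D (S : state D) : state (opd D) :=
  @State (opd D) (sob S) (fun i => ~~ spos S i) (fun i => \max_j srk S j - srk S i)%N.

Section HereditaryTheory.
Variable D : hdata.
Hypothesis HD : hereditary D.
Let R := proj1 HD.
Let L := proj2 HD.
Implicit Types (A B C K M N V X Y Z : ob D).

Lemma h0_subr A B C X : hses A B C -> h0 X B -> h0 X A. Proof. exact: (h0_sub R). Qed.
Lemma h0_quol A B C X : hses A B C -> h0 B X -> h0 C X.
Proof. by move=> s; apply: (@h0_sub _ L C B A X). Qed.
Lemma h0_extr A B C X : hses A B C -> h0 X A -> h0 X C -> h0 X B. Proof. exact: (h0_ext R). Qed.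
Lemma h0_extl A B C X : hses A B C -> h0 A X -> h0 C X -> h0 B X.
Proof. by move=> s a c; apply: (@h0_ext _ L C B A X). Qed.
Lemma x0_quor A B C X : hses A B C -> x0 X B -> x0 X C. Proof. exact: (x0_quo R). Qed.
Lemma x0_subl A B C X : hses A B C -> x0 B X -> x0 A X.
Proof. by move=> s; apply: (@x0_quo _ L C B A X). Qed.
Lemma x0_extr A B C X : hses A B C -> x0 X A -> x0 X C -> x0 X B. Proof. exact: (x0_ext R). Qed.
Lemma x0_extl A B C X : hses A B C -> x0 A X -> x0 C X -> x0 B X.
Proof. by move=> s a c; apply: (@x0_ext _ L C B A X). Qed.
Lemma h0_connr A B C X : hses A B C -> h0 X B -> x0 X A -> h0 X C. Proof. exact: (h0_conn R). Qed.
Lemma h0_connl A B C X : hses A B C -> h0 B X -> x0 C X -> h0 A X.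
Proof. by move=> s; apply: (@h0_conn _ L C B A X). Qed.
Lemma x0_connr A B C X : hses A B C -> x0 X B -> h0 X C -> x0 X A. Proof. exact: (x0_conn R). Qed.
Lemma x0_connl A B C X : hses A B C -> x0 B X -> h0 A X -> x0 C X.
Proof. by move=> s; apply: (@x0_conn _ L C B A X). Qed.

Lemma form_linr u v (c : int) w :
  hform D v (fun i => u i + c * w i) = hform D v u + c * hform D v w.
Proof. exact: (form_lin L). Qed.

Lemma form_eq u u' v v' : u =1 u' -> v =1 v' -> hform D u v = hform D u' v'.
Proof. by move=> /funext-> /funext->. Qed.

Lemma form0l v : hform D (fun=> 0) v = 0.
Proof.
have := form_lin R (fun=> 0) (fun=> 0) 1 v.
have -> : (fun i : I => 0 + 1 * 0 : int) = fun=> 0 by apply/funext => i; rewrite mulr0 addr0.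
by rewrite mul1r => /eqP; rewrite -subr_eq0 opprD addrA subrr sub0r oppr_eq0 => /eqP.
Qed.
Lemma form0r v : hform D v (fun=> 0) = 0.
Proof.
have := form_linr (fun=> 0) v 1 (fun=> 0).
have -> : (fun i : I => 0 + 1 * 0 : int) = fun=> 0 by apply/funext => i; rewrite mulr0 addr0.
by rewrite mul1r => /eqP; rewrite -subr_eq0 opprD addrA subrr sub0r oppr_eq0 => /eqP.
Qed.

Lemma form_sum (T : Type) (r : seq T) (c : T -> int) (u : T -> I -> int) v :
  hform D (fun l => \sum_(j <- r) c j * u j l) v = \sum_(j <- r) c j * hform D (u j) v.
Proof.
elim: r => [|j r IH].
  by rewrite big_nil -[RHS](form0l v); apply: form_eq => // l; rewrite big_nil.
rewrite big_cons -IH addrC -(form_lin R); apply: form_eq => // l.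
by rewrite big_cons addrC.
Qed.

Lemma form_sumr (T : Type) (r : seq T) (c : T -> int) (u : T -> I -> int) v :
  hform D v (fun l => \sum_(j <- r) c j * u j l) = \sum_(j <- r) c j * hform D v (u j).
Proof.
elim: r => [|j r IH].
  by rewrite big_nil -[RHS](form0r v); apply: form_eq => // l; rewrite big_nil.
rewrite big_cons -IH addrC -form_linr; apply: form_eq => // l.
by rewrite big_cons addrC.
Qed.

Lemma chi_sesl A B C X : hses A B C -> hchi B X = hchi A X + hchi C X.
Proof.
move=> /(ses_cl R) E; rewrite /hchi -[hform D (hcl C) _]mul1r -(form_lin R).
by apply: form_eq => // i; rewrite mul1r.
Qed.
Lemma chi_sesr A B C X : hses A B C -> hchi X B = hchi X A + hchi X C.
Proof.
move=> /(ses_cl R) E; rewrite /hchi -[hform D _ (hcl C)]mul1r -form_linr.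
by apply: form_eq => // i; rewrite mul1r.
Qed.
Lemma dim_ses A B C : hses A B C -> hdim B = hdim A + hdim C.
Proof. by move=> /(ses_cl R) E; rewrite /hdim -big_split; apply: eq_bigr => i _; rewrite E. Qed.
Lemma dim_ge0 M : 0 <= hdim M.
Proof. by apply: sumr_ge0 => i _; exact: cl_ge0 R _ _. Qed.

Lemma closed_h0r X : hclosed (fun Y => h0 X Y).
Proof. by split=> [Z /(null_h0 R)|A B C s]; [exact | exact: h0_extr s]. Qed.
Lemma closed_h0l X : hclosed (fun Y => h0 Y X).
Proof. by split=> [Z /(null_h0 L)|A B C s]; [exact | exact: h0_extl s]. Qed.
Lemma closed_x0r X : hclosed (fun Y => x0 X Y).
Proof. by split=> [Z /(null_x0 R)|A B C s]; [exact | exact: x0_extr s]. Qed.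
Lemma closed_x0l X : hclosed (fun Y => x0 Y X).
Proof. by split=> [Z /(null_x0 L)|A B C s]; [exact | exact: x0_extl s]. Qed.

Lemma exc_h0N M : hexc M -> ~ h0 M M.
Proof. by move=> [_ c] /(chi_h0 R); rewrite c. Qed.
Lemma exc_dim_gt0 M : hexc M -> 0 < hdim M.
Proof.
move=> eM; rewrite lt_neqAle dim_ge0 andbT eq_sym; apply/eqP => /(null_h0 R M).
exact: exc_h0N.
Qed.

(** * Mutation of a signed exceptional sequence at an unshifted term *)

Section Mutation.
Variables (S : state D) (B : I -> I -> int) (k : I).
Hypothesis HS : is_state S B.
Hypothesis posk : spos S k.
Let M := sob S.
Let N := M k.
Let ex i : hexc (M i). Proof. by case: HS => -[]. Qed.
Let ord i j : (srk S i < srk S j)%N -> orth (M j) (M i). Proof. by case: HS => -[_ _ _ H _] _; exact: H. Qed.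
Let np i j : spos S i = false -> spos S j -> (srk S i < srk S j)%N.
Proof. by case: HS => -[_ _ H _ _] _; exact: H. Qed.
Let ss i j : i != j -> spos S i = spos S j -> h0 (M i) (M j).
Proof.
case: HS => -[_ inj _ H1 H2] _ ij E; case: (ltngtP (srk S i) (srk S j)) => h.
- exact: H2.
- by case: (H1 _ _ h).
- by move/inj: h => h; rewrite h eqxx in ij.
Qed.
Let c i := pospart (- B i k).

(** What the term at i becomes when N = M_k gets shifted. A shifted M_i without maps to N stays (0).
    Otherwise its approximation by a power V of N is onto and is replaced by its kernel, still
    shifted (1), or is injective and is replaced by its cokernel, now unshifted (2). An unshifted
    term stays or is extended by copies of N (3). N itself gets shifted (4). *)
Inductive kind (i : I) (X : ob D) : nat -> Prop :=
| Kneg : spos S i = false -> X = M i -> h0 (M i) N -> kind i X 0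
| Kker V : spos S i = false -> hses X (M i) V -> (forall P, hclosed P -> P N -> P V) ->
    orth X N -> (forall Y, h0 Y N -> x0 Y V -> x0 Y N) -> ~ h0 (M i) N -> kind i X 1
| Kcok V : spos S i = false -> hses (M i) V X -> (forall P, hclosed P -> P N -> P V) ->
    orth X N -> kind i X 2
| Kpos : spos S i -> i != k -> (forall P, hclosed P -> P (M i) -> P N -> P X) -> orth X N ->
    (X = M i \/ (srk S i < srk S k)%N) -> kind i X 3
| Kself : i = k -> X = N -> kind i X 4.

Definition kind_sign (t : nat) : bool := (t == 2)%N || (t == 3)%N.

Let gk l : gvec S k l = hcl N l. Proof. by rewrite /gvec posk mul1r. Qed.

Let form_sign (b b' : bool) X Y :
  hform D (fun l => (if b then 1 else -1) * hcl X l) (fun l => (if b' then 1 else -1) * hcl Y l)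
  = (if b == b' then 1 else -1) * hchi X Y.
Proof.
have e x u v : hform D (fun l => x * u l) v = x * hform D u v.
  by have := form_lin R (fun=> 0) u x v; rewrite form0l add0r => <-; apply: form_eq => // l; rewrite add0r.
have e' x u v : hform D u (fun l => x * v l) = x * hform D u v.
  by have := form_linr (fun=> 0) u x v; rewrite form0r add0r => <-; apply: form_eq => // l; rewrite add0r.
rewrite e e' mulrA; congr (_ * _); by case: b; case: b'.
Qed.

Lemma gform i j : hform D (gvec S i) (gvec S j) =
  (if spos S i == spos S j then 1 else -1) * hchi (M i) (M j).
Proof. exact: form_sign. Qed.

Lemma stateB i j : B i j = (if spos S i == spos S j then 1 else -1) *
  (hchi (M i) (M j) - hchi (M j) (M i)).
Proof. by case: HS => _ [-> _]; rewrite !gform (eq_sym (spos S j)) mulrBr. Qed.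

Let chi_orth X Y : orth X Y -> hchi X Y = 0.
Proof.
move=> [h x]; apply/eqP; rewrite eq_le (chi_h0 R) //.
exact: (chi_x0 R).
Qed.

Let chi_scl X Y V (e : int) : (forall l, hcl V l = e * hcl Y l) -> hchi X V = e * hchi X Y.
Proof.
move=> E; have := form_sumr [:: k] (fun=> e) (fun=> hcl Y) (hcl X).
rewrite big_seq1 => <-; apply: form_eq => // l; by rewrite big_seq1 E.
Qed.
Let chi_scl' X Y V (e : int) : (forall l, hcl V l = e * hcl Y l) -> hchi V X = e * hchi Y X.
Proof.
move=> E; have := form_sum [:: k] (fun=> e) (fun=> hcl Y) (hcl X).
rewrite big_seq1 => <-; apply: form_eq => // l; by rewrite big_seq1 E.
Qed.

(** The coefficient [c i] is the number of copies of N in the universal extension or in the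
    approximation, so the signed classes follow the mutation rule of c-vectors. *)
Lemma kind_exists i : exists X t, [/\ kind i X t, hexc X,
  i != k -> forall l, (if kind_sign t then 1 else -1) * hcl X l = gvec S i l + c i * gvec S k l &
  i != k -> c i = 0 -> X = M i /\ kind_sign t = spos S i].
Proof.
have [->|/eqP ik] := pselect (i = k).
  by exists N, 4%N; split=> //; [constructor | exact: ex | rewrite eqxx | rewrite eqxx].
have [pi|/negbTE ni] := boolP (spos S i).
  have E3 : hchi (M i) N = 0 -> orth (M i) N -> exists X t, [/\ kind i X t, hexc X,
    i != k -> forall l, (if kind_sign t then 1 else -1) * hcl X l = gvec S i l + c i * gvec S k l &
    i != k -> c i = 0 -> X = M i /\ kind_sign t = true].
    move=> chi0 oik; have cE : c i = 0.
      rewrite /c stateB pi posk eqxx mul1r chi0 sub0r opprK.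
      case: (ltngtP (srk S i) (srk S k)) => h.
      - by rewrite (chi_orth (ord h)).
      - have : hchi N (M i) <= 0 by apply: (chi_h0 R); apply: ss; rewrite ?pi ?posk // eq_sym.
        by rewrite /pospart; case: ifP => // ? ?; apply/eqP; rewrite eq_le; apply/andP.
      - by case: HS => -[_ inj _ _ _] _; move/inj: h ik => ->; rewrite eqxx.
    exists (M i), 3%N; split=> //; first by constructor => //; left.
    by move=> _ l; rewrite cE mul0r addr0 /gvec pi.
  have [lt_ik|ge_ik] := ltnP (srk S i) (srk S k); last first.
    have lt_ki : (srk S k < srk S i)%N.
      rewrite ltn_neqAle ge_ik andbT; apply: contraNneq ik => h.
      by case: HS => -[_ inj _ _ _] _; rewrite (inj _ _ h).
    by apply: E3; [exact: chi_orth (ord lt_ki) | exact: ord].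
  have oki := ord lt_ik; have hik : h0 (M i) N by apply: ss => //; rewrite pi posk.
  have [/eqP chi0|chi0] := boolP (hchi (M i) N == 0).
    by apply: E3 => //; split=> //; exact: (x0_chi R).
  have [X [a [aE clX hX xX PX]]] := uext R (ex k) hik.
  have cE : c i = a%:Z.
    rewrite /c stateB pi posk eqxx mul1r (chi_orth oki) subr0 aE opprK.
    exact: pospart_nat.
  exists X, 3%N; split.
  - by constructor => //; right.
  - split.
      have xXi : x0 X (M i).
        by apply: (PX (fun Y => x0 Y (M i))); [exact: closed_x0l | case: (ex i) | case: oki].
      by apply: (PX (fun Y => x0 X Y)); first exact: closed_x0r.
    have -> : hchi X X = hchi X (M i) + a%:Z * hchi X N.
      by rewrite /hchi -form_linr; apply: form_eq => // l; rewrite clX.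
    rewrite (chi_orth (conj hX xX)) mulr0 addr0.
    have -> : hchi X (M i) = hchi (M i) (M i) + a%:Z * hchi N (M i).
      by rewrite /hchi -(form_lin R); apply: form_eq => // l; rewrite clX.
    by rewrite (proj2 (ex i)) (chi_orth oki) mulr0 addr0.
  - by move=> _ l; rewrite cE gk clX /gvec pi !mul1r.
  - by move=> _; rewrite cE => a0; move: chi0; rewrite aE a0 oppr0 eqxx.
have lt_ik := np ni posk; have oki := ord lt_ik.
have BE : B i k = - hchi (M i) N by rewrite stateB ni posk mulN1r (chi_orth oki) subr0.
have [hik|hik] := pselect (h0 (M i) N).
  have cE : c i = 0.
    rewrite /c BE opprK; have := chi_h0 R hik.
    by rewrite /pospart; case: ifP => // ? ?; apply/eqP; rewrite eq_le; apply/andP.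
  exists (M i), 0%N; split=> //; first by constructor.
  by move=> _ l; rewrite cE mul0r addr0 /gvec ni.
have [V [e [xik eE clV PV cas]]] := umap R (ex i) (ex k) (proj2 oki) hik.
have cE : c i = e%:Z.
  by rewrite /c BE opprK eE pospart_nat.
have e_gt0 : (0 < e)%N.
  rewrite lt0n; apply/eqP => e0; apply: hik; apply: (h0_chi R) => //.
  by rewrite eE e0.
have oVi : orth V (M i).
  split; first by apply: (PV (fun Y => h0 Y _)); [exact: closed_h0l | case: oki].
  by apply: (PV (fun Y => x0 Y _)); [exact: closed_x0l | case: oki].
have xVV : x0 V V.
  apply: (PV (fun Y => x0 V Y)); first exact: closed_x0r.
  apply: (PV (fun Y => x0 Y N)); first exact: closed_x0l.
  by case: (ex k).
have chiNN : hchi N N = 1 by case: (ex k).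
have chiVV : hchi V V = e%:Z * e%:Z.
  by rewrite (chi_scl V clV) (chi_scl' N clV) chiNN mulr1.
have chiiV : hchi (M i) V = e%:Z * e%:Z by rewrite (chi_scl _ clV) eE.
have chiii : hchi (M i) (M i) = 1 by case: (ex i).
case: cas => -[X s hXN].
  have xXN : x0 X N by exact: x0_subl s xik.
  have hXV : h0 X V by apply: (PV (fun Y => h0 X Y)); first exact: closed_h0r.
  exists X, 1%N; split.
  (* chi(Y, V) = e chi(Y, N) is nonnegative while chi(Y, N) is nonpositive; as e > 0, both
     vanish. *)
  - apply: (Kker ni s PV) => // Y hY xY; apply: (x0_chi R) => //.
    have := chi_x0 R xY; rewrite (chi_scl _ clV) pmulr_rge0 ?ltz_nat //.
    by have := chi_h0 R hY => ? ?; apply/eqP; rewrite eq_le; apply/andP.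
  - split; first by apply: (x0_connr s) => //; apply: x0_subl s _; case: (ex i).
    have := chi_sesl X s; have := chi_sesr (M i) s; have := chi_sesr V s.
    have := chi_sesl (M i) s; have := chi_sesl V s; have := chi_sesr X s.
    by rewrite chiii chiVV chiiV (chi_orth oVi); lia.
  - by move=> _ l; rewrite cE gk /gvec ni (ses_cl R s) clV /=; lra.
  - by move=> _; rewrite cE => -[e0]; rewrite e0 in e_gt0.
have xXN : x0 X N.
  apply: (x0_chi R) => //; have := chi_sesl N s.
  by rewrite (chi_scl' N clV) chiNN eE; lia.
exists X, 2%N; split.
- exact: (Kcok ni s PV).
- split.
    apply: (x0_quor s); apply: (PV (fun Y => x0 X Y)) => //; exact: closed_x0r.
  have := chi_sesl X s; have := chi_sesr (M i) s; have := chi_sesr V s.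
  have := chi_sesl (M i) s; have := chi_sesl V s; have := chi_sesr X s.
  by rewrite chiii chiVV chiiV (chi_orth oVi); lia.
- by move=> _ l; rewrite cE gk /gvec ni -clV (ses_cl R s) /=; lra.
- by move=> _; rewrite cE => -[e0]; rewrite e0 in e_gt0.
Qed.

Let rkb := (\max_j srk S j).+1.
Let rk_lt i : (srk S i < rkb)%N. Proof. by rewrite ltnS; exact: leq_bigmax. Qed.
Let orthN i : i != k -> spos S i = false -> orth N (M i).
Proof. by move=> _ ni; apply: ord; exact: np. Qed.
Let nk i : spos S i = false -> i != k.
Proof. by apply: contraFneq => ->. Qed.

(** N is inserted among the shifted terms just before the first one of kind 1, or after all of them
    if there is none: 2 tau is even and the other ranks are odd. The offsets put the terms that have
    just become unshifted after all shifted ones and before the old unshifted ones. *)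
Definition newrk (tau : nat) (i : I) (t : nat) : nat :=
  match t with
  | 4 => 2 * tau
  | 3 => 2 * srk S i + 1 + 4 * rkb
  | 2 => 2 * srk S i + 1 + 2 * rkb
  | _ => 2 * srk S i + 1
  end.

Lemma kind_pair tau i j X Y s t : (tau <= rkb)%N ->
  (s = 1%N -> tau <= srk S i)%N ->
  (tau = rkb \/ exists m Z, kind m Z 1 /\ srk S m = tau) ->
  kind i X s -> kind j Y t -> i != j -> (newrk tau i s < newrk tau j t)%N ->
  orth Y X /\ (kind_sign s = kind_sign t -> h0 X Y).
Proof.
move=> tb T1 T2 ki kj ij; have bi := rk_lt i; have bj := rk_lt j.
have vh0r V Z : (forall P, hclosed P -> P N -> P V) -> h0 Z N -> h0 Z V.
  by move=> H; apply: H; exact: closed_h0r.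
have vx0r V Z : (forall P, hclosed P -> P N -> P V) -> x0 Z N -> x0 Z V.
  by move=> H; apply: H; exact: closed_x0r.
have vh0l V Z : (forall P, hclosed P -> P N -> P V) -> h0 N Z -> h0 V Z.
  by move=> H; apply: (H (fun Y => h0 Y Z)); exact: closed_h0l.
have vx0l V Z : (forall P, hclosed P -> P N -> P V) -> x0 N Z -> x0 V Z.
  by move=> H; apply: (H (fun Y => x0 Y Z)); exact: closed_x0l.
have ji : j != i by rewrite eq_sym.
case: ki T1 => [ni -> hi|V ni si PV [hX xX] xV hiN|V ni si PV [hX xX]|pi ik PX [hX xX] cX|ik ->] T1;
case: kj => [nj -> hj|W nj sj PW [hY xY] xW hjN|W nj sj PW [hY xY]|pj jk PY [hY xY] cY|jk ->];
  rewrite /newrk /= => lt; try (exfalso; lia).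
- have lt_ij : (srk S i < srk S j)%N by lia.
  by split=> [|_]; [exact: ord | apply: ss; rewrite ?ni].
- have lt_ij : (srk S i < srk S j)%N by lia.
  have [oh ox] := ord lt_ij; have [nh nx] := orthN (nk ni) ni.
  split; last by move=> _; apply: (h0_subr sj); apply: ss; rewrite ?ni.
  split; first by apply: (h0_connl sj) => //; exact: vx0l.
  exact: x0_subl sj ox.
- have [nh nx] := orthN (nk ni) ni.
  split=> //; split; first by apply: (h0_quol sj); exact: vh0l.
  apply: (x0_connl sj); first exact: vx0l.
  by apply: ss; rewrite ?nj.
- have [nh nx] := orthN (nk ni) ni; have [oh ox] := ord (np ni pj).
  split=> //; split.
    by apply: (PY (fun Y => h0 Y _)) => //; exact: closed_h0l.
  by apply: (PY (fun Y => x0 Y _)) => //; exact: closed_x0l.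
- by split=> // ; exact: orthN (nk ni) ni.
- have lt_ij : (srk S i < srk S j)%N by lia.
  have [oh ox] := ord lt_ij; have [nh nx] := orthN (nk nj) nj.
  split; last first.
    by move=> _; apply: (h0_connl si); [apply: ss; rewrite ?ni | exact: vx0l].
  split; first exact: (h0_subr si).
  by apply: (x0_connr si) => //; exact: vh0r.
- have lt_ij : (srk S i < srk S j)%N by lia.
  have [oh ox] := ord lt_ij; have [nhi nxi] := orthN (nk ni) ni.
  have [nh nx] := orthN (nk nj) nj.
  split; last first.
    move=> _; apply: (h0_subr sj).
    by apply: (h0_connl si); [apply: ss; rewrite ?ni | exact: vx0l].
  split; first by apply: (h0_subr si); apply: (h0_connl sj) => //; exact: vx0l.
  apply: (x0_connr si); last exact: vh0r.
  exact: x0_subl sj ox.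
- have [nhi nxi] := orthN (nk ni) ni.
  split=> //; split; first by apply: (h0_subr si); apply: (h0_quol sj); exact: vh0l.
  apply: (x0_connr si); last exact: vh0r.
  apply: (x0_connl sj); first exact: vx0l.
  by apply: ss; rewrite ?nj.
- have [nhi nxi] := orthN (nk ni) ni; have [oh ox] := ord (np ni pj).
  split=> //; split.
    by apply: (h0_subr si); apply: (PY (fun Y => h0 Y _)) => //; exact: closed_h0l.
  apply: (x0_connr si); last exact: vh0r.
  by apply: (PY (fun Y => x0 Y _)) => //; exact: closed_x0l.
- have lt_ij : (srk S i < srk S j)%N by lia.
  have [oh ox] := ord lt_ij; have [nhi nxi] := orthN (nk ni) ni.
  have [nhj nxj] := orthN (nk nj) nj.
  split; last first.
    move=> _; apply: (h0_connr sj); first exact: vh0r.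
    by apply: (x0_connl si); [exact: vx0l | apply: ss; rewrite ?ni].
  split; last by apply: (x0_quor si); exact: vx0r.
  apply: (h0_connr si); first exact: vh0r.
  by apply: (x0_connl sj); [exact: vx0l | apply: ss; rewrite ?nj].
- have [nhi nxi] := orthN (nk ni) ni; have [oh ox] := ord (np ni pj).
  split; last first.
    move=> _; apply: (PY (fun Y => h0 _ Y)) => //; first exact: closed_h0r.
    by apply: (h0_quol si); apply: vh0l => //; apply: ss; rewrite ?posk // eq_sym.
  split; last by apply: (x0_quor si); exact: vx0r.
  apply: (h0_connr si); first exact: vh0r.
  by apply: (PY (fun Y => x0 Y _)) => //; exact: closed_x0l.
- have lt_ij : (srk S i < srk S j)%N by lia.
  have [oh ox] := ord lt_ij.
  have oYi : orth Y (M i).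
    case: cY => [->//|lt_jk]; have [nh nx] := ord (ltn_trans lt_ij lt_jk).
    split; first by apply: (PY (fun Y => h0 Y _)) => //; exact: closed_h0l.
    by apply: (PY (fun Y => x0 Y _)) => //; exact: closed_x0l.
  split; last first.
    move=> _; apply: (PY (fun Y => h0 _ Y)) => //; first exact: closed_h0r.
    apply: (PX (fun Y => h0 Y _)); first exact: closed_h0l.
      by apply: ss; rewrite ?pi ?pj.
    by apply: ss; rewrite ?posk ?pj // eq_sym.
  case: oYi => hYi xYi; split.
    by apply: (PX (fun Z => h0 _ Z)) => //; exact: closed_h0r.
  by apply: (PX (fun Z => x0 _ Z)) => //; exact: closed_x0r.
(* N now precedes M_j, of kind 0, so a term M_m of kind 1 has smaller rank than M_j. It maps onto a
   power U of N and Ext(M_j, M_m) = 0; hence Ext(M_j, U) = 0, and Ext(M_j, N) = 0. *)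
- have [nh nx] := orthN (nk nj) nj.
  split=> // ; split=> //; case: T2 => [tE|[m [Z [km mE]]]]; first by exfalso; lia.
  move E : 1%N km => one km; case: km E => // U nm sm PU _ xU hmN _.
  have mj : m != j by apply: contra_notN hmN => /eqP->.
  have lt_mj : (srk S m < srk S j)%N.
    rewrite ltn_neqAle; apply/andP; split; last by lia.
    by apply: contraNneq mj => h; case: HS => -[_ inj _ _ _] _; rewrite (inj _ _ h).
  by apply: xU => //; apply: (x0_quor sm); case: (ord lt_mj).
- have [nh nx] := orthN (nk nj) nj.
  by split=> // _; exact: (h0_subr sj).
- by [].
- by [].
Qed.

Lemma mutation_pos : exists S' : state D,
  [/\ is_state S' (matmut B k), spos S' k = false /\ sob S' k = sob S k,
     forall i, i != k -> forall l, gvec S' i l = gvec S i l + c i * gvec S k l &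
     forall i, i != k -> c i = 0 -> sob S' i = sob S i /\ spos S' i = spos S i].
Proof.
have fex i : exists p : ob D * nat, [/\ kind i p.1 p.2, hexc p.1,
  i != k -> forall l, (if kind_sign p.2 then 1 else -1) * hcl p.1 l =
      gvec S i l + c i * gvec S k l &
  i != k -> c i = 0 -> p.1 = M i /\ kind_sign p.2 = spos S i].
  by have [X [t H]] := kind_exists i; exists (X, t).
have [f fP] := choice fex.
have fk i : kind i (f i).1 (f i).2 by case: (fP i).
have f4 i : i != k -> (f i).2 != 4%N.
  by move=> ik; case: (fk i) ik => // ->; rewrite eqxx.
have fkk : (f k).1 = N /\ (f k).2 = 4%N.
  by case: (fk k) => [|V|V||]; rewrite ?posk ?eqxx.
have [tau [tb T1 T2]] : exists tau, [/\ (tau <= rkb)%N,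
    forall i, (f i).2 = 1%N -> (tau <= srk S i)%N &
    tau = rkb \/ exists m Z, kind m Z 1 /\ srk S m = tau].
  have [/existsP[i0 /eqP i01]|/existsPn none] := boolP [exists i, (f i).2 == 1%N].
    have ex0 : exists n, [exists i, ((f i).2 == 1%N) && (srk S i == n)].
      by exists (srk S i0); apply/existsP; exists i0; rewrite i01 !eqxx.
    case: (ex_minnP ex0) => tau /existsP[m /andP[/eqP m1 /eqP mt]] tmin.
    exists tau; split; first by rewrite -mt ltnW.
      by move=> i i1; apply: tmin; apply/existsP; exists i; rewrite i1 !eqxx.
    by right; exists m, (f m).1; split=> //; rewrite -m1.
  exists rkb; split=> //; last by left.
  by move=> i i1; have := none i; rewrite i1.
have fty i : (f i).2 = 0%N \/ (f i).2 = 1%N \/ (f i).2 = 2%N \/ (f i).2 = 3%N \/ (f i).2 = 4%N.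
  by case: (fk i); intuition.
pose S' := @State D (fun i => (f i).1) (fun i => kind_sign (f i).2)
  (fun i => newrk tau i (f i).2).
have pr i j : i != j -> (srk S' i < srk S' j)%N ->
   orth (sob S' j) (sob S' i) /\ (spos S' i = spos S' j -> h0 (sob S' i) (sob S' j)).
  by move=> ij lt; apply: (@kind_pair tau i j _ _ (f i).2 (f j).2) => //; exact: T1.
have rinj : injective (srk S').
  case: HS => -[_ inj _ _ _] _ i j; rewrite /S' /newrk /=.
  have bi := rk_lt i; have bj := rk_lt j.
  have [->|ik] := eqVneq i k; have [->|jk] := eqVneq j k => //.
  - have := f4 j jk; case: fkk => _ ->.
    by case: (fty j) => [|[|[|[|]]]] -> //; lia.
  - have := f4 i ik; case: fkk => _ ->.
    by case: (fty i) => [|[|[|[|]]]] -> //; lia.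
  move=> E; apply: inj; move: E; have := f4 i ik; have := f4 j jk.
  by case: (fty i) => [|[|[|[|]]]] ->; case: (fty j) => [|[|[|[|]]]] -> //; lia.
have gE i : i != k -> forall l, gvec S' i l = gvec S i l + c i * gvec S k l.
  by move=> ik; case: (fP i) => _ _ /(_ ik).
have gkE l : gvec S' k l = 0 + (-1) * gvec S k l.
  by rewrite gk /gvec /=; case: fkk => -> ->; rewrite add0r.
exists S'; split=> //; last by move=> i ik c0; case: (fP i) => _ _ _ /(_ ik c0).
- split; [split=> // | split].
  + by move=> i; case: (fP i).
  + move=> i j; rewrite /S' /=; have bi := rk_lt i.
    have bj := rk_lt j; rewrite /newrk.
    by case: (fty i) => [|[|[|[|]]]] ->; case: (fty j) => [|[|[|[|]]]] -> //; lia.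
  + move=> i j lt; have [ij|/eqP ij] := pselect (i = j); first by move: lt; rewrite ij ltnn.
    by case: (pr i j ij lt).
  + move=> i j lt E; have [ij|/eqP ij] := pselect (i = j); first by move: lt; rewrite ij ltnn.
    by case: (pr i j ij lt) => _; apply.
  + pose w u v := hform D u v - hform D v u.
    have wD u v x y : w (fun l => u l + x * v l) y = w u y + x * w v y.
      by rewrite /w (form_lin R) form_linr; lra.
    have wN u v : w v u = - w u v by rewrite /w opprB.
    have BE i j : B i j = w (gvec S i) (gvec S j) by case: HS => _ [->].
    have Bkk : B k k = 0 by rewrite BE /w subrr.
    have wk u : w (gvec S' k) u = - w (gvec S k) u.
      have -> : gvec S' k = fun l => (fun=> 0) l + (-1) * gvec S k l by apply/funext.
      by rewrite wD {1}/w form0l form0r; lra.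
    have wi i u : i != k -> w (gvec S' i) u = w (gvec S i) u + c i * w (gvec S k) u.
      move=> ik; have -> : gvec S' i = fun l => gvec S i l + c i * gvec S k l by apply/funext/gE.
      exact: wD.
    have wkr u : w u (gvec S' k) = - w u (gvec S k) by rewrite wN wk opprK; exact: wN.
    have wir i u : i != k -> w u (gvec S' i) = w u (gvec S i) + c i * w u (gvec S k).
      by move=> ik; rewrite wN (wi _ _ ik) (wN (gvec S i)) (wN (gvec S k)); lra.
    move=> i j; rewrite -/(w _ _) /matmut.
    have [<-|ki] := eqVneq k i.
      rewrite wk; have [<-|kj] := eqVneq k j; first by rewrite wkr -BE Bkk !oppr0.
      rewrite eq_sym in kj.
      by rewrite (wir _ _ kj) -!BE Bkk mulr0 addr0.
    have [<-|kj] := eqVneq k j.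
      rewrite eq_sym in ki.
      by rewrite /= (wi _ _ ki) !wkr -!BE Bkk oppr0 mulr0 addr0.
    rewrite eq_sym in ki; rewrite eq_sym in kj. rewrite /=.
    rewrite (wi _ _ ki) !(wir _ _ kj) -!BE Bkk mulr0 addr0 /c.
    have -> : B k j = - B j k by rewrite !BE wN.
    by case: (pospartP (B i k)) (pospartP (- B j k)) (pospartP (- B i k)) (pospartP (- - B j k))
      => -[? ->] [] [? ->] [] [? ->] [] [? ->]; lia.
  + move=> v; case: HS => _ [_ /(_ v) [d dE]].
    pose x j : int := (if spos S' j then 1 else -1) * (if spos S j then 1 else -1) * d j.
    have sgn (b : bool) : (if b then 1 else -1 : int) * (if b then 1 else -1) = 1 by case: b.
    have clE j l : hcl (sob S j) l = (if spos S j then 1 else -1) * gvec S j l.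
      by rewrite /gvec mulrA sgn mul1r.
    have clE' j l : hcl (sob S' j) l = (if spos S' j then 1 else -1) * gvec S' j l.
      by rewrite /gvec mulrA sgn mul1r.
    (* The coefficient at k absorbs the multiples of the class of N that were added to the other
       classes. *)
    pose x0' := d k - \sum_(j | j != k) (if spos S j then 1 else -1) * c j * d j.
    exists (fun j => if j == k then x0' else x j) => l.
    rewrite dE (bigD1 k) //= [in RHS](bigD1 k) //= eqxx.
    have -> : (f k).1 = M k by case: fkk.
    rewrite /x0' mulrBl -addrA; congr (_ + _); apply/eqP; rewrite eq_sym addrC subr_eq.
    rewrite mulr_suml -big_split /=; apply/eqP; apply: eq_bigr => j jk.
    rewrite (negPf jk) -[(f j).1]/(sob S' j) clE' gE // clE /x gk.
    move: (sgn (spos S' j)) (sgn (spos S j)).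
    move: (if spos S' j then _ else _) (if spos S j then _ else _) (gvec S j l) => a b g a1 b1.
    have -> : a * b * d j * (a * (g + c j * hcl N l)) = (a * a) * (b * d j * (g + c j * hcl N l)).
      by lra.
    by rewrite a1 /N; lra.
- by case: fkk => f1 f2; rewrite /= f2 f1.
Qed.
End Mutation.

Section Orientation.
Variables (S : state D) (B : I -> I -> int).
Hypothesis HS : is_state S B.

Lemma state_exc i : hexc (sob S i). Proof. by case: HS => -[]. Qed.
Lemma state_ord i j : (srk S i < srk S j)%N -> orth (sob S j) (sob S i).
Proof. by case: HS => -[_ _ _ H _] _; exact: H. Qed.
Lemma state_inj : injective (srk S). Proof. by case: HS => -[]. Qed.
Lemma state_np i j : spos S i = false -> spos S j -> (srk S i < srk S j)%N.
Proof. by case: HS => -[_ _ H _ _] _; exact: H. Qed.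
Lemma state_neq i j : i != j -> (srk S i < srk S j)%N \/ (srk S j < srk S i)%N.
Proof.
move=> ij; case: (ltngtP (srk S i) (srk S j)) => h; [by left | by right |].
by move/state_inj: h ij => ->; rewrite eqxx.
Qed.
Lemma state_ss i j : i != j -> spos S i = spos S j -> h0 (sob S i) (sob S j).
Proof.
case: HS => -[_ inj _ H1 H2] _ ij E; case: (ltngtP (srk S i) (srk S j)) => h.
- exact: H2.
- by case: (H1 _ _ h).
- by move/inj: h => h; rewrite h eqxx in ij.
Qed.
Lemma chi_orth (X Y : ob D) : orth X Y -> hchi X Y = 0.
Proof.
move=> [h x]; apply/eqP; rewrite eq_le (chi_h0 R) //; exact: (chi_x0 R).
Qed.
Lemma hform_scale a b u v : hform D (fun l => a * u l) (fun l => b * v l) = a * b * hform D u v.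
Proof.
have e x u' v' : hform D (fun l => x * u' l) v' = x * hform D u' v'.
  by have := form_lin R (fun=> 0) u' x v'; rewrite form0l add0r => <-; apply: form_eq => // l; rewrite add0r.
have e' x u' v' : hform D u' (fun l => x * v' l) = x * hform D u' v'.
  by have := form_linr (fun=> 0) u' x v'; rewrite form0r add0r => <-; apply: form_eq => // l; rewrite add0r.
by rewrite e e' mulrA.
Qed.
Lemma state_mat i j : B i j = (if spos S i == spos S j then 1 else -1) *
  (hchi (sob S i) (sob S j) - hchi (sob S j) (sob S i)).
Proof.
case: HS => _ [-> _]; rewrite /gvec !hform_scale /hchi.
by case: (spos S i); case: (spos S j); rewrite /= ?mulrN ?mulNr ?opprK ?mul1r ?mulr1 ?opprB // addrC.
Qed.
End Orientation.
End HereditaryTheory.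

Lemma gvec_op D (S : state D) i : gvec (state_op S) i = fun l => - gvec S i l.
Proof.
apply/funext => l; rewrite /gvec /=; case: (spos S i) => /=; first by rewrite mul1r mulN1r.
by rewrite mul1r mulN1r opprK.
Qed.

Lemma is_state_op D (HD : hereditary D) (S : state D) B :
  is_state S B -> is_state (state_op S) (fun i j => - B i j).
Proof.
move=> HS; have [[ex inj np o s] [BE sp]] := HS; set b := \max_j srk S j.
have le i : (srk S i <= b)%N by exact: leq_bigmax.
have rev i j : (b - srk S i < b - srk S j)%N -> (srk S j < srk S i)%N.
  by have := le i; have := le j; lia.
split; [split|split] => //=.
- by move=> i j E; apply: inj; move: E; have := le i; have := le j; rewrite /= -/b; lia.
- move=> i j /negbFE pi nj; have := np j i (negbTE nj) pi.
  by have := le i; have := le j; rewrite -/b; lia.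
- by move=> i j /rev/o.
- by move=> i j /rev lt E; apply: s => //; move: E; case: (spos S i); case: (spos S j).
move=> i j; rewrite BE !gvec_op.
have E u v : hform D (fun l => - gvec S u l) (fun l => - gvec S v l) = hform D (gvec S u) (gvec S v).
  have := hform_scale HD (-1) (-1) (gvec S u) (gvec S v); rewrite mulrN1 opprK mul1r => <-.
  by apply: form_eq => l; rewrite mulN1r.
by rewrite !E opprB.
Qed.

Definition state_unop D (S : state (opd D)) : state D :=
  @State D (sob S) (fun i => ~~ spos S i) (fun i => \max_j srk S j - srk S i)%N.

Lemma is_state_unop D (HD : hereditary D) (S : state (opd D)) B :
  is_state S B -> is_state (state_unop S) (fun i j => - B i j).
Proof.
case: D HD S => O c f h x s HD S H; exact: (is_state_op (hereditary_op HD) H).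
Qed.

Lemma matmutN (B : I -> I -> int) k i j :
  matmut (fun i j => - B i j) k i j = - matmut B k i j.
Proof. by rewrite /matmut; case: ifP => _ //; rewrite !opprK; lra. Qed.

(** The rule of c-vectors, where the sign of the term at k decides whether the arrows into or out of
    k count. A zero coefficient leaves the object itself unchanged, not only its class. *)
Definition mutated D (S S' : state D) (B : I -> I -> int) k :=
  [/\ is_state S' (matmut B k), spos S' k = ~~ spos S k /\ sob S' k = sob S k,
    forall l, gvec S' k l = - gvec S k l &
    forall i, i != k -> let c := pospart (if spos S k then - B i k else B i k) in
      (forall l, gvec S' i l = gvec S i l + c * gvec S k l) /\
      (c = 0 -> sob S' i = sob S i /\ spos S' i = spos S i)].

Lemma state_mutation D (HD : hereditary D) (S : state D) B k :
  is_state S B -> exists S', mutated S S' B k.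
Proof.
move=> HS; have [pk|/negbTE nk] := boolP (spos S k).
  have [S' [H1 [H2 H2'] H3 H4]] := mutation_pos HD HS pk.
  exists S'; split=> //; first by rewrite pk.
    by move=> l; rewrite /gvec H2 H2' pk; lra.
  by move=> i ik /=; rewrite pk; split; [exact: H3 | exact: H4].
have HO := is_state_op HD HS.
have [|S1 [H1 [H2 H2'] H3 H4]] := mutation_pos (k := k) (hereditary_op HD) HO; first by rewrite /= nk.
have gE' i l : gvec (state_unop S1) i l = - gvec S1 i l.
  rewrite /gvec /=; case: (spos S1 i) => /=; first by rewrite mul1r mulN1r.
  by rewrite mul1r mulN1r opprK.
exists (state_unop S1); split.
- have -> : matmut B k = fun i j => - matmut (fun i j => - B i j) k i j.
    by apply/funext => i; apply/funext => j; rewrite matmutN opprK.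
  exact: is_state_unop.
- by rewrite /= H2 H2' nk.
- move=> l; rewrite gE' /gvec H2 H2' nk /=; lra.
move=> i ik /=; rewrite nk; have := H3 i ik; have := H4 i ik; rewrite opprK => h4 h3; split.
  move=> l; rewrite gE' h3 !gvec_op /=; lra.
by move=> /h4 [e1 e2]; rewrite /= e1 e2 /= negbK.
Qed.

(** If x^2 + e x y + y^2 > 0 with x and y of opposite signs, one of them is more than e - 1 times
    the other in absolute value. The hypotheses give d0 < (e - 1) d1, so such a vector has dimension
    at least d1 once its dimension is positive. *)
Lemma int_min_root (e d0 d1 x y : int) :
  0 < d1 -> d1 < d0 -> 2 * d0 <= e * d1 -> 0 < x * x + y * y + e * (x * y) ->
  0 < x * d0 + y * d1 -> d1 <= x * d0 + y * d1.
Proof.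
move=> d1p d10 e2 m d.
have e3 : 2 < e by nia.
have e1 : d0 < (e - 1) * d1 by nia.
have [x0|x0] := lerP 0 x; have [y0|y0] := lerP 0 y.
- have yd : 0 <= y * d1 by apply: mulr_ge0 => //; exact: ltW.
  have [x0'|x0'] := lerP x 0; last first.
    have : d0 <= x * d0 by apply: ler_peMl => //; lia.
    by lia.
  have x00 : x = 0 by lia.
  rewrite x00 mul0r add0r in d *; apply: ler_peMl; first exact: ltW.
  by rewrite -gtz0_ge1 -(pmulr_lgt0 _ d1p).
- set q := - y; have yE : y = - q by rewrite /q opprK.
  have q0 : 1 <= q by lia.
  have [pq|pq] := lerP q x.
    have : (e - 1) * q + 1 <= x.
      rewrite leNgt; apply/negP => h; have h1 : x <= (e - 1) * q by lia.
      have : x * (x - e * q) + q * q <= 0 by nia.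
      by rewrite yE in m; nia.
    by rewrite yE; nia.
  have : (e - 1) * x + 1 <= q.
    rewrite leNgt; apply/negP => h; have h1 : q <= (e - 1) * x by lia.
    have : q * (q - e * x) + x * x <= 0 by nia.
    by rewrite yE in m; nia.
  by rewrite yE in d *; nia.
- set p := - x; have xE : x = - p by rewrite /p opprK.
  have p0 : 1 <= p by lia.
  have py : p < y by rewrite xE in d; nia.
  have : (e - 1) * p + 1 <= y.
    rewrite leNgt; apply/negP => h; have h1 : y <= (e - 1) * p by lia.
    have : y * (y - e * p) + p * p <= 0 by nia.
    by rewrite xE in m; nia.
  by rewrite xE; nia.
by nia.
Qed.

(** * Mutation at a smallest term decreases the total dimension *)

Section Descent.
Variable D : hdata.
Hypothesis HD : hereditary D.
Let R := proj1 HD.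
Let L := proj2 HD.

Section Pair.
Variables (S : state D) (B : I -> I -> int) (i k : I).
Hypotheses (HS : is_state S B) (ni : spos S i = false) (pk : spos S k).
Hypothesis hik : ~ h0 (sob S i) (sob S k).
Hypothesis dik : hdim (sob S k) <= hdim (sob S i).
Let M := sob S.
Let N := M k.
Let ki : orth N (M i). Proof. by apply: (state_ord HS); exact: (state_np HS ni pk). Qed.

Lemma null_iso A C X : hses A X C -> hdim A = 0 -> h0 N X -> h0 N C.
Proof. by move=> s A0 h; apply: (h0_connr HD s h); exact: (null_x0 R). Qed.

(** A map M_i -> N is injective or onto; the dimensions exclude a proper inclusion, and Hom(N, M_i)
    = 0 excludes an isomorphism. *)
Lemma pair_ker : exists2 K, hses K (M i) N & 0 < hdim K.
Proof.
have hNN := exc_h0N HD (state_exc HS k).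
have [[K s]|[C s]] := pmap R (state_exc HS i) (state_exc HS k) (proj2 ki) hik.
  exists K => //; rewrite lt_neqAle (dim_ge0 HD) andbT eq_sym; apply/eqP => K0.
  by apply: hNN; exact: (null_iso s K0 (proj1 ki)).
have C0 : hdim C = 0.
  have := dim_ses HD s; have := dim_ge0 HD C.
  by move: dik; rewrite -/M -/N; lia.
exfalso; apply: hNN; apply: (h0_extr HD s (proj1 ki)); exact: (null_h0 R).
Qed.

Lemma pair_lt : hdim N < hdim (M i).
Proof. by have [K /(dim_ses HD) -> K0] := pair_ker; lia. Qed.

Lemma pair_ext0 p : spos S p -> (srk S p < srk S k)%N -> x0 (M p) N.
Proof.
move=> pp _; have [K s _] := pair_ker; apply: (x0_quor HD s).
by case: (state_ord HS (state_np HS ni pp)).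
Qed.

(* If the inequality failed, then in the rank two wide subcategory generated by [M i] and [N]
   every class of positive square would have dimension at least [hdim N], although [N] is
   not simple there. *)
Lemma pair_bound : hchi (M i) N * hdim N < 2 * hdim (M i).
Proof.
have hNN := exc_h0N HD (state_exc HS k).
have dN0 := exc_dim_gt0 HD (state_exc HS k).
rewrite ltNge; apply/negP => bad.
have [V [e [xik eE clV PV cas]]] := umap R (state_exc HS i) (state_exc HS k) (proj2 ki) hik.
have dV : hdim V = e%:Z * hdim N by rewrite /hdim mulr_sumr; apply: eq_bigr => l _; rewrite clV.
have dMi := pair_lt; rewrite -/M -/N in eE bad.
have [C sV hCN] : exists2 C, hses (M i) V C & h0 C N.
  case: cas => // -[K s _]; exfalso; have := dim_ses HD s; have := dim_ge0 HD K.
  rewrite dV; move: bad dMi dN0; rewrite eE -/M -/N; move: (_ * hdim N) => P; lia.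
(* The category perpendicular to the other terms on the appropriate sides: it contains M_i and N,
   and is closed under images, kernels of epimorphisms and cokernels of monomorphisms. *)
pose W X := (forall j, spos S j = false -> j != i -> orth X (M j)) /\
  (forall p, spos S p -> p != k -> orth (M p) X).
have Wi : W (M i).
  split=> [j nj ji|p pp _]; last by apply: (state_ord HS); exact: (state_np HS ni pp).
  split; first by apply: (state_ss HS); rewrite ?ni // eq_sym.
  apply: (x0_subl HD sV); apply: (PV (fun Y => x0 Y _)); first exact: closed_x0l.
  by case: (state_ord HS (state_np HS nj pk)).
have Wk : W N.
  split=> [j nj ji|p pp pk']; first by apply: (state_ord HS); exact: (state_np HS nj pk).
  split; first by apply: (state_ss HS); rewrite ?pp.
  case: (state_neq HS pk') => h; first exact: pair_ext0.
  by case: (state_ord HS h).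
have Wsub A X Y : hses A X Y -> W X -> W Y -> W A.
  move=> s [X1 X2] [Y1 Y2]; split=> [j nj ji|p pp pk'].
    have [h x] := X1 j nj ji; have [h' x'] := Y1 j nj ji.
    by split; [exact: (h0_connl HD s h x') | exact: (x0_subl HD s x)].
  have [h x] := X2 p pp pk'; have [h' x'] := Y2 p pp pk'.
  by split; [exact: (h0_subr HD s h) | exact: (x0_connr HD s x h')].
have Wquo A X Y : hses A X Y -> W X -> W A -> W Y.
  move=> s [X1 X2] [Y1 Y2]; split=> [j nj ji|p pp pk'].
    have [h x] := X1 j nj ji; have [h' x'] := Y1 j nj ji.
    by split; [exact: (h0_quol HD s h) | exact: (x0_connl HD s x h')].
  have [h x] := X2 p pp pk'; have [h' x'] := Y2 p pp pk'.
  by split; [exact: (h0_connr HD s h x') | exact: (x0_quor HD s x)].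
have Wim X Y K J C' : hses K X J -> hses J Y C' -> W X -> W Y -> W J.
  move=> s s' [X1 X2] [Y1 Y2]; split=> [j nj ji|p pp pk'].
    have [h x] := X1 j nj ji; have [h' x'] := Y1 j nj ji.
    by split; [exact: (h0_quol HD s h) | exact: (x0_subl HD s' x')].
  have [h x] := X2 p pp pk'; have [h' x'] := Y2 p pp pk'.
  by split; [exact: (h0_subr HD s' h') | exact: (x0_quor HD s x)].
(* The Euler form is triangular on the exceptional sequence, so orthogonality kills the coefficients
   of the other terms one rank after another. *)
have Wcl X : W X -> exists x y : int, forall l, hcl X l = x * hcl (M i) l + y * hcl N l.
  move=> [X1 X2]; have [c cE] : exists c : I -> int, forall l, hcl X l = \sum_j c j * hcl (M j) l.
    by case: HS => _ [_ /(_ (hcl X))].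
  have chiE Z : hchi Z X = \sum_j c j * hchi Z (M j).
    by rewrite /hchi -(form_sumr HD); apply: form_eq.
  have chiE' Z : hchi X Z = \sum_j c j * hchi (M j) Z.
    by rewrite /hchi -(form_sum HD); apply: form_eq.
  pose b := (\max_j srk S j).+1.
  have rb j : (srk S j < b)%N by rewrite ltnS; exact: leq_bigmax.
  have cp p : spos S p -> p != k -> c p = 0.
    have [n] := ubnP (b - srk S p)%N; elim: n p => // n IH p pn pp pk'.
    have := chi_orth HD (X2 p pp pk'); rewrite chiE (bigD1 p) //= big1; last first.
      move=> j jp; have [jk|/eqP jk] := pselect (j = k).
        by rewrite jk (chi_orth HD) ?mulr0 //; case: Wk => _; apply.
      have [pj|/negbTE nj] := boolP (spos S j); last first.
        by rewrite (chi_orth HD) ?mulr0 //; apply: (state_ord HS); exact: (state_np HS nj pp).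
      case: (state_neq HS jp) => h; first by rewrite (chi_orth HD) ?mulr0 //; exact: (state_ord HS).
      by rewrite IH ?mul0r //; have := rb p; have := rb j; lia.
    by rewrite addr0; case: (state_exc HS p) => _ ->; rewrite mulr1.
  have cn j : spos S j = false -> j != i -> c j = 0.
    have [n] := ubnP (srk S j); elim: n j => // n IH j jn nj ji.
    have := chi_orth HD (X1 j nj ji); rewrite chiE' (bigD1 j) //= big1; last first.
      move=> l lj; have [li|/eqP li] := pselect (l = i).
        by rewrite li (chi_orth HD) ?mulr0 //; case: Wi => + _; apply.
      have [pl|/negbTE nl] := boolP (spos S l).
        by rewrite (chi_orth HD) ?mulr0 //; apply: (state_ord HS); exact: (state_np HS nj pl).
      case: (state_neq HS lj) => h; last by rewrite (chi_orth HD) ?mulr0 //; exact: (state_ord HS).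
      by rewrite IH ?mul0r //; lia.
    by rewrite addr0; case: (state_exc HS j) => _ ->; rewrite mulr1.
  have ik : i != k by apply: contraFneq ni => ->.
  exists (c i), (c k) => l; rewrite cE (bigD1 i) //= (bigD1 k) 1?eq_sym //= big1 ?addr0 //.
  move=> j /andP[ji jk]; have [pj|/negbTE nj] := boolP (spos S j).
    by rewrite cp ?mul0r.
  by rewrite cn ?mul0r.
have small X : W X -> 0 < hdim X -> hdim X < hdim N -> hchi X X <= 0.
  move=> WX X0 XN; have [x [y xy]] := Wcl X WX; rewrite leNgt; apply/negP => q.
  have dX : hdim X = x * hdim (M i) + y * hdim N.
    by rewrite /hdim !mulr_sumr -big_split; apply: eq_bigr => l _; rewrite xy.
  have qE : hchi X X = x * x + y * y + hchi (M i) N * (x * y).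
    have lin Z : hchi Z X = x * hchi Z (M i) + y * hchi Z N.
      have := form_sumr HD [:: (x, hcl (M i)); (y, hcl N)] (fun p => p.1) (fun p => p.2) (hcl Z).
      rewrite !big_cons big_nil addr0 /= => <-; apply: form_eq => // l.
      by rewrite !big_cons big_nil addr0.
    have lin' Z : hchi X Z = x * hchi (M i) Z + y * hchi N Z.
      have := form_sum HD [:: (x, hcl (M i)); (y, hcl N)] (fun p => p.1) (fun p => p.2) (hcl Z).
      rewrite !big_cons big_nil addr0 /= => <-; apply: form_eq => // l.
      by rewrite !big_cons big_nil addr0.
    rewrite lin !lin' (chi_orth HD ki); case: (state_exc HS i) => _ ->.
    by case: (state_exc HS k) => _ ->; lra.
  have := @int_min_root (hchi (M i) N) (hdim (M i)) (hdim N) x y dN0 dMi.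
  by rewrite -qE -dX bad => /(_ isT q X0); lia.
(* A nonzero map X -> Y with image J gives chi(X, Y) = chi(K, Y) + chi(J, J) + chi(J, C'). *)
have neg n X Y : hdim X + hdim Y < n%:Z -> W X -> W Y -> hdim X < hdim N -> hdim Y < hdim N ->
    hchi X Y <= 0.
  elim: n X Y => [|n IH] X Y; have X0 := dim_ge0 HD X; have Y0 := dim_ge0 HD Y.
    by move=> ?; exfalso; lia.
  move=> XYn WX WY XN YN; have [h|h] := pselect (h0 X Y); first exact: (chi_h0 R).
  have [K [J [C' [s s' J0]]]] := imap R h.
  have J0' : 0 < hdim J by rewrite lt_neqAle (dim_ge0 HD) andbT eq_sym; apply/eqP.
  have WJ := Wim _ _ _ _ _ s s' WX WY.
  have WK := Wsub _ _ _ s WX WJ; have WC := Wquo _ _ _ s' WY WJ.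
  have dX := dim_ses HD s; have dY := dim_ses HD s'.
  have K0 := dim_ge0 HD K; have C0 := dim_ge0 HD C'.
  rewrite (chi_sesl HD Y s) (chi_sesr HD J s').
  have h1 : hchi K Y <= 0 by apply: IH => //; lia.
  have h2 : hchi J J <= 0 by apply: small => //; lia.
  have h3 : hchi J C' <= 0 by apply: IH => //; lia.
  by lia.
(* X is nonzero, receives no map from N, and has maps only from objects that map to N. A nonzero map
   X -> N is onto, since otherwise N is an extension of two smaller objects and chi(N, N) <= 0; its
   kernel is then a smaller object with the same properties. *)
have main n X : hdim X < n%:Z -> W X -> 0 < hdim X -> h0 N X ->
    (forall Z, h0 Z N -> h0 Z X) -> False.
  elim: n X => [|n IH] X Xn WX X0 hNX emb; first by have := dim_ge0 HD X; lia.
  have hXN : ~ h0 X N by move=> /emb/(h0_null R); lia.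
  have [K [J [C' [s s' J0]]]] := imap R hXN.
  have J0' : 0 < hdim J by rewrite lt_neqAle (dim_ge0 HD) andbT eq_sym; apply/eqP.
  have WJ := Wim _ _ _ _ _ s s' WX Wk.
  have WK := Wsub _ _ _ s WX WJ; have WC := Wquo _ _ _ s' Wk WJ.
  have dX := dim_ses HD s; have dY := dim_ses HD s'.
  have K0 := dim_ge0 HD K; have C0 := dim_ge0 HD C'.
  have [C1|C1] := eqVneq (hdim C') 0; last first.
    have lt : 0 < hdim C' by rewrite lt_neqAle C0 andbT eq_sym.
    have n4 A A' : W A -> W A' -> hdim A < hdim N -> hdim A' < hdim N -> hchi A A' <= 0.
      by move=> ? ? ? ?; apply: (neg (absz (hdim A + hdim A')%R).+1) => //; lia.
    have : hchi N N <= 0.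
      rewrite (chi_sesl HD N s') !(chi_sesr HD _ s').
      have h1 : hchi J J <= 0 by apply: n4 => //; lia.
      have h2 : hchi J C' <= 0 by apply: n4 => //; lia.
      have h3 : hchi C' J <= 0 by apply: n4 => //; lia.
      have h4 : hchi C' C' <= 0 by apply: n4 => //; lia.
      by lia.
    by case: (state_exc HS k) => _ ->.
  have [K1|K1] := eqVneq (hdim K) 0.
    apply: hNN; apply: (h0_extr HD s'); last exact: (null_h0 R).
    exact: (null_iso s K1 hNX).
  apply: (IH K) => //; first by lia.
  - by rewrite lt_neqAle K0 andbT eq_sym.
  - exact: (h0_subr HD s hNX).
  - by move=> Z /emb; exact: (h0_subr HD s).
apply: (main (absz (hdim (M i))).+1 (M i)) => //; first by lia.
- exact: (exc_dim_gt0 HD (state_exc HS i)).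
- by case: ki.
- by move=> Z h; apply: (h0_subr HD sV); apply: PV => //; exact: closed_h0r.
Qed.
End Pair.

Definition measure (A : pred I) (S : state D) : int := \sum_(i | A i) hdim (sob S i).

Lemma gvec_dim (S : state D) i : \sum_l gvec S i l = (if spos S i then 1 else -1) * hdim (sob S i).
Proof. by rewrite /hdim mulr_sumr. Qed.

(** Unshifted terms do not change: for those before k, Ext(M_p, N) = 0 because M_i0 maps onto N; for
    those after k, the coefficient is the positive part of a nonpositive chi. A shifted M_i with
    maps to N gets the dimension |e dim N - dim M_i|, which is smaller by [pair_bound]. *)
Lemma pos_step (A : pred I) (S : state D) B i0 k : is_state S B ->
  A i0 -> A k -> spos S i0 = false -> spos S k -> ~ h0 (sob S i0) (sob S k) ->
  (forall i, A i -> spos S i = false -> ~ h0 (sob S i) (sob S k) ->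
     hdim (sob S k) <= hdim (sob S i)) ->
  exists2 S', mutated S S' B k & measure A S' < measure A S.
Proof.
move=> HS Ai0 Ak ni0 pk hi0 minA; have [S' mS'] := state_mutation HD k HS.
exists S' => //; case: (mS') => HS' [_ obk] _ gE.
have xp p : spos S p -> (srk S p < srk S k)%N -> x0 (sob S p) (sob S k).
  by move=> pp lt; apply: (pair_ext0 HS ni0 pk hi0 (minA _ Ai0 ni0 hi0)).
have cpos p : spos S p -> p != k -> pospart (- B p k) = 0.
  move=> pp pk'; rewrite (state_mat HD HS) pp pk eqxx mul1r.
  case: (state_neq HS pk') => lt.
    rewrite (chi_orth HD (state_ord HS lt)) subr0 (chi_orth HD) //; split; last exact: xp.
    by apply: (state_ss HS); rewrite ?pp.
  rewrite (chi_orth HD (state_ord HS lt)) sub0r opprK.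
  have : hchi (sob S k) (sob S p) <= 0.
    by apply: (chi_h0 R); apply: (state_ss HS); rewrite ?pp ?pk // eq_sym.
  by case: (pospartP (hchi (sob S k) (sob S p))) => -[? ->]; lia.
have cneg i : spos S i = false -> - B i k = hchi (sob S i) (sob S k).
  move=> ni; rewrite (state_mat HD HS) ni pk mulN1r opprK.
  by rewrite (chi_orth HD (state_ord HS (state_np HS ni pk))) subr0.
have dk0 := exc_dim_gt0 HD (state_exc HS k).
have le i : A i -> hdim (sob S' i) <= hdim (sob S i) /\
    (spos S i = false -> ~ h0 (sob S i) (sob S k) -> hdim (sob S' i) < hdim (sob S i)).
  move=> Ai; have [->|/eqP ik] := pselect (i = k).
    by rewrite obk pk.
  have := gE i ik; rewrite /= pk => -[gi ci].
  have [pi|/negbTE ni] := boolP (spos S i).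
    by have [-> _] := ci (cpos i pi ik).
  have c0 := cneg i ni; rewrite c0 in gi ci.
  have [h|h] := pselect (h0 (sob S i) (sob S k)).
    split=> //; have [|-> //] := ci.
    by have := chi_h0 R h; case: (pospartP (hchi (sob S i) (sob S k))) => -[? ->]; lia.
  have dik := minA i Ai ni h; have bd := pair_bound HS ni pk h dik.
  have [V [e [xik eE _ _ _]]] := umap R (state_exc HS i) (state_exc HS k)
    (proj2 (state_ord HS (state_np HS ni pk))) h.
  have e0 : 0 < e%:Z.
    rewrite ltz_nat lt0n; apply/eqP => e0; apply: h.
    by apply: (h0_chi R) => //; rewrite eE e0.
  have : \sum_l gvec S' i l = \sum_l gvec S i l +
      pospart (hchi (sob S i) (sob S k)) * \sum_l gvec S k l.
    by rewrite mulr_sumr -big_split; apply: eq_bigr => l _; rewrite gi.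
  rewrite !gvec_dim ni pk eE pospart_nat.
  rewrite eE in bd; have d0 := dim_ge0 HD (sob S' i).
  have p0 : 0 < e%:Z * hdim (sob S k) by apply: mulr_gt0.
  move: bd p0; rewrite mul1r; move: (e%:Z * _) => P bd p0.
  by case: (spos S' i); rewrite ?mulN1r ?mul1r; lia.
rewrite /measure (bigD1 i0) //= [X in _ < X](bigD1 i0) //=.
apply: ltr_leD; first by case: (le i0 Ai0) => _; apply.
by apply: ler_sum => i /andP[Ai _]; case: (le i Ai).
Qed.
End Descent.

(** * Elimination of the shifted terms in a given set of vertices *)

Section Reach.
Variable D : hdata.
Hypothesis HD : hereditary D.
Variables (A Y : pred I).
Hypothesis AY : forall i, A i -> ~~ Y i.

(** Mutation outside of Y does not change the coordinates along Y. The term at a vertex of Y thus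
    keeps a positive coordinate, and stays unshifted. *)
Definition coord_inv (S : state D) :=
  forall y, Y y -> forall i, gvec S i y = if i == y then 1 else 0.

Lemma coord_inv_mut (S S' : state D) B k : A k -> mutated S S' B k -> coord_inv S -> coord_inv S'.
Proof.
move=> Ak [_ _ gk gE] inv y Yy i.
have ky : k != y by apply: contraNneq (AY Ak) => ->.
have gky : gvec S k y = 0 by rewrite inv // (negPf ky).
have [->|/eqP ik] := pselect (i = k); first by rewrite gk gky oppr0 (negPf ky).
by have [-> _] := gE i ik; rewrite gky mulr0 addr0 inv.
Qed.

Lemma coord_inv_pos (S : state D) y : coord_inv S -> Y y -> spos S y.
Proof.
move=> inv Yy; have := inv y Yy y; rewrite eqxx /gvec.
by case: (spos S y) => //; have := cl_ge0 (proj1 HD) (sob S y) y; lia.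
Qed.

Lemma measure_ge0 (S : state D) : 0 <= measure A S.
Proof. by apply: sumr_ge0 => i _; exact: dim_ge0 HD _. Qed.

Lemma reach_nocross n (S : state D) B : measure A S < n%:Z -> is_state S B -> coord_inv S ->
  exists w S', [/\ all A w, is_state S' (foldl (@matmut I) B w), coord_inv S' &
    forall i j, A i -> A j -> spos S' i = false -> spos S' j -> h0 (sob S' i) (sob S' j)].
Proof.
elim: n S B => [|n IH] S B; first by have := measure_ge0 S; lia.
move=> Sn HS inv.
have [|H] := pselect (forall i j, A i -> A j -> spos S i = false -> spos S j -> h0 (sob S i) (sob S j)).
  by move=> H; exists [::], S.
pose crossing z := A z /\ exists z', A z' /\
  ((spos S z /\ spos S z' = false /\ ~ h0 (sob S z') (sob S z)) \/
   (spos S z = false /\ spos S z' /\ ~ h0 (sob S z) (sob S z'))).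
have [z0 cz0] : exists z, crossing z.
  apply: contrapT => none; apply: H => i j Ai Aj ni pj; apply: contrapT => h.
  by apply: none; exists j; split=> //; exists i; split=> //; left.
have [z [cz zmin]] : exists z, crossing z /\ forall z', crossing z' -> hdim (sob S z) <= hdim (sob S z').
  have [m] := ubnP (absz (hdim (sob S z0))); elim: m z0 cz0 => // m IHm z0 cz0 lt.
  have [[z1 [c1 l1]]|none] := pselect (exists z1, crossing z1 /\ hdim (sob S z1) < hdim (sob S z0)).
    apply: (IHm z1 c1); have := dim_ge0 HD (sob S z1); lia.
  exists z0; split=> // z' cz'; rewrite leNgt; apply/negP => l; apply: none.
  by exists z'.
case: cz => Az [z' [Az' cas]].
have [S' [mS' lt]] : exists S', mutated S S' B z /\ measure A S' < measure A S.
  case: cas => [[pz [nz' hz]]|[nz [pz' hz]]].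
    have [|S' m l] := pos_step HD (A := A) HS Az' Az nz' pz hz; last by exists S'.
    move=> i Ai ni hi; apply: zmin; split=> //; exists z; split=> //.
    by right.
  (* [z] is shifted, so the descent takes place in the opposite category. The classes obtained there
     are the negatives of those of the mutation in [D], so the dimensions agree. *)
  have HO := is_state_op HD HS.
  have [||||S' m l] := pos_step (hereditary_op HD) (A := A) (i0 := z') (k := z) HO Az' Az.
  - by rewrite /= pz'.
  - by rewrite /= nz.
  - by [].
  - move=> i Ai /negbFE pi hi; apply: zmin; split=> //; exists z; split=> //.
    by left.
  have [S1 mS1] := state_mutation HD z HS.
  exists S1; split=> //.
  suff -> : measure A S1 = measure A S' by [].
  apply: eq_bigr => i Ai.
  have gE : gvec S' i = fun l => - gvec S1 i l.
    case: m mS1 => _ _ gk gg [_ _ gk1 gg1]; apply/funext => l'.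
    have [->|/eqP iz] := pselect (i = z); first by rewrite gk gk1 gvec_op.
    have [-> _] := gg i iz; have [-> _] := gg1 i iz; rewrite !gvec_op /= nz opprK; lra.
  have := gvec_dim S' i; rewrite gE sumrN gvec_dim.
  have d1 := dim_ge0 HD (sob S1 i); have d2 := dim_ge0 HD (sob S' i : ob D).
  change (@hdim (opd D) (sob S' i)) with (@hdim D (sob S' i)).
  by case: (spos S1 i); case: (spos S' i); rewrite ?mulN1r ?mul1r; lia.
have [HS' _ _ _] := mS'.
have [|w [S2 [w1 w2 w3 w4]]] := IH S' (matmut B z) _ HS' (coord_inv_mut Az mS' inv); first by lia.
by exists (z :: w), S2; split=> //=; rewrite Az.
Qed.

(** Mutation at the shifted term of A of largest rank changes no other term of A: unshifted ones
    receive no map from it, and shifted ones precede it and have no map to it. Each such mutation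
    lowers the number of shifted terms. *)
Lemma reach_pos (S : state D) B : is_state S B -> coord_inv S ->
  exists w S', [/\ all A w, is_state S' (foldl (@matmut I) B w), coord_inv S' &
    forall i, A i -> spos S' i].
Proof.
move=> HS inv.
have [w [S1 [w1 HS1 inv1 H]]] := @reach_nocross (absz (measure A S)).+1 S B ltac:(have := measure_ge0 S; lia) HS inv.
suff [w' [S2 [h1 h2 h3 h4]]] : exists w' S', [/\ all A w',
    is_state S' (foldl (@matmut I) (foldl (@matmut I) B w) w'), coord_inv S' &
    forall i, A i -> spos S' i].
  by exists (w ++ w'), S2; rewrite all_cat w1 foldl_cat.
move: (foldl _ _ _) HS1 => B1 HS1; clear HS inv w w1.
have [n] := ubnP #|[pred i | A i && ~~ spos S1 i]|.
elim: n S1 B1 HS1 inv1 H => // n IH S1 B1 HS1 inv1 H cn.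
have [none|] := pselect (forall i, A i -> spos S1 i).
  by exists [::], S1.
move=> /existsNP[i0 /not_implyP[Ai0 /negP ni0]].
have ex0 : [exists i, A i && ~~ spos S1 i] by apply/existsP; exists i0; rewrite Ai0.
have [i [Ai ni imax]] : exists i, [/\ A i, spos S1 i = false &
    forall j, A j -> spos S1 j = false -> (srk S1 j <= srk S1 i)%N].
  have [i /andP[Ai ni] im] := @arg_maxnP _ i0 (fun i => A i && ~~ spos S1 i) (srk S1) ltac:(by rewrite /= Ai0).
  by exists i; split=> //; [exact: negbTE | move=> j Aj nj; apply: im; rewrite Aj nj].
have [S2 mS2] := state_mutation HD i HS1.
have [HS2 [sg obi] _ gE] := mS2.
have same j : A j -> j != i -> sob S2 j = sob S1 j /\ spos S2 j = spos S1 j.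
  move=> Aj ji; have := gE j ji; rewrite /= ni => -[_]; apply.
  rewrite (state_mat HD HS1) ni; have [pj|/negbTE nj] := boolP (spos S1 j).
    rewrite /= mulN1r (chi_orth HD (state_ord HS1 (state_np HS1 ni pj))) sub0r opprK.
    have := chi_h0 (proj1 HD) (H i j Ai Aj ni pj).
    by case: (pospartP (hchi (sob S1 i) (sob S1 j))) => -[? ->]; lia.
  have lt : (srk S1 j < srk S1 i)%N.
    rewrite ltn_neqAle imax // andbT; apply: contraNneq ji => h.
    by apply/eqP; exact: (state_inj HS1 h).
  rewrite /= mul1r (chi_orth HD (state_ord HS1 lt)) subr0.
  have := chi_h0 (proj1 HD) (state_ss HS1 ji (etrans nj (esym ni))).
  by case: (pospartP (hchi (sob S1 j) (sob S1 i))) => -[? ->]; lia.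
have pi2 : spos S2 i by rewrite sg ni.
have [||w [S3 [h1 h2 h3 h4]]] := IH S2 (matmut B1 i) HS2 (coord_inv_mut Ai mS2 inv1).
- move=> j l Aj Al nj pl.
  have ji : j != i by apply: contraFneq nj => ->.
  have [oj sj] := same j Aj ji; rewrite oj.
  have [->|/eqP li] := pselect (l = i).
    by rewrite obi; apply: (state_ss HS1) => //; rewrite -sj nj ni.
  have [ol sl] := same l Al li; rewrite ol; apply: H; rewrite -?sj -?sl //.
- apply: leq_trans (_ : #|[pred j | A j && ~~ spos S1 j]| <= n)%N => //.
  apply: proper_card; apply/properP; split.
    apply/fintype.subsetP => j; rewrite !inE => /andP[Aj nj]; rewrite Aj /=.
    have ji : j != i by apply: contraNneq nj => ->.
    by have [_ <-] := same j Aj ji.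
  by exists i; rewrite !inE Ai ?ni ?pi2.
by exists (i :: w), S3; split=> //=; rewrite Ai.
Qed.
End Reach.
End Hereditary.

(** * Deletion of a vertex of an acyclic quiver *)

Section RepHereditary.
Variables (K : numFieldType) (I Ar : finType).

Definition rep_data (s t : Ar -> I) : hdata I :=
  @HData I (rep K s t) (@cl K I Ar s t) (euler_form s t) (@hom0 K I Ar s t) (@ext0 K I Ar s t)
    (@ses K I Ar s t).

Lemma euler_form_lin (s t : Ar -> I) (u w : I -> int) (c : int) (v : I -> int) :
  euler_form s t (fun i => u i + c * w i) v = euler_form s t u v + c * euler_form s t w v.
Proof.
rewrite /euler_form mulrBr addrACA -opprD !mulr_sumr -!big_split /=.
by congr (_ - _); apply: eq_bigr => i _; lra.
Qed.

Lemma euler_form_op (s t : Ar -> I) u v : euler_form t s u v = euler_form s t v u.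
Proof. by rewrite /euler_form; congr (_ - _); apply: eq_bigr => i _; rewrite mulrC. Qed.

Lemma hdim_null (s t : Ar -> I) (M : rep K s t) : @hdim I (rep_data s t) M = 0 -> nullrep M.
Proof. by move=> h; apply/nullP. Qed.

Lemma ext_closed_hclosed (s t : Ar -> I) (P : rep K s t -> Prop) :
  @hclosed I (rep_data s t) P -> ext_closed P.
Proof. by move=> [P0 PE]; split=> // Z Z0; apply: P0; apply/nullP. Qed.

Lemma half_rep (s t : Ar -> I) : half (rep_data s t).
Proof.
split=> /=.
- by [].
- exact: euler_form_lin.
- by move=> A B C /cl_ses.
- by move=> A B C X S; exact: hom0_subr S.
- by move=> A B C X S; exact: hom0_extr S.
- by move=> A B C X S; exact: ext0_quor S.
- by move=> A B C X S; exact: ext0_extr S.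
- by move=> A B C X S; exact: hom0_connr S.
- by move=> A B C X S; exact: ext0_connr S.
- by move=> M N; exact: chi_le0.
- by move=> M N; exact: chi_ge0.
- by move=> M N; exact: hom0_chi.
- by move=> M N; exact: ext0_chi.
- by move=> X Z /hdim_null; exact: null_hom0r.
- by move=> X Z /hdim_null; exact: null_ext0r.
- move=> X h; apply/nullP; rewrite /nullrep.
  have /matrixP E := h _ (ishom1 X); case: (rdim X) E => // n /(_ ord0 ord0).
  by rewrite !mxE eqxx => /eqP; rewrite oner_eq0.
- move=> M N eN h; have [B [a [h1 h2 h3 h4 h5]]] := universal_ext eN h.
  by exists B, a; split=> // P Pc; apply: h5; exact: ext_closed_hclosed.
- move=> M N eM eN x h; have [V [e [h1 h2 h3 h4 h5]]] := universal_map eM eN x h.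
  by exists V, e; split=> // P Pc; apply: h4; exact: ext_closed_hclosed.
- by move=> M N eM eN x h; exact: exc_pair_map eM eN x h.
- move=> M N h; have [K' [J [C [h1 h2 h3]]]] := image_ses h.
  by exists K', J, C; split=> // /hdim_null.
Qed.

Lemma hclosed_dual (s t : Ar -> I) (P : rep K s t -> Prop) :
  @hclosed I (opd (rep_data s t)) P -> ext_closed (fun X : rep K t s => P (dual X)).
Proof.
move=> [P0 PE]; split=> [Z /nullP Z0|A B C S PA PC].
  by apply: P0; rewrite /hdim /= cl_dual.
by apply: (PE (dual A) (dual B) (dual C)) => //=; exact: ses_dual.
Qed.

Lemma exc_dual (s t : Ar -> I) (M : rep K s t) :
  @hexc I (opd (rep_data s t)) M -> exc (dual M).
Proof.
move=> [x c]; split; first by apply/ext0_dual.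
by rewrite /chi cl_dual euler_form_op.
Qed.

(** The existence axioms are those of the quiver with reversed arrows, carried over by duality. *)
Lemma half_rep_op (s t : Ar -> I) : half (opd (rep_data s t)).
Proof.
split=> /=.
- by [].
- by move=> u w c v; rewrite -!(euler_form_op s t) euler_form_lin.
- by move=> A B C /cl_ses E i; rewrite E addrC.
- by move=> A B C X S; exact: hom0_quol S.
- by move=> A B C X S h1 h2; exact: hom0_extl S h2 h1.
- by move=> A B C X S; exact: ext0_subl S.
- by move=> A B C X S h1 h2; exact: ext0_extl S h2 h1.
- by move=> A B C X S; exact: hom0_connl S.
- by move=> A B C X S; exact: ext0_connl S.
- by move=> M N; exact: chi_le0.
- by move=> M N; exact: chi_ge0.
- by move=> M N; exact: hom0_chi.
- by move=> M N; exact: ext0_chi.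
- by move=> X Z /hdim_null; exact: null_hom0l.
- by move=> X Z /hdim_null; exact: null_ext0l.
- by move=> X; exact: (h0_null (half_rep s t)).
- move=> M N /exc_dual eN /hom0_dual h; have [B [a [h1 h2 h3 h4 h5]]] := universal_ext eN h.
  exists (dual B), a; split.
  + by move: h1; rewrite /chi !cl_dual euler_form_op.
  + by move=> i; rewrite cl_dual h2 !cl_dual.
  + by rewrite -[N]dualK; apply/hom0_dual.
  + by rewrite -[N]dualK; apply/ext0_dual.
  + move=> P Pc PM PN; apply: (h5 (fun X => P (dual X))); rewrite ?dualK //.
    exact: hclosed_dual.
- move=> M N /exc_dual eM /exc_dual eN /ext0_dual x h.
  have h' : ~ hom0 (dual M) (dual N) by move=> /hom0_dual.
  have [V [e [h1 h2 h3 h4 h5]]] := universal_map eM eN x h'.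
  exists (dual V), e; split.
  + by apply/ext0_dual.
  + by move: h2; rewrite /chi !cl_dual euler_form_op.
  + by move=> i; rewrite cl_dual h3 !cl_dual.
  + move=> P Pc PN; apply: (h4 (fun X => P (dual X))); rewrite ?dualK //.
    exact: hclosed_dual.
  + case: h5 => -[X S h0].
      left; exists (dual X); first by rewrite -[M]dualK; exact: ses_dual.
      by rewrite -[N]dualK; apply/hom0_dual.
    right; exists (dual X); first by rewrite -[M]dualK; exact: ses_dual.
    by rewrite -[N]dualK; apply/hom0_dual.
- move=> M N /exc_dual eM /exc_dual eN /ext0_dual x h.
  have h' : ~ hom0 (dual M) (dual N) by move=> /hom0_dual.
  case: (exc_pair_map eM eN x h') => -[X S].
    by left; exists (dual X); rewrite -[M]dualK -[N]dualK; exact: ses_dual.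
  by right; exists (dual X); rewrite -[M]dualK -[N]dualK; exact: ses_dual.
- move=> M N h; have [K' [J [C [h1 h2 h3]]]] := image_ses h.
  by exists C, J, K'; split=> // /hdim_null.
Qed.

Lemma hereditary_rep (s t : Ar -> I) : hereditary (rep_data s t).
Proof. by split; [exact: half_rep | exact: half_rep_op]. Qed.
End RepHereditary.

(** * The initial sequence, made of simple representations *)

Section Simple.
Variables (I : finType) (B : I -> I -> int) (rk : I -> nat).
Hypothesis skew : forall i j, B i j = - B j i.
Hypothesis acyc : forall i j, 0 < B i j -> (rk i < rk j)%N.

Let bound := (\max_(p : I * I) absz (B p.1 p.2)).
(** One arrow from j to i for each unit of a positive entry B i j, against the arrows of the valued
    quiver: with this orientation B is the antisymmetrised Euler form of the simples, without a
    change of sign. *)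
Let Ar := {p : I * I * 'I_bound | (p.2 < absz (pospart (B p.1.1 p.1.2)))%N}.
Let s (a : Ar) : I := (val a).1.2.
Let t (a : Ar) : I := (val a).1.1.

Lemma card_arrows i j : #|[pred a : Ar | (s a == j) && (t a == i)]| = absz (pospart (B i j)).
Proof.
have le_b : (absz (pospart (B i j)) <= bound)%N.
  apply: leq_trans (leq_bigmax (F := fun p : I * I => absz (B p.1 p.2)) (i, j)).
  by rewrite /=; case: (pospartP (B i j)) => -[? ->].
pose f (m : 'I_(absz (pospart (B i j)))) : Ar :=
  exist _ ((i, j), widen_ord le_b m) (ltn_ord m).
have finj : injective f by move=> m n /(congr1 (fun a => (val a).2)) /= /val_eqP h; apply: val_inj; apply/eqP.
rewrite -[RHS]card_ord -(card_codom finj); apply: eq_card => a; rewrite inE.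
apply/andP/codomP => [[/eqP sa /eqP ta]|[m ->]]; last by rewrite /s /t /= !eqxx.
case: a sa ta => -[[i' j'] m] lt; rewrite /s /t /= => sa ta; subst i' j'.
by exists (Ordinal lt); apply: val_inj; congr (_, _); apply: val_inj.
Qed.

Let sre (i l : I) : 'M[rat]_1 := if l == i then 1%:M else 0.
Fact simple_reM i l m : sre i l *m sre i m = if l == m then sre i l else 0.
Proof.
rewrite /sre; have [->|lm] := eqVneq l m.
  by case: eqP => _; rewrite ?mulmx1 ?mulmx0.
case: eqP => [li|_]; last by rewrite mul0mx.
by rewrite -li eq_sym (negPf lm) mulmx0.
Qed.
Fact simple_re_sum i : \sum_l sre i l = 1%:M.
Proof.
rewrite (bigD1 i) //= big1 ?addr0 /sre ?eqxx // => l li; by rewrite (negPf li).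
Qed.
Fact simple_rfs i (a : Ar) : sre i (s a) *m (0 : 'M[rat]_1) = 0.
Proof. exact: mulmx0. Qed.
Fact simple_rft i (a : Ar) : (0 : 'M[rat]_1) *m sre i (t a) = 0.
Proof. exact: mul0mx. Qed.
Definition simple i : rep rat s t :=
  @Rep _ _ _ s t 1 (sre i) (fun=> 0) (simple_reM i) (simple_re_sum i) (simple_rfs i) (simple_rft i).

Lemma cl_simple i l : cl (simple i) l = if l == i then 1 else 0.
Proof. by rewrite /cl /dimv /= /sre; case: eqP => _; rewrite ?mxrank1 ?mxrank0. Qed.

Lemma chi_simple i j : euler_form s t (cl (simple j)) (cl (simple i)) =
  (if i == j then 1 else 0) - pospart (B i j).
Proof.
rewrite /euler_form; congr (_ - _).
  rewrite (bigD1 j) //= big1 ?addr0; last by move=> l lj; rewrite cl_simple (negPf lj) mul0r.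
  by rewrite !cl_simple eqxx mul1r eq_sym.
under eq_bigr => a _ do rewrite !cl_simple.
have -> : pospart (B i j) = (absz (pospart (B i j)))%:Z.
  by case: (pospartP (B i j)) => -[? ->]; lia.
rewrite -card_arrows -sum1_card (big_morph Posz PoszD (erefl _)) [RHS]big_mkcond /=.
by apply: eq_bigr => a _; rewrite inE; case: (s a == j); case: (t a == i).
Qed.

Lemma simple_hom0 i j : i != j -> hom0 (simple j) (simple i).
Proof.
move=> ij h [hg _]; have := hg j.
by rewrite /= /sre eqxx eq_sym (negPf ij) mul1mx mulmx0.
Qed.

Lemma simple_ext0 i j : B i j <= 0 -> ext0 (simple j) (simple i).
Proof.
move=> Bij phi P; exists 0; first by case: (ishom0 (simple j) (simple i)).
move=> a; rewrite mulmx0 ?mul0mx subr0; have [p1 p2] := P a.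
have [sa|sa] := eqVneq (s a) j; last first.
  by move: p1; rewrite /= /sre (negPf sa) mul0mx => <-.
have [ta|ta] := eqVneq (t a) i; last first.
  by move: p2; rewrite /= /sre (negPf ta) mulmx0 => <-.
have := card_arrows i j; have -> : pospart (B i j) = 0.
  by case: (pospartP (B i j)) => -[? ->]; lia.
by move/card0_eq => /(_ a); rewrite inE sa ta !eqxx.
Qed.

Let skew0 i : B i i = 0. Proof. have := skew i i; lia. Qed.

(** At the end all terms over A and Y are unshifted and without maps between each other. A positive
    entry B j l is then chi(M_j, M_l) - chi(M_l, M_j) with both terms nonpositive, which forces l to
    precede j. *)
Theorem acyclic_deletion (A Y : pred I) (w : seq I) :
  (forall i, A i -> ~~ Y i) -> all (predC Y) w ->
  exists w', all A w' /\ exists rk' : I -> nat, forall j l, A j || Y j -> A l || Y l ->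
    0 < foldl (@matmut I) B (w ++ w') j l -> (rk' j < rk' l)%N.
Proof.
move=> AY wY; have HD := hereditary_rep rat s t.
(* The simples are ordered against [rk], with ties broken by [enum_rank]; the sum is an upper bound
   that keeps the truncated subtraction injective. *)
pose r i := (\sum_j (rk j).+1 * #|I|.+1 - (rk i * #|I|.+1 + enum_rank i))%N.
have rle i : (rk i * #|I|.+1 + enum_rank i <= \sum_j (rk j).+1 * #|I|.+1)%N.
  rewrite (bigD1 i) //=; apply: leq_trans (leq_addr _ _).
  by rewrite mulSnr leq_add2l ltnW // ltnS ltnW // ltn_ord.
pose q i := (rk i * #|I|.+1 + enum_rank i)%N.
have qlt i j : (rk i < rk j)%N -> (q i < q j)%N.
  move=> lt; rewrite /q; apply: (@leq_trans ((rk i).+1 * #|I|.+1)); last first.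
    by apply: leq_trans (leq_addr _ _); rewrite leq_mul2r lt orbT.
  by rewrite mulSn addnC ltn_add2r ltnS ltnW.
have qinj : injective q.
  move=> i j E; have [lt|lt|rE] := ltngtP (rk i) (rk j).
  - by have := qlt _ _ lt; rewrite E ltnn.
  - by have := qlt _ _ lt; rewrite E ltnn.
  by move: E; rewrite /q rE => /addnI/ord_inj/enum_rank_inj.
have rq i j : (r i < r j)%N -> (q j < q i)%N.
  by rewrite /r -/(q i) -/(q j); have := rle i; have := rle j; rewrite -/(q i) -/(q j); lia.
pose S0 := @State I (rep_data rat s t) simple (fun=> true) r.
have g0 i : gvec S0 i = cl (simple i) by apply/funext => l; rewrite /gvec mul1r.
have HS0 : is_state S0 B.
  split; [split => //=|split].
  - move=> i; split; first by apply: simple_ext0; rewrite skew0.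
    by rewrite /hchi /= chi_simple eqxx skew0 subr0.
  - move=> i j E; apply: qinj; move: E; rewrite /r -/(q i) -/(q j).
    by have := rle i; have := rle j; rewrite -/(q i) -/(q j); lia.
  - move=> i j lt; split.
      by apply: simple_hom0; apply: contraTneq lt => ->; rewrite ltnn.
    apply: simple_ext0; rewrite leNgt; apply/negP => /acyc/qlt; have := rq _ _ lt; lia.
  - move=> i j lt _; apply: simple_hom0.
    by apply: contraTneq lt => ->; rewrite ltnn.
  - move=> i j; rewrite !g0 /= !chi_simple (eq_sym j) (skew j i).
    by case: (pospartP (B i j)) (pospartP (- B i j)) => -[? ->] [] [? ->]; lia.
  - move=> v; exists v => l; rewrite (bigD1 l) //= cl_simple eqxx mulr1 big1 ?addr0 //.
    by move=> j jl; rewrite cl_simple eq_sym (negPf jl) mulr0.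
have inv0 : coord_inv Y S0.
  by move=> y _ i; rewrite g0 cl_simple eq_sym.
have path u B' (S : state (rep_data rat s t)) : all (predC Y) u -> is_state S B' ->
    coord_inv Y S -> exists2 S1 : state (rep_data rat s t),
    is_state S1 (foldl (@matmut I) B' u) & coord_inv Y S1.
  elim: u B' S => [|k u IH] B' S /=; first by move=> _ HS inv; exists S.
  case/andP=> kY uY HS inv; have [S' mS] := state_mutation HD k HS.
  apply: (IH _ S') => //; first by case: mS.
  by apply: (@coord_inv_mut _ _ (predC Y) Y _ _ _ _ _ kY mS inv).
have [S1 HS1 inv1] := path w B S0 wY HS0 inv0.
have [w' [S2 [w'A HS2 inv2 pos]]] := reach_pos HD AY HS1 inv1.
exists w'; split=> //; exists (fun i => \max_j srk S2 j - srk S2 i)%N => j l Yj Yl.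
have ps i : A i || Y i -> spos S2 i.
  by case/orP => [/pos //|]; exact: (coord_inv_pos HD inv2).
rewrite foldl_cat (state_mat HD HS2) !ps // eqxx mul1r => gt0.
have lt : (srk S2 l < srk S2 j)%N.
  rewrite ltnNge; apply/negP; rewrite leq_eqVlt => /orP[/eqP/(state_inj HS2) E|lt].
    by move: gt0; rewrite E subrr.
  move: gt0; rewrite (chi_orth HD (state_ord HS2 lt)) subr0.
  have jl : j != l by apply: contraTneq lt => ->; rewrite ltnn.
  have := chi_h0 (proj1 HD) (state_ss HS2 jl (etrans (ps j Yj) (esym (ps l Yl)))).
  by lia.
have : (srk S2 j <= \max_j srk S2 j)%N by exact: leq_bigmax.
by move: lt; lia.
Qed.
End Simple.

(** * Rings generated by a family of elements *)

Section RingTactic.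
Variable R : comNzRingType.
Implicit Types x y : R.
Definition radd x y : R := x + y.
Definition rmul x y : R := x * y.
Definition ropp x : R := - x.
Definition rsub x y : R := x - y.
Definition rzero : R := 0.
Definition rone : R := 1.
Definition rexp x n : R := x ^+ n.
Lemma rexpE x n : x ^+ n = rexp x n. Proof. by []. Qed.
Lemma raddE x y : x + y = radd x y. Proof. by []. Qed.
Lemma rmulE x y : x * y = rmul x y. Proof. by []. Qed.
Lemma roppE x : - x = ropp x. Proof. by []. Qed.
Lemma rzeroE : 0 = rzero. Proof. by []. Qed.
Lemma roneE : 1 = rone. Proof. by []. Qed.
Lemma comring_theory : @ring_theory (GRing.ComNzRing.sort R) rzero rone radd rmul rsub ropp eq.
Proof.
split=> //; [exact: add0r|exact: addrC|exact: addrA|exact: mul1r|exact: mulrC|exact: mulrA|exact: mulrDl|exact: subrr].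
Qed.
Definition req x y := @eq (GRing.ComNzRing.sort R) x y.
Lemma reqP x y : req x y -> x = y. Proof. by []. Qed.
End RingTactic.
Ltac abstract_atoms t :=
  lazymatch t with
  | radd ?a ?b => abstract_atoms a; abstract_atoms b
  | rmul ?a ?b => abstract_atoms a; abstract_atoms b
  | ropp ?a => abstract_atoms a
  | rzero _ => idtac
  | rone _ => idtac
  | _ => first [is_var t | let y := fresh "y" in try set y := t]
  end.

Ltac cring R :=
  rewrite ?exprMn ?exprD ?exprS ?expr0; apply: (@reqP R);
  rewrite ?(@raddE R) ?(@rmulE R) ?(@roppE R) ?(@rzeroE R) ?(@roneE R) ?(@rexpE R);
  rewrite /req; match goal with |- ?a = ?b => abstract_atoms a; abstract_atoms b end; ring.

Section Gen.
Variable F : comNzRingType.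
Add Ring F_ring : (comring_theory F).
Implicit Types (R G : F -> Prop) (p q : {poly F}) (t a b : F).

(** The generated subring as an inductive predicate, so that claims are proved by induction on
    derivations; see [subring_generatedE] for the comparison with [subring_generated]. *)
Inductive gen (G : F -> Prop) : F -> Prop :=
| gen_in a : G a -> gen G a
| gen_1 : gen G 1
| gen_B a b : gen G a -> gen G b -> gen G (a - b)
| gen_M a b : gen G a -> gen G b -> gen G (a * b).

Definition isring R := [/\ R 1, forall a b, R a -> R b -> R (a - b) & forall a b, R a -> R b -> R (a * b)].

Lemma gen_ring G : isring (gen G).
Proof. by split; [exact: gen_1 | exact: gen_B | exact: gen_M]. Qed.

Lemma gen_sub G R : isring R -> (forall a, G a -> R a) -> forall a, gen G a -> R a.
Proof. by move=> [r1 rB rM] GR a; elim; auto. Qed.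

Lemma gen_mono G G' : (forall a, G a -> gen G' a) -> forall a, gen G a -> gen G' a.
Proof. exact: gen_sub (gen_ring _). Qed.

Section Ring.
Variable R : F -> Prop.
Hypothesis HR : isring R.
Lemma ring1 : R 1. Proof. by case: HR. Qed.
Lemma ringB a b : R a -> R b -> R (a - b). Proof. case: HR; auto. Qed.
Lemma ringM a b : R a -> R b -> R (a * b). Proof. case: HR; auto. Qed.
Lemma ring0 : R 0. Proof. by rewrite -(subrr 1); apply: ringB; exact: ring1. Qed.
Lemma ringN a : R a -> R (- a). Proof. by rewrite -sub0r; apply: ringB; exact: ring0. Qed.
Lemma ringD a b : R a -> R b -> R (a + b).
Proof. by move=> ra rb; rewrite -[b]opprK; apply: ringB => //; exact: ringN. Qed.
Lemma ringX a n : R a -> R (a ^+ n).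
Proof. by move=> ra; elim: n => [|n IH]; rewrite ?expr0 ?exprS; [exact: ring1 | exact: ringM]. Qed.
Lemma ring_sum (T : Type) (r : seq T) (P : pred T) (f : T -> F) :
  (forall i, P i -> R (f i)) -> R (\sum_(i <- r | P i) f i).
Proof. by move=> H; elim/big_ind: _ => //; [exact: ring0 | exact: ringD]. Qed.
Lemma ring_prod (T : Type) (r : seq T) (P : pred T) (f : T -> F) :
  (forall i, P i -> R (f i)) -> R (\prod_(i <- r | P i) f i).
Proof. by move=> H; elim/big_ind: _ => //; [exact: ring1 | exact: ringM]. Qed.

Definition polyr p := forall k, R p`_k.
Lemma polyrD p q : polyr p -> polyr q -> polyr (p + q).
Proof. by move=> hp hq k; rewrite coefD; exact: ringD. Qed.
Lemma polyrB p q : polyr p -> polyr q -> polyr (p - q).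
Proof. by move=> hp hq k; rewrite coefB; exact: ringB. Qed.
Lemma polyrM p q : polyr p -> polyr q -> polyr (p * q).
Proof. by move=> hp hq k; rewrite coefM; apply: ring_sum => i _; exact: ringM. Qed.
Lemma polyrC c : R c -> polyr c%:P.
Proof. by move=> hc k; rewrite coefC; case: ifP => _ //; exact: ring0. Qed.
Lemma polyrX : polyr 'X.
Proof. by move=> k; rewrite coefX; case: eqP => _; [exact: ring1 | exact: ring0]. Qed.
Lemma polyrXn n : polyr 'X^n.
Proof. by move=> k; rewrite coefXn; case: eqP => _; [exact: ring1 | exact: ring0]. Qed.
Lemma polyrE p n : polyr p -> polyr (p ^+ n).
Proof.
move=> hp; elim: n => [|n IH]; last by rewrite exprS; exact: polyrM.
by rewrite expr0; apply: (polyrC ring1).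
Qed.
Lemma polyr_horner p t : polyr p -> R t -> R p.[t].
Proof.
move=> hp ht; rewrite horner_coef; apply: ring_sum => i _.
by apply: ringM => //; exact: ringX.
Qed.

Lemma gen_horner t a : gen (fun b => R b \/ b = t) a -> exists2 p, polyr p & a = p.[t].
Proof.
elim=> {a} [a [Ra|->]||a b _ [p pp ->] _ [q qq ->]|a b _ [p pp ->] _ [q qq ->]].
- by exists a%:P; rewrite ?hornerC //; exact: polyrC.
- by exists 'X; rewrite ?hornerX //; exact: polyrX.
- by exists 1; rewrite ?hornerC //; exact: (polyrC ring1).
- by exists (p - q); rewrite ?hornerE //; exact: polyrB.
- by exists (p * q); rewrite ?hornerM //; exact: polyrM.
Qed.
End Ring.
End Gen.

(** * Polynomials and transcendence over a subring of a field *)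

Section Lift.
Variables (F : fieldType) (R : F -> Prop).
Add Ring F_ring : (comring_theory F).
Hypothesis HR : isring R.
Local Notation polyr := (polyr R).
Implicit Types (p q : {poly F}) (t a b f : F).

Lemma adj_horner t a : t != 0 -> gen (fun b => R b \/ b = t \/ b = t^-1) a ->
  exists m p, polyr p /\ a * t ^+ m = p.[t].
Proof.
move=> t0; elim=> {a} [a [Ra|[->|->]]||a b _ [m [p [pp pE]]] _ [n [q [qq qE]]]|
  a b _ [m [p [pp pE]]] _ [n [q [qq qE]]]].
- by exists 0%N, a%:P; rewrite hornerC expr0 mulr1; split=> //; exact: (polyrC HR).
- by exists 0%N, 'X; rewrite hornerX expr0 mulr1; split=> //; exact: (polyrX HR).
- by exists 1%N, 1; rewrite hornerC expr1 mulVf //; split=> //; exact: (polyrC HR (ring1 HR)).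
- by exists 0%N, 1; rewrite hornerC expr0 mulr1; split=> //; exact: (polyrC HR (ring1 HR)).
- exists (m + n)%N, (p * 'X^n - q * 'X^m); split.
    by apply: (polyrB HR); apply: (polyrM HR) => //; exact: (polyrXn HR).
  rewrite !hornerE -pE -qE; cring F.
- exists (m + n)%N, (p * q); split; first exact: (polyrM HR).
  by rewrite hornerM -pE -qE exprD; cring F.
Qed.

Definition transc t := forall p, polyr p -> p.[t] = 0 -> p = 0.

Lemma transc_neq0 t : transc t -> t != 0.
Proof.
move=> tr; apply/eqP => t0; have := tr 'X (polyrX HR); rewrite hornerX => /(_ t0)/eqP.
by rewrite polyX_eq0.
Qed.

Lemma transc_eq t p q : transc t -> polyr p -> polyr q -> p.[t] = q.[t] -> p = q.
Proof.
move=> tr hp hq E; apply/eqP; rewrite -subr_eq0; apply/eqP/tr; first exact: (polyrB HR).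
by rewrite hornerE hornerN E subrr.
Qed.

(* A polynomial whose leading coefficient is a unit divides within [R[t]]. *)
Lemma regular t f P N m g q d h m' : transc t -> R P -> P != 0 -> polyr g ->
  f * P ^+ N * t ^+ m = g.[t] ->
  polyr q -> size q = d.+1 -> R (q`_d)^-1 -> polyr h -> f * q.[t] * t ^+ m' = h.[t] ->
  exists n k, polyr k /\ f * t ^+ n = k.[t].
Proof.
move=> tr RP P0 gr gE qr sq qd hr hE.
have PN0 : P ^+ N != 0 by rewrite expf_neq0.
have E : q * g * 'X^m' = (P ^+ N)%:P * h * 'X^m.
  apply: (transc_eq tr).
  - by apply: (polyrM HR); [exact: (polyrM HR) | exact: (polyrXn HR)].
  - by apply: (polyrM HR); [apply: (polyrM HR) => //; apply: (polyrC HR); exact: (ringX HR) | exact: (polyrXn HR)].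
  by rewrite !hornerM !hornerXn hornerC -gE -hE; cring F.
(* f t^m = p(t), where p has coefficients in the field only. The product q p has coefficients in R,
   and those of p follow from the top down, since the leading coefficient of q is a unit of R. *)
pose p := (P ^+ N)^-1%:P * g.
have pE : p.[t] = f * t ^+ m by rewrite hornerM hornerC -gE mulrA [_ * (f * _)]mulrC mulfK.
have E' : q * p * 'X^m' = h * 'X^m.
  rewrite /p [q * _]mulrCA -!mulrA [q * _]mulrA E !mulrA -polyCM mulVf // mul1r.
  by [].
have qpr : polyr (q * p).
  move=> k; have := congr1 (fun r : {poly F} => r`_(k + m')) E'.
  rewrite coefMXn ltnNge leq_addl /= addnK => ->.
  by rewrite coefMXn; case: ifP => _ //; exact: (ring0 HR).
have qd0 : q`_d != 0.
  by have := lead_coef_eq0 q; rewrite lead_coefE sq /= => ->; rewrite -size_poly_eq0 sq.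
exists m, p; split=> // k; have [n] := ubnP (size p - k)%N.
elim: n k => // n IH k lt.
have [sk|sk] := leqP (size p) k; first by rewrite nth_default //; exact: (ring0 HR).
have := qpr (k + d)%N; rewrite coefM.
rewrite (bigD1 (inord d : 'I_(k + d).+1)) //= inordK; last by rewrite ltnS leq_addl.
rewrite addnK => H.
have H2 : R (\sum_(i < (k + d).+1 | i != inord d) q`_i * p`_(k + d - i)).
  apply: (ring_sum HR) => i ij; have [di|id] := ltnP d i.
    by rewrite nth_default ?sq // mul0r; exact: (ring0 HR).
  apply: (ringM HR) => //; apply: IH.
  have : (i < d)%N.
    rewrite ltn_neqAle id andbT; apply: contraNneq ij => E2.
    by apply/eqP/val_inj; rewrite /= inordK ?ltnS ?leq_addl.
  by lia.
have -> : p`_k = (q`_d)^-1 * ((q`_d * p`_k + \sum_(i < (k + d).+1 | i != inord d) q`_i * p`_(k + d - i))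
     - \sum_(i < (k + d).+1 | i != inord d) q`_i * p`_(k + d - i)).
  by rewrite addrK mulKf.
by apply: (ringM HR) => //; exact: (ringB HR).
Qed.
End Lift.

Section Swap.
Variable F : fieldType.
Implicit Types (R : F -> Prop) (t u : F).

Lemma transc_mono R R' t : (forall a, R a -> R' a) -> transc R' t -> transc R t.
Proof. by move=> RR tr p pR; apply: tr => k; exact: RR. Qed.

Definition adj R t : F -> Prop := gen (fun b => R b \/ b = t \/ b = t^-1).

Lemma lift_poly R t p : isring R -> t != 0 -> polyr (adj R t) p ->
  exists m (q : nat -> {poly F}), forall k, polyr R (q k) /\ p`_k * t ^+ m = (q k).[t].
Proof.
move=> HR t0 pR.
have /choice [M HM] : forall k, exists mq : nat * {poly F}, polyr R mq.2 /\ p`_k * t ^+ mq.1 = mq.2.[t].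
  by move=> k; have [m [q qH]] := adj_horner HR t0 (pR k); exists (m, q).
pose N := \max_(k < size p) (M k).1.
exists N, (fun k => if (k < size p)%N then (M k).2 * 'X^(N - (M k).1) else 0) => k.
case: ifP => kp; last first.
  by split; [apply: (polyrC HR (ring0 HR)) | rewrite nth_default ?mul0r ?horner0 // leqNgt kp].
have [h1 h2] := HM k; split; first by apply: polyrM => //; exact: polyrXn.
have le : ((M k).1 <= N)%N by exact: (@leq_bigmax _ (fun k : 'I_(size p) => (M k).1) (Ordinal kp)).
by rewrite hornerM hornerXn -h2 -mulrA -exprD subnKC.
Qed.

(** After clearing denominators, a relation for u over R[t, 1/t] is a polynomial in t and u over R.
    Its coefficients in t vanish because t is transcendental over R[u, 1/u], and then their
    coefficients in u vanish. *)
Lemma transc_swap R t u : isring R -> transc R u -> transc (adj R u) t -> transc (adj R t) u.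
Proof.
move=> HR tu tt p pR pu0.
have HRu : isring (adj R u) by exact: gen_ring.
have t0 := transc_neq0 HRu tt.
have [m [q H]] := lift_poly HR t0 pR.
pose r := \sum_(k < size p) (u ^+ k)%:P * q k.
have r0 : r = 0.
  apply: tt.
    move=> d; rewrite coef_sum; apply: (ring_sum HRu) => k _; rewrite coefCM.
    apply: (ringM HRu); last by apply: gen_in; left; case: (H k).
    by apply: (ringX HRu); apply: gen_in; right; left.
  rewrite horner_sum; apply: etrans (_ : p.[u] * t ^+ m = 0); last by rewrite pu0 mul0r.
  rewrite horner_coef big_distrl; apply: eq_bigr => k _ /=.
  by rewrite hornerM hornerC; case: (H k) => _ <-; rewrite mulrCA mulrA.
apply/polyP => k; rewrite coef0; have [kp|kp] := ltnP k (size p); last by rewrite nth_default.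
apply: (mulIf (expf_neq0 m t0)); rewrite mul0r; case: (H k) => _ ->.
suff -> : q k = 0 by rewrite horner0.
apply/polyP => d; rewrite coef0.
have Z : \poly_(j < size p) (q j)`_d = 0.
  apply: tu; first by move=> j; rewrite coef_poly; case: ifP => _; [case: (H j) | exact: ring0].
  rewrite horner_poly; have := congr1 (fun s : {poly F} => s`_d) r0; rewrite coef0 coef_sum => E0.
  by apply: etrans E0; apply: eq_bigr => j _; rewrite coefCM mulrC.
by have := congr1 (fun s : {poly F} => s`_k) Z; rewrite coef0 coef_poly kp.
Qed.
End Swap.

(** * Laurent rings in which only some variables are inverted *)

Section Lau.
Variables (F : fieldType) (I : finType).
Implicit Types (x : I -> F) (D E : pred I).

Definition lau x D E := gen (fun a => (exists2 l, D l & a = x l) \/ (exists2 l, E l & a = (x l)^-1)).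

Lemma lau_ring x D E : isring (lau x D E). Proof. exact: gen_ring. Qed.
Lemma lau_in x D E l : D l -> lau x D E (x l).
Proof. by move=> Dl; apply: gen_in; left; exists l. Qed.
Lemma lau_inV x D E l : E l -> lau x D E (x l)^-1.
Proof. by move=> Dl; apply: gen_in; right; exists l. Qed.
Lemma lau_sub x D E x' D' E' : (forall l, D l -> lau x' D' E' (x l)) ->
  (forall l, E l -> lau x' D' E' (x l)^-1) -> forall a, lau x D E a -> lau x' D' E' a.
Proof. by move=> h1 h2; apply: gen_mono => a [[l Dl ->]|[l El ->]]; [exact: h1 | exact: h2]. Qed.
Lemma lau_mono x D E D' E' : subpred D D' -> subpred E E' -> forall a, lau x D E a -> lau x D' E' a.
Proof. by move=> h1 h2; apply: lau_sub => l H; [apply: lau_in | apply: lau_inV]; auto. Qed.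

Definition off i : pred I := predC1 i.
Definition offp (D : pred I) i : pred I := fun l => D l && (l != i).

Lemma lau_lift x D E i a : x i != 0 -> lau x D E a ->
  exists m p, polyr (lau x (offp D i) (offp E i)) p /\ a * x i ^+ m = p.[x i].
Proof.
move=> xi h; apply: adj_horner => //; first exact: lau_ring.
apply: gen_mono h => b [[l Dl ->]|[l El ->]].
  have [->|li] := eqVneq l i; first by apply: gen_in; right; left.
  by apply: gen_in; left; apply: lau_in; rewrite /offp Dl.
have [->|li] := eqVneq l i; first by apply: gen_in; right; right.
by apply: gen_in; left; apply: lau_inV; rewrite /offp El.
Qed.

(** The form of algebraic independence that is carried along mutations; [alg_independent_tr] derives
    it from the one of the seeds. *)
Definition tr_indep x := forall i, transc (lau x (off i) (off i)) (x i).

Lemma tr_neq0 x i : tr_indep x -> x i != 0.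
Proof. by move=> /(_ i); apply: transc_neq0; exact: lau_ring. Qed.

Definition mon x (a : I -> int) : F := \prod_l x l ^ a l.

Lemma monD x a b : (forall l, x l != 0) -> mon x (fun l => a l + b l) = mon x a * mon x b.
Proof. by move=> x0; rewrite -big_split; apply: eq_bigr => l _; rewrite expfzDr. Qed.
Lemma mon_neq0 x a : (forall l, x l != 0) -> mon x a != 0.
Proof. by move=> x0; rewrite prodf_seq_neq0; apply/allP => l _; rewrite expfz_neq0. Qed.
Lemma monN x a : mon x (fun l => - a l) = (mon x a)^-1.
Proof. by rewrite /mon -prodfV; apply: eq_bigr => l _; rewrite invr_expz. Qed.
Lemma monX x a n : mon x (fun l => a l * n%:Z) = mon x a ^+ n.
Proof. by rewrite /mon -prodrXl; apply: eq_bigr => l _; rewrite exprnP exprz_exp. Qed.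
Lemma eq_mon x a b : a =1 b -> mon x a = mon x b.
Proof. by move=> E; apply: eq_bigr => l _; rewrite E. Qed.
Lemma mon_pull x a i : mon x a = x i ^ a i * mon x (fun l => if l == i then 0 else a l).
Proof.
rewrite /mon (bigD1 i) //= [in RHS](bigD1 i) //= eqxx expr0z mul1r; congr (_ * _).
by apply: eq_bigr => l /negPf ->.
Qed.
Lemma lau_mon x D E a : (forall l, 0 < a l -> D l) -> (forall l, a l < 0 -> E l) -> lau x D E (mon x a).
Proof.
move=> h1 h2; apply: (ring_prod (lau_ring _ _ _)) => l _.
have [al|al] := lerP 0 (a l).
  have [a0|a0] := eqVneq (a l) 0; first by rewrite a0 expr0z; exact: (ring1 (lau_ring _ _ _)).
  have -> : a l = (absz (a l))%:Z by lia.
  rewrite -exprnP; apply: (ringX (lau_ring _ _ _)); apply: lau_in; apply: h1; lia.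
have -> : a l = - (absz (a l))%:Z by lia.
rewrite -exprz_inv -exprnP; apply: (ringX (lau_ring _ _ _)).
by apply: lau_inV; apply: h2; lia.
Qed.
End Lau.

(** * Places *)

Definition char0 (F : fieldType) := forall n : nat, (n.+1)%:R != 0 :> F.

Section Place.
Variables F K : fieldType.
Variable R : (F * K)%type -> Prop.
Add Ring F_ring : (comring_theory F).
Add Ring K_ring : (comring_theory K).

(** For a subring R of F x K, this says that R is the graph of a ring homomorphism defined on its
    first projection. *)
Definition functional := forall p, R p -> p.1 = 0 -> p.2 = 0.

(* [spec a c]: the element [a] has the value [c] at the place that extends the relation [R]. *)
Definition spec (a : F) (c : K) :=
  exists p q, [/\ R p, R q, q.2 != 0, a * q.1 = p.1 & c * q.2 = p.2].

Hypothesis HR : isring R.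
Implicit Types (a b : F) (c d : K).

Lemma spec_in a c : R (a, c) -> spec a c.
Proof. by move=> h; exists (a, c), 1; split=> //=; rewrite ?mulr1 ?oner_eq0 //; exact: ring1. Qed.

Lemma spec1 : spec 1 1. Proof. by apply: spec_in; exact: (ring1 HR). Qed.

Lemma spec0 : spec 0 0. Proof. by apply: spec_in; exact: (ring0 HR). Qed.

Lemma specM a b c d : spec a c -> spec b d -> spec (a * b) (c * d).
Proof.
move=> [p [q [pR qR q0 e1 e2]]] [p' [q' [pR' qR' q0' e1' e2']]].
exists (p * p'), (q * q'); split; rewrite /= ?mulf_neq0 //; try exact: (ringM HR).
  by rewrite -e1 -e1'; cring F.
by rewrite -e2 -e2'; cring K.
Qed.

Lemma specB a b c d : spec a c -> spec b d -> spec (a - b) (c - d).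
Proof.
move=> [p [q [pR qR q0 e1 e2]]] [p' [q' [pR' qR' q0' e1' e2']]].
exists (p * q' - p' * q), (q * q'); split; rewrite /= ?mulf_neq0 //; try exact: (ringM HR).
- by apply: (ringB HR); exact: (ringM HR).
- by rewrite -e1 -e1'; cring F.
by rewrite -e2 -e2'; cring K.
Qed.

Lemma specD a b c d : spec a c -> spec b d -> spec (a + b) (c + d).
Proof.
move=> h1 h2; have := specB h1 (specB spec0 h2).
by rewrite !sub0r !opprK.
Qed.

Lemma specX a c n : spec a c -> spec (a ^+ n) (c ^+ n).
Proof. by move=> h; elim: n => [|n IH]; rewrite ?expr0 ?exprS; [exact: spec1 | exact: specM]. Qed.

Lemma spec_prod (T : Type) (r : seq T) (a : T -> F) (c : T -> K) :
  (forall l, spec (a l) (c l)) -> spec (\prod_(l <- r) a l) (\prod_(l <- r) c l).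
Proof.
move=> h; elim: r => [|l r IH]; rewrite ?big_nil ?big_cons; first exact: spec1.
exact: specM.
Qed.

Lemma spec_sum (T : Type) (r : seq T) (a : T -> F) (c : T -> K) :
  (forall l, spec (a l) (c l)) -> spec (\sum_(l <- r) a l) (\sum_(l <- r) c l).
Proof.
move=> h; elim: r => [|l r IH]; rewrite ?big_nil ?big_cons; first exact: spec0.
exact: specD.
Qed.

Hypothesis HF : functional.

Lemma spec_uniq a c d : spec a c -> spec a d -> c = d.
Proof.
move=> [p [q [pR qR q0 e1 e2]]] [p' [q' [pR' qR' q0' e1' e2']]].
have /HF : R (p * q' - p' * q) by apply: (ringB HR); exact: (ringM HR).
rewrite /= -e1 -e1' -e2 -e2' => H; apply/eqP; rewrite -subr_eq0; apply/eqP.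
apply: (mulIf (mulf_neq0 q0 q0')); rewrite mul0r -[RHS]H; last by cring F.
by cring K.
Qed.

Lemma specV a c : c != 0 -> spec a c -> spec a^-1 c^-1.
Proof.
move=> c0 [p [q [pR qR q0 e1 e2]]].
have p0 : p.2 != 0 by rewrite -e2 mulf_neq0.
have a0 : a != 0.
  by apply: contraNneq p0 => a0; apply/eqP/HF => //; rewrite -e1 a0 mul0r.
by exists q, p; split=> //; rewrite -?e1 -?e2 mulrA mulVf ?mul1r.
Qed.

Lemma spec_neq0 a c : c != 0 -> spec a c -> a != 0.
Proof.
move=> c0 h; apply: contraNneq c0 => a0; rewrite a0 in h.
by rewrite (spec_uniq h spec0).
Qed.

End Place.

Section Mutation.
Variables (F : fieldType) (I : finType).
Implicit Types (x : I -> F) (b : I -> int) (s : (I -> F) * (I -> I -> int)).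

Definition expoly x b : F := mon x (fun l => pospart (b l)) + mon x (fun l => pospart (- b l)).
Definition vmut x b i : I -> F := fun j => if j == i then expoly x b / x i else x j.
Definition smut s i := (vmut s.1 (s.2 i) i, matmut s.2 i).
Definition smuts := foldl smut.

(** The condition under which a place commutes with mutation along w: no denominator of an exchange
    relation vanishes. *)
Fixpoint nonvanishing s (w : seq I) :=
  if w is i :: w' then (s.1 i != 0) && nonvanishing (smut s i) w' else true.

End Mutation.

Section SpecMutation.
Variables (F K : fieldType) (I : finType).
Variable R : (F * K)%type -> Prop.
Hypothesis HR : isring R.
Hypothesis HF : functional R.
Implicit Types (x : I -> F) (z : I -> K) (B : I -> I -> int).
Implicit Types (s : (I -> F) * (I -> I -> int)) (t : (I -> K) * (I -> I -> int)).

Lemma spec_mon x z (a : I -> int) : (forall l, 0 <= a l) -> (forall l, spec R (x l) (z l)) ->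
  spec R (mon x a) (mon z a).
Proof.
move=> a0 h; apply: spec_prod => // l; have -> : a l = (absz (a l))%:Z by have := a0 l; lia.
by rewrite -!exprnP; exact: specX.
Qed.

Lemma spec_expoly x z b : (forall l, spec R (x l) (z l)) -> spec R (expoly x b) (expoly z b).
Proof.
by move=> h; apply: specD => //; apply: spec_mon => // l; have := pospartP (b l);
  have := pospartP (- b l); lia.
Qed.

Lemma spec_smut s t i : s.2 = t.2 -> (forall l, spec R (s.1 l) (t.1 l)) -> t.1 i != 0 ->
  (smut s i).2 = (smut t i).2 /\ forall l, spec R ((smut s i).1 l) ((smut t i).1 l).
Proof.
move=> e h ti; rewrite /= -e; split=> // l; rewrite /vmut; case: eqP => _ //.
by apply: specM => //; [exact: spec_expoly | exact: specV].
Qed.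

Lemma spec_smuts s t w : s.2 = t.2 -> (forall l, spec R (s.1 l) (t.1 l)) -> nonvanishing t w ->
  (smuts s w).2 = (smuts t w).2 /\ forall l, spec R ((smuts s w).1 l) ((smuts t w).1 l).
Proof.
elim: w s t => [|i w IH] s t // e h /= /andP[ti nv].
by have [e' h'] := spec_smut e h ti; exact: IH.
Qed.

(** The graph of the evaluation that sends the variables x to z. *)
Definition pairs x z := gen (fun p : (F * K)%type => exists l, p = (x l, z l)).

Lemma char0_int (G : fieldType) (n : int) : char0 G -> n%:~R = 0 :> G -> n = 0.
Proof.
move=> c0; case: n => [[|n]|n] //.
  by move=> /eqP; rewrite -pmulrn (negPf (c0 _)).
by rewrite NegzE mulrNz => /eqP; rewrite oppr_eq0 -pmulrn (negPf (c0 _)).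
Qed.

(** Induction on the variables that occur. A relation that holds at x is a polynomial in the last
    variable; its coefficients vanish at x by transcendence, hence at z by induction. *)
Lemma functional_pairs x z : char0 F -> tr_indep x -> functional (pairs x z).
Proof.
move=> c0 tr.
suff H (r : seq I) : functional (gen (fun p : (F * K)%type => exists2 l, l \in r & p = (x l, z l))).
  move=> p pR; apply: (H (enum I)); apply: gen_mono pR => _ [l ->].
  by apply: gen_in; exists l; rewrite ?mem_enum.
elim: r => [|l r IH] p.
  have Hint : gen (fun p : (F * K)%type => exists2 l, l \in [::] & p = (x l, z l)) p ->
      exists n : int, p = (n%:~R, n%:~R).
    elim=> {p} [a [l //]||a b _ [n ->] _ [m ->]|a b _ [n ->] _ [m ->]].
    - by exists 1.
    - by exists (n - m); rewrite !intrB.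
    - by exists (n * m); rewrite !intrM.
  by move=> /Hint[n ->] /= /(char0_int c0) ->.
have [lr|lr] := boolP (l \in r).
  move=> pR; apply: IH; apply: gen_mono pR => _ [k kr ->].
  apply: gen_in; exists k => //; move: kr; rewrite inE; by case: eqP => [->|].
move=> pR.
have : gen (fun b => gen (fun p : (F * K)%type => exists2 l, l \in r & p = (x l, z l)) b \/ b = (x l, z l)) p.
  apply: gen_mono pR => _ [k kr ->]; apply: gen_in; move: kr; rewrite inE.
  by case: eqP => [-> _|_ kr]; [right | left; apply: gen_in; exists k].
move=> /(gen_horner (gen_ring _)) [P PR ->].
have E1 : (P.[(x l, z l)]).1 = (map_poly fst P).[x l] by rewrite -horner_map.
have E2 : (P.[(x l, z l)]).2 = (map_poly snd P).[z l] by rewrite -horner_map.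
rewrite E1 E2 => H; suff -> : map_poly snd P = 0 by rewrite horner0.
have P0 : map_poly fst P = 0.
  apply: (tr l) => // k; rewrite coef_map /=.
  have hh := gen_sub (R := fun p : (F * K)%type => lau x (off l) (off l) p.1).
  apply: hh (PR k).
    have HL := lau_ring x (off l) (off l).
    by split; [exact: (ring1 HL) | move=> ? ? ; exact: (ringB HL) | move=> ? ?; exact: (ringM HL)].
  move=> _ [j jr ->] /=; apply: lau_in; rewrite /off /=; by apply: contraNneq lr => <-.
apply/polyP => k; rewrite coef_map coef0 /=; apply: IH; first exact: PR.
by have := congr1 (fun s : {poly F} => s`_k) P0; rewrite coef_map coef0.
Qed.

Lemma pairs_ring x z : isring (pairs x z). Proof. exact: gen_ring. Qed.
Lemma spec_pairs x z l : spec (pairs x z) (x l) (z l).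
Proof. by apply: spec_in; [exact: gen_ring | apply: gen_in; exists l]. Qed.

End SpecMutation.

(** * Mutation of transcendental families *)

Section Matmut.
Variable I : eqType.
Implicit Types B : I -> I -> int.

Definition skew B := forall i j, B i j = - B j i.

Lemma skew_diag B i : skew B -> B i i = 0.
Proof. by move=> sk; have := sk i i; lia. Qed.

Lemma pospart_ge0 n : 0 <= pospart n.
Proof. by have := pospartP n; lia. Qed.

Lemma skew_matmut B k : skew B -> skew (matmut B k).
Proof.
move=> sk i j; rewrite /matmut orbC; case: ifP => _; first by rewrite sk.
by rewrite (sk i j) (sk i k) (sk k j) !opprK; lra.
Qed.

Lemma matmutK B k : matmut (matmut B k) k = B.
Proof.
apply/funext => i; apply/funext => j; rewrite /matmut.
have [e|ki] := eqVneq k i; first by rewrite opprK.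
have [e|kj] := eqVneq k j; first by rewrite opprK.
by rewrite /= !eqxx ?orbT /= !opprK; lra.
Qed.

Lemma matmutC B k l : skew B -> B k l = 0 -> matmut (matmut B k) l = matmut (matmut B l) k.
Proof.
move=> sk kl; have lk : B l k = 0 by rewrite sk kl oppr0.
have [->//|nkl] := eqVneq k l.
have p0 : pospart 0 = 0 by [].
apply/funext => i; apply/funext => j; rewrite /matmut.
case: (altP (k =P i)) => [ki|ki]; case: (altP (l =P i)) => [li|li];
case: (altP (k =P j)) => [kj|kj]; case: (altP (l =P j)) => [lj|lj] => //=;
rewrite ?eqxx ?(negPf nkl) ?(eq_sym l k) ?(negPf nkl) /= ?orbT /= ?kl ?lk ?oppr0 ?p0; try lra;
subst; rewrite ?kl ?lk ?eqxx ?oppr0 ?p0 in nkl *; rewrite ?mulr0 ?mul0r ?addr0 ?subr0; lra.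
Qed.
End Matmut.

Section TrMut.
Variables (F : fieldType) (I : finType).
Add Ring F_ring : (comring_theory F).
Implicit Types (x : I -> F) (b : I -> int) (s : (I -> F) * (I -> I -> int)).

(** At the place where all variables are 1, the exchange polynomial takes the value 2. *)
Lemma expoly_neq0 x b : char0 F -> tr_indep x -> expoly x b != 0.
Proof.
move=> c0 tr; pose z (l : I) : F := 1.
have m1 a : mon z a = 1 by apply: big1 => l _; rewrite exp1rz.
apply: (@spec_neq0 _ _ (pairs x z) _ _ _ (expoly z b)).
- exact: pairs_ring.
- exact: functional_pairs.
- by rewrite /expoly !m1; exact: (c0 1%N).
- by apply: spec_expoly => [|l]; [exact: pairs_ring | exact: spec_pairs].
Qed.

Lemma lau_expoly x b (D E : pred I) : (forall l, b l != 0 -> D l) -> lau x D E (expoly x b).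
Proof.
move=> h; apply: (ringD (lau_ring _ _ _)); apply: lau_mon => l.
- by have := pospartP (b l) => ? ?; apply: h; lia.
- by have := pospart_ge0 (b l) => ? ?; lia.
- by have := pospartP (- b l) => ? ?; apply: h; lia.
- by have := pospart_ge0 (- b l) => ? ?; lia.
Qed.

Lemma horner_rev (t P : F) (p : {poly F}) N : t != 0 -> (size p <= N.+1)%N ->
  (\poly_(k < N.+1) (p`_(N - k) * P ^+ (N - k))).[t] = p.[P / t] * t ^+ N.
Proof.
move=> t0 pN; rewrite horner_poly (horner_coef_wide _ pN) big_distrl /= [RHS](reindex_inj rev_ord_inj).
apply: eq_bigr => k _ /=; rewrite subSS expr_div_n -!mulrA; congr (_ * (_ * _)).
have kN : (k <= N)%N by rewrite -ltnS.
have -> : t ^+ N = t ^+ (N - k) * t ^+ k by rewrite -exprD subnK.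
by rewrite mulKf // expf_neq0.
Qed.

(** Reversing a relation for P / t and multiplying by a power of t gives a relation for t. *)
Lemma transc_div (R : F -> Prop) (t P : F) : isring R -> R P -> P != 0 -> transc R t -> transc R (P / t).
Proof.
move=> HR RP P0 tt p pR p0; have t0 := transc_neq0 HR tt.
pose N := size p.
pose q := \poly_(k < N.+1) (p`_(N - k) * P ^+ (N - k)).
have q0 : q = 0.
  apply: tt => [k|].
    rewrite coef_poly; case: ifP => _; last exact: ring0.
    by apply: (ringM HR) => //; exact: (ringX HR).
  by rewrite horner_rev // p0 mul0r.
apply/polyP => k; rewrite coef0; have [kN|kN] := ltnP k N; last by rewrite nth_default.
have := congr1 (fun s : {poly F} => s`_(N - k)) q0.
rewrite coef_poly coef0 ltnS leq_subr subKn; last exact: ltnW.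
by move=> /eqP; rewrite mulf_eq0 expf_eq0 (negPf P0) andbF orbF => /eqP.
Qed.

Lemma vmutE x b i l : l != i -> vmut x b i l = x l.
Proof. by rewrite /vmut => /negPf ->. Qed.
Lemma vmut_id x b i : vmut x b i i = expoly x b / x i.
Proof. by rewrite /vmut eqxx. Qed.

(** For j != i, the new variable at i is transcendental over the others with x_j adjoined;
    [transc_swap] then makes x_j transcendental over the others with the new variable adjoined. *)
Lemma tr_vmut x b i : char0 F -> tr_indep x -> b i = 0 -> tr_indep (vmut x b i).
Proof.
move=> c0 tr bi j; have bP l : b l != 0 -> off i l by rewrite /off /=; apply: contraNneq => ->; rewrite bi.
have xi : transc (lau x (off i) (off i)) (vmut x b i i).
  rewrite vmut_id; apply: transc_div => //; first exact: lau_ring.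
    exact: lau_expoly.
  exact: expoly_neq0.
have [->|ji] := eqVneq j i.
  by apply: transc_mono xi; apply: lau_sub => l li;
    rewrite (vmutE _ _ li); [exact: lau_in | exact: lau_inV].
rewrite (vmutE _ _ ji).
pose D : pred I := offp (off i) j.
apply: (@transc_mono _ _ (adj (lau x D D) (vmut x b i i))).
  apply: gen_mono => a; have HA : isring (adj (lau x D D) (vmut x b i i)) by exact: gen_ring.
  by case=> -[l lj ->]; have [->|li] := eqVneq l i; try (by apply: gen_in; right; auto);
    rewrite (vmutE _ _ li); apply: gen_in; left; [apply: lau_in | apply: lau_inV];
    rewrite /D /offp /off /= li.
apply: transc_swap; first exact: lau_ring.
  apply: transc_mono (tr j); apply: lau_mono => l; rewrite /D /offp /off /= => /andP[] //.
apply: transc_mono xi; apply: gen_mono => a [|[]->].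
- by apply: lau_mono => l; rewrite /D /offp => /andP[].
- by apply: lau_in.
- by apply: lau_inV.
Qed.

Definition good s := [/\ char0 F, tr_indep s.1 & skew s.2].

Lemma good_smut s i : good s -> good (smut s i).
Proof.
by case=> c0 tr sk; split=> //=; [apply: tr_vmut => //; exact: skew_diag | exact: skew_matmut].
Qed.
Lemma good_smuts s w : good s -> good (smuts s w).
Proof. by elim: w s => //= i w IH s h; apply: IH; exact: good_smut. Qed.
Lemma good_neq0 s l : good s -> s.1 l != 0.
Proof. by case=> _ tr _; exact: tr_neq0. Qed.
Lemma eq_mon_in x y a : (forall l, a l != 0 -> x l = y l) -> mon x a = mon y a.
Proof.
move=> h; apply: eq_bigr => l _; have [->|al] := eqVneq (a l) 0; first by rewrite !expr0z.
by rewrite h.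
Qed.

Lemma eq_expoly_in x y b : (forall l, b l != 0 -> x l = y l) -> expoly x b = expoly y b.
Proof.
by move=> h; congr (_ + _); apply: eq_mon_in => l; [have := pospartP (b l)|have := pospartP (- b l)];
  move=> H1 H2; apply: h; lia.
Qed.

Lemma eq_expoly x b c : b =1 c -> expoly x b = expoly x c.
Proof. by move=> h; congr (_ + _); apply: eq_mon => l; rewrite h. Qed.

Lemma expolyN x b : expoly x (fun l => - b l) = expoly x b.
Proof. by rewrite /expoly addrC; congr (_ + _); apply: eq_mon => l; rewrite ?opprK. Qed.

Lemma smutK s i : good s -> smut (smut s i) i = s.
Proof.
move=> gs; case: (gs) => c0 tr sk; case: s gs tr sk => x B gs tr sk; rewrite /smut /= matmutK //.
congr (_, _); apply/funext => j; rewrite {1}/vmut; case: eqVneq => [->|ji]; last by rewrite vmutE.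
have -> : expoly (vmut x (B i) i) (matmut B i i) = expoly x (B i).
  rewrite -[RHS]expolyN; have E : matmut B i i =1 fun l => - B i l by move=> l; rewrite /matmut eqxx.
  rewrite (eq_expoly _ E); apply: eq_expoly_in => l; rewrite oppr_eq0 => bl; rewrite vmutE //.
  by apply: contraNneq bl => ->; rewrite skew_diag.
have P0 : expoly x (B i) != 0 by exact: expoly_neq0.
by rewrite vmut_id invf_div mulrCA mulfV // mulr1.
Qed.

Lemma smutC s i j : good s -> s.2 i j = 0 -> smut (smut s i) j = smut (smut s j) i.
Proof.
case: s => x B [c0 tr /= sk] /= ij; have [->//|nij] := eqVneq i j.
have ji : B j i = 0 by rewrite sk ij oppr0.
have p0 : pospart 0 = 0 by [].
rewrite /smut /= matmutC //; congr (_, _); apply/funext => l; rewrite /vmut.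
have M1 : matmut B i j =1 B j.
  by move=> k; rewrite /matmut (negPf nij) /= ji oppr0 p0; case: eqP => [<-|_]; rewrite ?ji ?oppr0; lra.
have M2 : matmut B j i =1 B i.
  by move=> k; rewrite /matmut eq_sym (negPf nij) /= ij oppr0 p0; case: eqP => [<-|_]; rewrite ?ij ?oppr0; lra.
rewrite (eq_expoly _ M1) (eq_expoly _ M2).
have [->|lj] := eqVneq l j.
  rewrite eq_sym (negPf nij); congr (_ / _); apply: eq_expoly_in => k bk.
  by case: eqP => // e; rewrite e ji eqxx in bk.
have [_|li] := eqVneq l i; last by [].
rewrite (negPf nij).
congr (_ / _); apply: esym; apply: eq_expoly_in => k bk.
by case: eqP => // e; rewrite e ij eqxx in bk.
Qed.

Lemma smutN x B i : smut (x, fun i j => - B i j) i = ((smut (x, B) i).1, fun k l => - (smut (x, B) i).2 k l).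
Proof.
rewrite /smut /=; congr (_, _); last by apply/funext => k; apply/funext => l; rewrite matmutN.
by apply/funext => j; rewrite /vmut; case: eqP => // _; congr (_ / _); exact: expolyN.
Qed.

Lemma smutsN x B w : smuts (x, fun i j => - B i j) w = ((smuts (x, B) w).1, fun k l => - (smuts (x, B) w).2 k l).
Proof. by elim: w x B => //= i w IH x B; rewrite smutN IH. Qed.
End TrMut.

(** * Dropping a variable with the value 1 *)

Section Drop.
Variables (F : fieldType) (I I0 : finType) (phi : I0 -> I) (o : I).
Hypothesis phi_inj : injective phi.
Hypothesis phi_o : forall l, phi l != o.
Hypothesis phiP : forall l, l != o -> exists l0, l = phi l0.
Implicit Types (x : I -> F) (s : (I -> F) * (I -> I -> int)).

Definition restr s := (fun l => s.1 (phi l), fun k l => s.2 (phi k) (phi l)).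

Lemma mon_drop x a : x o = 1 -> mon x a = mon (fun l => x (phi l)) (fun l => a (phi l)).
Proof.
move=> xo; rewrite /mon (bigD1 o) //= xo exp1rz mul1r -big_filter.
rewrite -(big_map phi predT (fun l => x l ^ a l)); apply: perm_big.
apply: uniq_perm; first by rewrite filter_uniq // index_enum_uniq.
  by rewrite map_inj_uniq // index_enum_uniq.
move=> l; rewrite mem_filter mem_index_enum andbT; apply/idP/mapP => [/phiP[l0 ->]|[l0 _ ->] //].
by exists l0; rewrite ?mem_index_enum.
Qed.

Lemma expoly_drop x b : x o = 1 -> expoly x b = expoly (fun l => x (phi l)) (fun l => b (phi l)).
Proof. by move=> xo; rewrite /expoly !mon_drop. Qed.

Lemma smut_drop s i : s.1 o = 1 ->
  restr (smut s (phi i)) = smut (restr s) i /\ (smut s (phi i)).1 o = 1.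
Proof.
move=> so; split; last by rewrite /= vmutE // eq_sym.
rewrite /restr /smut /=; congr (_, _).
  apply/funext => l; rewrite /vmut (inj_eq phi_inj); case: eqP => // _.
  by rewrite expoly_drop.
by apply/funext => k; apply/funext => l; rewrite /matmut !(inj_eq phi_inj).
Qed.

Lemma smuts_drop s w : s.1 o = 1 ->
  restr (smuts s (map phi w)) = smuts (restr s) w /\ (smuts s (map phi w)).1 o = 1.
Proof.
elim: w s => //= i w IH s so; have [<- so'] := smut_drop i so.
exact: IH.
Qed.

Lemma nonvanishing_drop s w : s.1 o = 1 -> good (restr s) -> nonvanishing s (map phi w).
Proof.
elim: w s => //= i w IH s so gs; have [e so'] := smut_drop i so.
by rewrite (good_neq0 i gs) IH // e; exact: good_smut.
Qed.
End Drop.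

Section LauMut.
Variables (F : fieldType) (I : finType).
Implicit Types (x : I -> F).

Lemma lau_mut x (b : I -> int) i f : b i = 0 -> expoly x b != 0 ->
  lau (vmut x b i) predT predT f -> exists N, lau x predT predT (f * expoly x b ^+ N).
Proof.
move=> bi P0 h; set P := expoly x b in P0 *.
have HL := lau_ring x predT predT.
have h' : gen (fun a => lau x predT predT a \/ a = P \/ a = P^-1) f.
  apply: gen_mono h => a; have HA : isring (gen (fun a => lau x predT predT a \/ a = P \/ a = P^-1)) by exact: gen_ring.
  case=> -[l _ ->]; have [->|li] := eqVneq l i.
  - rewrite vmut_id; apply: (ringM HA); first by apply: gen_in; right; left.
    by apply: gen_in; left; exact: lau_inV.
  - by rewrite vmutE //; apply: gen_in; left; exact: lau_in.
  - rewrite vmut_id invf_div; apply: (ringM HA); last by apply: gen_in; right; right.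
    by apply: gen_in; left; exact: lau_in.
  - by rewrite vmutE //; apply: gen_in; left; exact: lau_inV.
have [N [p [pR pE]]] := adj_horner HL P0 h'.
exists N; rewrite pE; apply: (polyr_horner HL) => //.
exact: lau_expoly.
Qed.

Lemma lau_horner x t p n f : x t != 0 -> polyr (lau x (off t) (off t)) p -> f * x t ^+ n = p.[x t] ->
  lau x predT predT f.
Proof.
move=> t0 pR pE; have HL := lau_ring x predT predT.
have -> : f = p.[x t] * (x t)^-1 ^+ n by rewrite -pE exprVn mulfK // expf_neq0.
apply: (ringM HL); last by apply: (ringX HL); exact: lau_inV.
apply: (polyr_horner HL); last exact: lau_in.
by move=> k; apply: lau_mono (pR k).
Qed.
End LauMut.

Lemma transc_image (F G : fieldType) (h : {rmorphism F -> G}) (R : F -> Prop) t :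
  transc R t -> transc (fun b => exists2 a, R a & b = h a) (h t).
Proof.
move=> tr p pR p0.
have /choice[c cH] : forall k, exists a, R a /\ p`_k = h a by move=> k; case: (pR k) => a; exists a.
pose q := \poly_(k < size p) c k.
have E : p = map_poly h q.
  apply/polyP => k; rewrite coef_map coef_poly; case: ifP => kp; first by case: (cH k).
  by rewrite raddf0 nth_default // leqNgt kp.
rewrite E; suff -> : q = 0 by rewrite raddf0.
case: (pselect (R 0)) => R0; last first.
  have s0 k : (k < size p)%N -> R (c k) by case: (cH k).
  exfalso; have [r0 e] := cH (size p).
  move: e; rewrite nth_default // => /esym/eqP; rewrite fmorph_eq0 => /eqP e.
  by apply: R0; rewrite -e.
apply: tr => [k|]; first by rewrite coef_poly; case: ifP => // _; case: (cH k).
by apply/eqP; rewrite -(fmorph_eq0 h) -horner_map -E p0.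
Qed.

(** * An auxiliary frozen variable *)

Section Extend.
Variables (F : fieldType) (I : finType) (s : (I -> F) * (I -> I -> int)) (j : I).
Hypothesis gs : good s.
Let x := s.1.
Let G : fieldType := {fraction {poly F}}.
Let hm : {rmorphism F -> G} := @tofrac {poly F} \o polyC.
Let X : G := tofrac 'X.
(* One more frozen variable, which is attached to [j] and has the value 1 in [extz]. *)
Definition extx (o : option I) : G := if o is Some l then hm (x l) else X.
Definition extz (o : option I) : F := if o is Some l then x l else 1.
Definition extB (o o' : option I) : int :=
  match o, o' with
  | Some k, Some l => s.2 k l
  | Some k, None => (k == j)%:R
  | None, Some k => - (k == j)%:R
  | None, None => 0
  end.

Lemma transc_X : transc (fun b : G => exists2 a : F, True & b = hm a) X.
Proof.
move=> p pR p0.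
have /choice[c cH] : forall k, exists a, True /\ p`_k = hm a by move=> k; case: (pR k) => a; exists a.
pose q := \poly_(k < size p) c k.
have E : p = map_poly hm q.
  apply/polyP => k; rewrite coef_map coef_poly; case: ifP => kp; first by case: (cH k).
  by rewrite raddf0 nth_default // leqNgt kp.
have := p0; rewrite E map_poly_comp /X horner_map /=.
rewrite -/(q \Po 'X) comp_polyXr => /eqP; rewrite tofrac_eq0 => /eqP ->.
by rewrite !map_poly0 ?raddf0.
Qed.

Lemma good_ext : good (extx, extB).
Proof.
case: gs => c0 tr sk; split=> /=.
- move=> n; have := c0 n; rewrite -(fmorph_eq0 hm) rmorph_nat //.
- case=> [l|].
    pose R0 := lau x (off l) (off l).
    pose R (b : G) := exists2 a : F, R0 a & b = hm a.
    have HR : isring R.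
      split; first by exists 1; rewrite ?rmorph1 //; exact: (ring1 (lau_ring _ _ _)).
        by move=> _ _ [a aR ->] [b bR ->]; exists (a - b); rewrite ?rmorphB //; exact: (ringB (lau_ring _ _ _)).
      by move=> _ _ [a aR ->] [b bR ->]; exists (a * b); rewrite ?rmorphM //; exact: (ringM (lau_ring _ _ _)).
    apply: (@transc_mono _ _ (adj R X)); last first.
      apply: transc_swap => //; first by exact: (@transc_image _ _ hm R0 (x l) (tr l)).
      apply: transc_mono transc_X; apply: gen_sub => [|a].
        split; first by exists 1; rewrite ?rmorph1.
          by move=> _ _ [a _ ->] [b _ ->]; exists (a - b); rewrite ?rmorphB.
        by move=> _ _ [a _ ->] [b _ ->]; exists (a * b); rewrite ?rmorphM.
      case=> [[b _ ->]|[->|->]]; first by exists b.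
        by exists (x l).
      by exists (x l)^-1 => //; rewrite fmorphV.
    apply: gen_mono => a [] [[k|]] kl ->; apply: gen_in; auto; left.
      by exists (x k) => //; apply: lau_in.
    by exists (x k)^-1; [apply: lau_inV | rewrite fmorphV].
  apply: transc_mono transc_X; apply: gen_sub => [|a].
    split; first by exists 1; rewrite ?rmorph1.
      by move=> _ _ [a _ ->] [b _ ->]; exists (a - b); rewrite ?rmorphB.
    by move=> _ _ [a _ ->] [b _ ->]; exists (a * b); rewrite ?rmorphM.
  case=> [[[k|] // _ ->]|[[k|] // _ ->]]; first by exists (x k).
  by exists (x k)^-1 => //; rewrite fmorphV.
- move=> [k|] [l|] //=; rewrite ?opprK //; exact: sk.
Qed.

Definition placeX (p : (G * F)%type) := exists q : {poly F}, p = (tofrac q, q.[1]).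
Lemma placeX_ring : isring placeX.
Proof.
split; first by exists 1; rewrite rmorph1 hornerC.
  by move=> _ _ [p ->] [q ->]; exists (p - q); rewrite rmorphB !hornerE.
by move=> _ _ [p ->] [q ->]; exists (p * q); rewrite rmorphM !hornerE.
Qed.
Lemma placeX_functional : functional placeX.
Proof. by move=> _ [p ->] /= /eqP; rewrite tofrac_eq0 => /eqP ->; rewrite horner0. Qed.

Lemma spec_ext o : spec placeX (extx o) (extz o).
Proof.
apply: spec_in; first exact: placeX_ring.
by case: o => [l|]; [exists (x l)%:P | exists 'X]; rewrite ?hornerE.
Qed.

(** The place X = 1 turns the extended seed into s with one more variable equal to 1, which has no
    effect on exchange relations. *)
Lemma ext_smuts w k : spec placeX ((smuts (extx, extB) (map Some w)).1 (Some k)) ((smuts s w).1 k).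
Proof.
have e : restr Some (extz, extB) = s by rewrite [RHS]surjective_pairing.
have inj : injective (@Some I) by move=> ? ? [].
have neq (l : I) : Some l != None by [].
have cov (l : option I) : l != None -> exists l0, l = Some l0 by case: l => // l _; exists l.
have [] := @spec_smuts _ _ _ _ placeX_ring placeX_functional (extx, extB) (extz, extB) (map Some w).
- by [].
- exact: spec_ext.
- by apply: (nonvanishing_drop inj neq cov); rewrite ?e.
move=> _ /(_ (Some k)).
have [] := smuts_drop inj neq cov w (erefl : (extz, extB).1 None = 1).
by rewrite e => <-.
Qed.

Lemma lau_ext f c : lau extx predT predT f -> spec placeX f c -> lau x predT predT c.
Proof.
move=> h sp; suff [d [dL dS]] : exists d, lau x predT predT d /\ spec placeX f d.
  by rewrite (spec_uniq placeX_ring placeX_functional sp dS).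
have HP := placeX_ring; have HL := lau_ring x predT predT.
elim: h => {f c sp} [f [[o _ ->]|[o _ ->]]||a b _ [c [cL cS]] _ [d [dL dS]]|a b _ [c [cL cS]] _ [d [dL dS]]].
- exists (extz o); split; last exact: spec_ext.
  by case: o => [l|]; [exact: lau_in | exact: (ring1 HL)].
- exists (extz o)^-1; split; last first.
    apply: (specV placeX_functional); last exact: spec_ext.
    by case: o => [l|] /=; [exact: (good_neq0 l gs) | exact: oner_neq0].
  by case: o => [l|] /=; [exact: lau_inV | rewrite invr1; exact: (ring1 HL)].
- by exists 1; split; [exact: (ring1 HL) | exact: spec1].
- by exists (c - d); split; [exact: (ringB HL) | exact: specB].
- by exists (c * d); split; [exact: (ringM HL) | exact: specM].
Qed.
End Extend.

(** * The Laurent phenomenon *)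

Lemma regular_lead (F : fieldType) (R : F -> Prop) t f P N m g q h m' :
  isring R -> transc R t -> R P -> P != 0 ->
  polyr R g -> f * P ^+ N * t ^+ m = g.[t] ->
  polyr R q -> q != 0 -> R (lead_coef q)^-1 -> polyr R h -> f * q.[t] * t ^+ m' = h.[t] ->
  exists n k, polyr R k /\ f * t ^+ n = k.[t].
Proof.
move=> HR tr RP P0 gR gE qR q0 ql hR hE.
apply: (regular (d := (size q).-1) HR tr RP P0 gR gE qR _ ql hR hE).
by rewrite prednK // lt0n size_poly_eq0.
Qed.

Lemma lau_mon_off (F : fieldType) (I : finType) (x : I -> F) i (a : I -> int) :
  a i = 0 -> lau x (off i) (off i) (mon x a).
Proof. by move=> ai; apply: lau_mon => l al; rewrite /off /=; apply: contraTneq al => ->; rewrite ai. Qed.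

Lemma lau_expoly_off (F : fieldType) (I : finType) (x : I -> F) i (b : I -> int) :
  b i = 0 -> lau x (off i) (off i) (expoly x b).
Proof. by move=> bi; apply: lau_expoly => l; rewrite /off /=; apply: contraNneq => ->; rewrite bi. Qed.

Lemma mon_delta (F : fieldType) (I : finType) (x : I -> F) i : mon x (fun l => (l == i)%:Z) = x i.
Proof.
rewrite /mon (bigD1 i) //= eqxx expr1z big1 ?mulr1 // => l /negPf ->; exact: expr0z.
Qed.

Lemma matmut_row (I : eqType) (B : I -> I -> int) k l : matmut B k k l = - B k l.
Proof. by rewrite /matmut eqxx. Qed.
Lemma matmut_col (I : eqType) (B : I -> I -> int) k l : matmut B k l k = - B l k.
Proof. by rewrite /matmut eqxx orbT. Qed.
Lemma matmutE (I : eqType) (B : I -> I -> int) k i j : i != k -> j != k ->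
  matmut B k i j = B i j + pospart (B i k) * pospart (B k j) - pospart (- B i k) * pospart (- B k j).
Proof. by move=> /negPf ik /negPf jk; rewrite /matmut !(eq_sym k) ik jk. Qed.

(** The field and the index type are quantified, because the induction hypothesis is applied to the
    seed with an additional frozen variable. *)
Definition laurent_upto n := forall (F : fieldType) (I : finType)
  (s : (I -> F) * (I -> I -> int)) w k, good s -> (size w <= n)%N ->
  lau s.1 predT predT ((smuts s w).1 k).

Section Step.
Variables (n : nat) (F : fieldType) (I : finType).
Hypothesis IH : laurent_upto n.
Implicit Types (s : (I -> F) * (I -> I -> int)).
Add Ring F_ring : (comring_theory F).

Lemma lau_neighbour s i w k : good s -> (size w <= n)%N ->
  exists N, lau s.1 predT predT ((smuts s (i :: w)).1 k * expoly s.1 (s.2 i) ^+ N).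
Proof.
move=> gs wn; case: (gs) => c0 tr sk; apply: (@lau_mut _ _ _ _ i).
- exact: skew_diag.
- exact: expoly_neq0.
exact: (IH k (good_smut i gs) wn).
Qed.
End Step.

(* In [x y], the exchange polynomial of [j] has degree one and a unit as leading coefficient, so
   that it is prime to the one of [i]; both [i] and [j] can be mutated first. *)
Lemma laurent_coprime n (F : fieldType) (I : finType) (s : (I -> F) * (I -> I -> int)) i j y w k :
  laurent_upto n -> good s -> s.2 i j = 0 -> s.2 i y = 0 -> s.2 j y = 1 -> (size w < n)%N ->
  lau s.1 predT predT ((smuts s (i :: j :: w)).1 k).
Proof.
move=> IH gs sij iy jy wn.
have [N hN] := lau_neighbour (w := j :: w) IH i k gs wn.
have [M hM] := lau_neighbour (w := i :: w) IH j k gs wn.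
set f := (smuts s (i :: j :: w)).1 k in hN *.
have Ef : (smuts s (j :: i :: w)).1 k = f by rewrite /f /= (smutC gs sij).
rewrite Ef in hM; clearbody f; clear Ef.
set P := expoly _ _ in hN; set Q := expoly _ _ in hM.
have [c0 tr sk] := gs; have t0 : s.1 y != 0 by exact: tr_neq0.
have HR := lau_ring s.1 (off y) (off y).
have [m [g [gR gE]]] := lau_lift t0 hN.
have [m' [h [hR hE]]] := lau_lift t0 hM.
pose a l := if l == y then 0 else pospart (s.2 j l).
pose b l := pospart (- s.2 j l).
pose q := (mon s.1 a)%:P * 'X + (mon s.1 b)%:P.
have a0 : mon s.1 a != 0 by apply: mon_neq0 => l; exact: tr_neq0.
have QE : Q = q.[s.1 y].
  by rewrite hornerD hornerM !hornerC hornerX /Q /expoly (mon_pull _ _ y) jy expr1z mulrC.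
have bR : lau s.1 (off y) (off y) (mon s.1 b) by apply: lau_mon_off; rewrite /b jy.
have lq : lead_coef q = mon s.1 a.
  by rewrite /q lead_coefDl ?lead_coefMX ?lead_coefC // size_Cmul // size_polyX size_polyC; case: eqP.
have qR : polyr (lau s.1 (off y) (off y)) q.
  apply: (polyrD HR); last exact: polyrC.
  apply: (polyrM HR); last exact: polyrX.
  by apply: (polyrC HR); apply: lau_mon_off; rewrite /a eqxx.
have q0 : q != 0 by rewrite -lead_coef_eq0 lq.
have PR : lau s.1 (off y) (off y) P.
  exact: lau_expoly_off.
have P0 : P != 0 by exact: expoly_neq0.
rewrite QE -horner_exp in hE.
have qR' : polyr (lau s.1 (off y) (off y)) (q ^+ M) by exact: polyrE.
have qn0 : q ^+ M != 0 by rewrite expf_neq0.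
have ql : lau s.1 (off y) (off y) (lead_coef (q ^+ M))^-1.
  rewrite lead_coef_exp lq -exprVn; apply: (ringX HR); rewrite -monN.
  by apply: lau_mon_off; rewrite /a eqxx oppr0.
have [d [r [rR rE]]] := regular_lead HR (tr y) PR P0 gR gE qR' qn0 ql hR hE.
exact: (lau_horner t0 rR rE).
Qed.

(** The exchange polynomials of i and j may have a common factor; a frozen variable attached to j
    alone removes it and is set to 1 at the end. *)
Lemma laurent_step0 n (F : fieldType) (I : finType) (s : (I -> F) * (I -> I -> int)) i j w k :
  laurent_upto n -> good s -> i != j -> s.2 i j = 0 -> (size w < n)%N ->
  lau s.1 predT predT ((smuts s (i :: j :: w)).1 k).
Proof.
move=> IH gs nij sij wn; have ge := good_ext j gs.
apply: (lau_ext gs (f := (smuts (extx s, extB s j) (map Some (i :: j :: w))).1 (Some k))); last exact: ext_smuts.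
apply: (@laurent_coprime n _ _ (extx s, extB s j) (Some i) (Some j) None (map Some w) (Some k) IH ge).
- exact: sij.
- by rewrite /= (negPf nij).
- by rewrite /= eqxx.
- by rewrite size_map.
Qed.

(** * Mutations at two linked vertices *)

Section Adjacent.
Variables (F : fieldType) (I : finType) (x : I -> F) (B : I -> I -> int) (i j : I) (c : nat).
Add Ring F_ring2 : (comring_theory F).
Hypothesis gs : good (x, B).
Hypothesis ij : B i j = c%:Z.
Hypothesis c0 : (0 < c)%N.

Let t := x i.
Let R := lau x (off i) (off i).
Let P := expoly x (B i).
Let S1 := smut (x, B) i.
Let S2 := smut S1 j.
Let S3 := smut S2 i.
Let v := S3.1 j.
Let w := S3.1 i.

Let HR : isring R. Proof. exact: lau_ring. Qed.
Let sk : skew B. Proof. by case: gs. Qed.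
Let nz l : x l != 0. Proof. exact: (good_neq0 l gs). Qed.
Let nij : i != j.
Proof. by apply/eqP => e; have := skew_diag i sk; rewrite {2}e ij => -[e0]; move: c0; rewrite e0. Qed.
Let ji : B j i = - c%:Z. Proof. by rewrite sk ij. Qed.
Let pp := pospartP.

(** [e1], [e2] are the exponents of the exchange monomials of j in [S1], and [e3], [e4] those of i
    in [S2], without the variables that have changed. [b] is the leading coefficient of v t^c in t,
    and [u] the exponent of the unit in [adj_unit]. *)
Let e1 l := if l == i then 0 else pospart (S1.2 j l).
Let e2 l := pospart (- S1.2 j l).
Let e3 l := if l == j then 0 else pospart (S2.2 i l).
Let e4 l := pospart (- S2.2 i l).
Let u l := if (l == i) || (l == j) then - (l == j)%:Z * c%:Z
           else pospart (B i l + c%:Z * e2 l) - pospart (B i l).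
Let b := mon x (fun l => e2 l - (l == j)%:Z).

Let S1ji : S1.2 j i = c%:Z. Proof. by rewrite [LHS]matmut_col /= ji opprK. Qed.
Let S1ij l : S1.2 i l = - B i l. Proof. exact: matmut_row. Qed.
Let S1jj : S1.2 j j = 0. Proof. by apply: skew_diag; exact: skew_matmut. Qed.
Let S2ij : S2.2 i j = c%:Z.
Proof. by rewrite [LHS]matmut_col S1ij ij opprK. Qed.
Let S2ii : S2.2 i i = 0. Proof. by apply: skew_diag; do 2 apply: skew_matmut. Qed.
Let S2i l : l != i -> l != j -> S2.2 i l = - B i l - c%:Z * e2 l.
Proof.
move=> li lj; rewrite [LHS]matmutE // !S1ij ij opprK pospart_nat -/(e2 l).
have -> : pospart (- c%:Z) = 0 by have := pp (- c%:Z); lia.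
by rewrite mul0r addr0.
Qed.

Let smut_id (s : (I -> F) * (I -> I -> int)) k : (smut s k).1 k = expoly s.1 (s.2 k) / s.1 k :> F. Proof. exact: vmut_id. Qed.
Let smut_ne (s : (I -> F) * (I -> I -> int)) k l : l != k -> (smut s k).1 l = s.1 l.
Proof. exact: vmutE. Qed.
Let S1i : S1.1 i = P / t. Proof. exact: smut_id. Qed.
Let S1l l : l != i -> S1.1 l = x l. Proof. exact: smut_ne. Qed.

Lemma adj_vE : v = ((P / t) ^+ c * mon x e1 + mon x e2) / x j.
Proof.
have ji' : j != i by rewrite eq_sym.
rewrite /v smut_ne // smut_id S1l //; congr (_ / _); rewrite /expoly; congr (_ + _).
  rewrite (mon_pull _ _ i) S1ji pospart_nat S1i -exprnP; congr (_ * _).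
  apply: eq_mon_in => l; have [_|li _] := eqVneq l i; last exact: S1l.
  by rewrite eqxx.
apply: eq_mon_in => l h; rewrite S1l //.
apply: contraNneq h => ->; by rewrite S1ji; apply/eqP; have := pp (- c%:Z); lia.
Qed.

Lemma adj_wE : w = (v ^+ c * mon x e3 + mon x e4) / (P / t).
Proof.
have ji' : j != i by rewrite eq_sym.
have S2i' : S2.1 i = P / t by rewrite smut_ne.
have S2j : S2.1 j = v by rewrite /v [RHS]smut_ne.
have S2l l : l != i -> l != j -> S2.1 l = x l by move=> li lj; rewrite !smut_ne.
rewrite /w smut_id S2i'; congr (_ / _); rewrite /expoly; congr (_ + _).
  rewrite (mon_pull _ _ j) S2ij pospart_nat S2j -exprnP; congr (_ * _).
  apply: eq_mon_in => l; have [_|lj h] := eqVneq l j; first by rewrite eqxx.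
  apply: S2l => //.
  by apply: contraNneq h => ->; rewrite S2ii.
apply: eq_mon_in => l h; apply: S2l; apply: contraNneq h => ->; first by rewrite S2ii.
by rewrite S2ij; apply/eqP; have := pp (- c%:Z); lia.
Qed.

Let e2i : e2 i = 0. Proof. by rewrite /e2 S1ji; have := pp (- c%:Z); lia. Qed.
Let e2j : e2 j = 0. Proof. by rewrite /e2 S1jj. Qed.

(* So the leading coefficient, in [t], of the polynomial attached to the second mutation at [i]
   becomes a unit once divided by [P]. *)
Lemma adj_unit : mon x e3 * b ^+ c + mon x e4 = P * mon x u.
Proof.
rewrite /b -monX -monD // /P /expoly mulrDl -!monD // addrC; congr (_ + _); apply: eq_mon => l; rewrite /e3 /e4 /u.
  have [->|li] := eqVneq l i.
    by rewrite S2ii (skew_diag i sk) (negPf nij) mul0r.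
  have [->|lj] := eqVneq l j; first by rewrite S2ij ij /= pospart_nat; have := pp (- c%:Z); lia.
  rewrite S2i //=; have := pp (- (- B i l - c%:Z * e2 l)).
  have := pp (B i l + c%:Z * e2 l); have := pp (B i l); move: (c%:Z * e2 l); lia.
have [->|li] := eqVneq l i.
  by rewrite S2ii (skew_diag i sk) (negPf nij) e2i oppr0 [pospart 0](_ : _ = 0) //=; lia.
have [->|lj] := eqVneq l j; first by rewrite ij e2j /=; have := pp (- c%:Z); lia.
rewrite S2i //= subr0; have := pp (- B i l - c%:Z * e2 l).
have := pp (B i l + c%:Z * e2 l); have := pp (B i l); have := pp (- B i l).
rewrite mulrC; move: (c%:Z * e2 l); lia.
Qed.

Let e1i : e1 i = 0. Proof. by rewrite /e1 eqxx. Qed.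
Let e3i : e3 i = 0. Proof. by rewrite /e3 (negPf nij) S2ii. Qed.
Let ui : u i = 0. Proof. by rewrite /u eqxx (negPf nij) oppr0 mul0r. Qed.
Let bi0 : e2 i - (i == j)%:Z = 0. Proof. by rewrite e2i (negPf nij). Qed.
Let PR : R P. Proof. by apply: lau_expoly_off; exact: skew_diag. Qed.
Let P0 : P != 0. Proof. by case: gs => ? ? _; exact: expoly_neq0. Qed.
Let xjV : R (x j)^-1. Proof. by apply: lau_inV; rewrite /off /= eq_sym. Qed.
Let bE : b = mon x e2 / x j.
Proof. by rewrite /b monD // monN mon_delta. Qed.

(** [qv] and [Q] represent v t^c and w t^(c c) as polynomials in t. The division by P in w is exact:
    P divides [a], so that qv^c - (b t^c)^c = P G, and [adj_unit] supplies the factor P in the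
    remaining term. *)
Let a := P ^+ c * mon x e1 / x j.
Let qv := a%:P + b%:P * 'X^c.
Let G := (P ^+ c.-1 * mon x e1 / x j)%:P *
  (\sum_(k < c) qv ^+ (c.-1 - k) * (b%:P * 'X^c) ^+ k).
Let Q := 'X * ((mon x e3)%:P * G + (mon x u)%:P * 'X^(c * c)).

Let aR : R a.
Proof.
apply: (ringM HR) => //; apply: (ringM HR); first exact: (ringX HR).
exact: lau_mon_off.
Qed.
Let bR : R b. Proof. exact: lau_mon_off. Qed.
Let b0 : b != 0. Proof. exact: mon_neq0. Qed.

Let qvR : polyr R qv.
Proof.
apply: (polyrD HR); first exact: polyrC.
by apply: (polyrM HR); [exact: polyrC | exact: polyrXn].
Qed.

Let QR : polyr R Q.
Proof.
apply: (polyrM HR); first exact: polyrX.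
apply: (polyrD HR); apply: (polyrM HR); try exact: polyrXn.
- by apply: (polyrC HR); exact: lau_mon_off.
- apply: (polyrM HR).
    apply: (polyrC HR); apply: (ringM HR) => //; apply: (ringM HR); first exact: (ringX HR).
    exact: lau_mon_off.
  move=> k; rewrite coef_sum; apply: (ring_sum HR) => l _.
  apply: (polyrM HR); apply: (polyrE HR) => //.
  by apply: (polyrM HR); [exact: polyrC | exact: polyrXn].
- by apply: (polyrC HR); exact: lau_mon_off.
Qed.

Let vt : v * t ^+ c = qv.[t].
Proof.
rewrite adj_vE hornerD hornerM !hornerC hornerXn bE /a expr_div_n.
have tc : t ^+ c != 0 by rewrite expf_neq0 // nz.
by rewrite -[P ^+ c in RHS](mulfVK tc); cring F.
Qed.

Let PG : P%:P * G = qv ^+ c - (b%:P * 'X^c) ^+ c.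
Proof.
rewrite subrXX mulrA -polyCM /qv addrK /a; congr (_%:P * _).
by rewrite !mulrA -exprS prednK.
Qed.

Let wt : w * t ^+ (c * c) = Q.[t].
Proof.
have h : P * (mon x e3 * G.[t] + mon x u * t ^+ (c * c)) = (v ^+ c * mon x e3 + mon x e4) * t ^+ (c * c).
  have bt : (b%:P * 'X^c).[t] = b * t ^+ c by rewrite hornerM hornerC hornerXn.
  have := congr1 (horner^~ t) PG.
  rewrite hornerM hornerC hornerD hornerN !horner_exp -vt bt => e.
  rewrite mulrDr mulrCA e [P * (mon x u * _)]mulrA -adj_unit !exprMn -!exprM; cring F.
rewrite hornerM hornerX hornerD (hornerM _ G) hornerC (hornerM _ 'X^(c * c)) hornerC hornerXn adj_wE invf_div.
apply: (mulfI P0); rewrite [RHS]mulrCA h.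
set Y := v ^+ c * mon x e3 + mon x e4; set T := t ^+ (c * c).
have -> : P * (Y * (t / P) * T) = P / P * (t * (Y * T)) by cring F.
by rewrite divff // mul1r.
Qed.

Let sb : size (b%:P * 'X^c) = c.+1.
Proof. by rewrite mul_polyC size_scale // size_polyXn. Qed.
Let sqv : size qv = c.+1.
Proof. by rewrite /qv addrC size_polyDl ?sb // ltnS (leq_trans (size_polyC_leq1 _)). Qed.
Let lqv : lead_coef qv = b.
Proof.
rewrite /qv lead_coefDr; first by rewrite lead_coefM lead_coefC lead_coefXn mulr1.
by rewrite sb ltnS (leq_trans (size_polyC_leq1 _)).
Qed.

Let sG : (size G <= c * c)%N.
Proof.
rewrite (leq_trans (size_polyMleq _ _)) //.
rewrite -ltnS; apply: (@leq_trans (size (\sum_(k < c) qv ^+ (c.-1 - k) * (b%:P * 'X^c) ^+ k)).+1).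
  have := size_polyC_leq1 (P ^+ c.-1 * mon x e1 / x j); lia.
rewrite ltnS; apply: (leq_trans (size_sum _ _ _)); apply/bigmax_leqP => k _.
rewrite (leq_trans (size_polyMleq _ _)) //.
have := size_poly_exp_leq qv (c.-1 - k); have := size_poly_exp_leq (b%:P * 'X^c) k.
by rewrite sqv sb /= => h1 h2; have := ltn_ord k; nia.
Qed.

Let lQ : lead_coef Q = mon x u.
Proof.
rewrite lead_coefM lead_coefX mul1r lead_coefDr.
  by rewrite lead_coefM lead_coefC lead_coefXn mulr1.
rewrite (mul_polyC (mon x u)) size_scale ?mon_neq0 // size_polyXn ltnS.
rewrite (leq_trans (size_polyMleq _ _)) //.
by rewrite -subn1 leq_subLR leq_add ?size_polyC_leq1.
Qed.

(** As v and w are Laurent in x, multiplying f by powers of them makes it Laurent in x, and so does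
    a power of P. The polynomials of v and w have units as leading coefficients in t and P does not
    involve t, so [regular_lead] removes the denominators. *)
Lemma adj_laurent f N : lau x predT predT (f * P ^+ N) -> lau S3.1 predT predT f -> lau x predT predT f.
Proof.
move=> hP h3; have HL := lau_ring x predT predT.
have vL : lau x predT predT v by apply: (lau_horner (nz i) qvR vt).
have wL : lau x predT predT w by apply: (lau_horner (nz i) QR wt).
have v0 : v != 0 by apply: (good_neq0 j (good_smut i (good_smut j (good_smut i gs)))).
have w0 : w != 0 by apply: (good_neq0 i (good_smut i (good_smut j (good_smut i gs)))).
have ji' : j != i by rewrite eq_sym.
have h : adj (adj (lau x predT predT) w) v f.
  apply: gen_mono h3 => y; case=> -[l _ ->]; have [->|lj] := eqVneq l j;
    try (by apply: gen_in; right; auto); have [->|li] := eqVneq l i;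
    try (by apply: gen_in; left; apply: gen_in; right; auto);
    rewrite !smut_ne //; apply: gen_in; left; apply: gen_in; left; [exact: lau_in | exact: lau_inV].
have HA : isring (adj (lau x predT predT) w) by exact: gen_ring.
have [k1 [p1 [p1R p1E]]] := adj_horner HA v0 h.
have h1 : adj (lau x predT predT) w (f * v ^+ k1).
  by rewrite p1E; apply: (polyr_horner HA) => //; apply: gen_in; left.
have [k2 [p2 [p2R p2E]]] := adj_horner HL w0 h1.
have h2 : lau x predT predT (f * v ^+ k1 * w ^+ k2).
  by rewrite p2E; exact: (polyr_horner HL).
have [m [g [gR gE]]] := lau_lift (nz i) hP.
have h3' : lau x predT predT (f * (qv ^+ k1 * Q ^+ k2).[t]).
  rewrite hornerM !horner_exp -vt -wt.
  have -> : f * ((v * t ^+ c) ^+ k1 * (w * t ^+ (c * c)) ^+ k2) =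
    f * v ^+ k1 * w ^+ k2 * ((t ^+ c) ^+ k1 * (t ^+ (c * c)) ^+ k2) by rewrite !exprMn; cring F.
  apply: (ringM HL) => //; apply: (ringM HL); do 2 apply: (ringX HL); exact: lau_in.
have [m' [r [rR rE]]] := lau_lift (nz i) h3'.
have qR : polyr R (qv ^+ k1 * Q ^+ k2) by apply: (polyrM HR); exact: polyrE.
have qv0 : qv != 0 by rewrite -lead_coef_eq0 lqv.
have Q0 : Q != 0 by rewrite -lead_coef_eq0 lQ mon_neq0.
have q0 : qv ^+ k1 * Q ^+ k2 != 0 by rewrite mulf_neq0 ?expf_neq0.
have ql : R (lead_coef (qv ^+ k1 * Q ^+ k2))^-1.
  rewrite lead_coefM !lead_coef_exp lqv lQ invfM -!exprVn; apply: (ringM HR); apply: (ringX HR).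
    by rewrite -monN; apply: lau_mon_off; rewrite bi0 oppr0.
  by rewrite -monN; apply: lau_mon_off; rewrite ui oppr0.
have tr : transc R t by case: gs => _ tr _; exact: tr.
have [d [z [zR zE]]] := regular_lead HR tr PR P0 gR gE qR q0 ql rR rE.
exact: (lau_horner (nz i) zR zE).
Qed.
End Adjacent.

(** Two mutations at i cancel, so the variable is reached from [S3] by the word [i :: w], which is
    short enough for the induction hypothesis; it is also reached by [j :: w] after one mutation at
    i. *)
Lemma laurent_step1 n (F : fieldType) (I : finType) (s : (I -> F) * (I -> I -> int)) i j w k :
  laurent_upto n -> good s -> s.2 i j != 0 -> (size w < n)%N ->
  lau s.1 predT predT ((smuts s (i :: j :: w)).1 k).
Proof.
move=> IH; case: s => x B; wlog pos : B / 0 < B i j.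
  move=> H gs nz wn; have [p|p] := ltrP 0 (B i j); first exact: H.
  have gs' : good (x, fun k l => - B k l).
    by case: gs => c0 tr /= sk; split=> // k' l'; rewrite /= sk.
  have pos' : 0 < - B i j by rewrite oppr_gt0 lt_neqAle nz.
  have nz' : - B i j != 0 by rewrite oppr_eq0.
  by have := H (fun k l => - B k l) pos' gs' nz' wn; rewrite smutsN.
move=> gs _ wn; have ij : B i j = (absz (B i j))%:Z by lia.
have c0 : (0 < absz (B i j))%N by lia.
have [N hN] := lau_neighbour (w := j :: w) IH i k gs wn.
apply: (adj_laurent gs ij c0 hN).
have := IH F I (smut (smut (smut (x, B) i) j) i) (i :: w) k.
by rewrite /= smutK //; [apply => //; do 3 apply: good_smut | do 2 apply: good_smut].
Qed.

Theorem laurent_phenomenon (F : fieldType) (I : finType) (s : (I -> F) * (I -> I -> int)) w k :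
  good s -> lau s.1 predT predT ((smuts s w).1 k).
Proof.
move=> gs; suff H n : laurent_upto n by exact: (H (size w)).
elim: n {F I s w k gs} => [|n IH] F I s w k gs.
  by rewrite leqn0 size_eq0 => /eqP ->; exact: lau_in.
case: w => [|i [|j w]] wn; first exact: lau_in.
  rewrite /= /vmut; case: eqP => _; last exact: lau_in.
  apply: (ringM (lau_ring _ _ _)); last exact: lau_inV.
  exact: lau_expoly.
have [e|nij] := eqVneq i j.
  by rewrite e /= smutK //; apply: IH => //; move: wn => /=; lia.
have [e|ne] := eqVneq (s.2 i j) 0; first exact: (laurent_step0 _ IH).
exact: (laurent_step1 _ IH).
Qed.

(** * Frozen variables do not occur in denominators *)

Section Positive.
Variables (I : finType) (B0 : I -> I -> int) (y : I).
Implicit Types (t : (I -> rat) * (I -> I -> int)).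

Definition positive_off t := t.1 y = 0 /\ forall l, l != y -> 0 < t.1 l.

(** y divides at most one of the two exchange monomials, so the other one is positive. *)
Lemma positive_expoly t b : positive_off t -> 0 < expoly t.1 b.
Proof.
move=> [ty tl]; have t0 l : 0 <= t.1 l by have [->|/tl/ltW//] := eqVneq l y; rewrite ty.
have ge0 (a : I -> int) : (forall l, 0 <= a l) -> 0 <= mon t.1 a.
  by move=> a0; apply: prodr_ge0 => l _; apply: exprz_ge0.
have gt0 (a : I -> int) : a y = 0 -> 0 < mon t.1 a.
  move=> ay; apply: prodr_gt0 => l _; have [->|/tl] := eqVneq l y; first by rewrite ay expr0z.
  exact: exprz_gt0.
have p0 l : 0 <= pospart (b l) by exact: pospart_ge0.
have n0 l : 0 <= pospart (- b l) by exact: pospart_ge0.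
have [by0|by0] := lerP 0 (b y).
  by apply: ltr_wpDl; [exact: ge0 | apply: gt0; have := pospartP (- b y); lia].
by apply: ltr_pwDl; [apply: gt0; have := pospartP (b y); lia | exact: ge0].
Qed.

Lemma positive_smut t i : i != y -> positive_off t -> positive_off (smut t i).
Proof.
move=> iy pt; have [ty tl] := pt; split=> [|l ly]; rewrite /= /vmut.
  by rewrite eq_sym (negPf iy).
by case: eqP => _; [rewrite divr_gt0 ?tl //; exact: positive_expoly | exact: tl].
Qed.

Lemma positive_nonvanishing t w : y \notin w -> positive_off t -> nonvanishing t w.
Proof.
elim: w t => //= i w IH t; rewrite inE negb_or eq_sym => /andP[iy yw] pt.
by rewrite gt_eqF ?(proj2 pt) // IH //; exact: positive_smut.
Qed.
End Positive.

Section Frozen.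
Variables (F : fieldType) (I : finType).
Implicit Types (x : I -> F) (s : (I -> F) * (I -> I -> int)).

Lemma spec_nonvanishing (K : fieldType) (R : (F * K)%type -> Prop) s (t : (I -> K) * (I -> I -> int)) w :
  isring R -> functional R -> s.2 = t.2 -> (forall l, spec R (s.1 l) (t.1 l)) ->
  nonvanishing t w -> nonvanishing s w.
Proof.
move=> HR HF; elim: w s t => //= i w IH s t e h /andP[ti nv].
have [e' h'] := spec_smut HR HF e h ti.
by rewrite (spec_neq0 HR HF ti (h i)) (IH _ _ e' h' nv).
Qed.

(* The place [y = 0] is finite and nonzero on cluster variables, since all exchange polynomials
   are positive after sending the other variables to 1. *)
Lemma lau_frozen1 s w k y (E : pred I) : good s -> y \notin w -> E y ->
  lau s.1 predT E ((smuts s w).1 k) -> lau s.1 predT (offp E y) ((smuts s w).1 k).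
Proof.
move=> gs yw Ey fL; have [c0 tr sk] := gs; set f := (smuts s w).1 k in fL *.
have HR := lau_ring s.1 (off y) (offp E y); have HL := lau_ring s.1 predT (offp E y).
have y0 : s.1 y != 0 by exact: tr_neq0.
have [m [p [pR pE]]] := lau_lift y0 fL.
have f0 : f != 0 by apply: good_neq0; exact: good_smuts.
have exd : exists d, p`_d != 0.
  apply: contrapT => H; have p0 : p = 0.
    by apply/polyP => d; rewrite coef0; apply/eqP/negPn/negP => h; apply: H; exists d.
  by move: pE; rewrite p0 horner0 => /eqP; rewrite mulf_eq0 (negPf f0) expf_eq0 (negPf y0) andbF.
case: (ex_minnP exd) => d pd dmin.
pose g := drop_poly d p.
have pg : p = g * 'X^d.
  rewrite -[LHS](poly_take_drop d); apply/eqP; rewrite -subr_eq0 addrK; apply/eqP/polyP => e.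
  rewrite coef_take_poly coef0; case: ifP => // ed.
  by apply/eqP; apply: contraTT ed => /dmin; rewrite -leqNgt.
have gR : polyr (lau s.1 (off y) (offp E y)) g by move=> e; rewrite coef_drop_poly; exact: pR.
have g0 : g`_0 != 0 by rewrite coef_drop_poly.
have gL : lau s.1 predT (offp E y) g.[s.1 y].
  apply: (polyr_horner HL); last exact: lau_in.
  by move=> e; apply: lau_mono (gR e).
rewrite pg hornerM hornerXn in pE.
have [md|dm] := leqP m d.
  have -> : f = g.[s.1 y] * s.1 y ^+ (d - m).
    apply: (mulIf (expf_neq0 m y0)); rewrite pE -mulrA -exprD subnK //.
  by apply: (ringM HL) => //; apply: (ringX HL); exact: lau_in.
(* If f had a pole of order m - d > 0 along y, the left side would vanish at y = 0, but the right
   side does not. *)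
exfalso; have fE : f * s.1 y ^+ (m - d) = g.[s.1 y].
  apply: (mulIf (expf_neq0 d y0)); rewrite -pE -mulrA -exprD subnK //; exact: ltnW.
pose z l : F := if l == y then 0 else s.1 l.
(* At y = 0 the denominators met along w are nonzero because they remain so after the other
   variables are sent to 1. *)
pose r l : rat := (l != y)%:R.
have HZ := pairs_ring s.1 z; have FZ : functional (pairs s.1 z) by exact: functional_pairs.
have HQ := pairs_ring s.1 r; have FQ : functional (pairs s.1 r) by exact: functional_pairs.
have zr l : spec (pairs s.1 r) (z l) (r l).
  rewrite /z; have [ly|ly] := eqVneq l y; last exact: spec_pairs.
  by rewrite /r ly eqxx; exact: spec0.
have nv : nonvanishing (z, s.2) w.
  apply: (@spec_nonvanishing _ _ (z, s.2) (r, s.2) _ HQ FQ) => //.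
  by apply: (@positive_nonvanishing _ y) => //; split=> [|l ly] /=; rewrite /r ?eqxx // ly.
have [_ /(_ k)] := spec_smuts HZ FZ (s := s) (t := (z, s.2)) (erefl _) (spec_pairs s.1 z) nv.
rewrite -/f; set c := (smuts _ _).1 k => fc.
have e1 : spec (pairs s.1 z) (f * s.1 y ^+ (m - d)) (c * z y ^+ (m - d)).
  by apply: specM => //; apply: specX => //; exact: spec_pairs.
have own a : lau s.1 (off y) (off y) a -> spec (pairs s.1 z) a a.
  elim=> {a} [a [[l ly ->]|[l ly ->]]||a b _ ? _ ?|a b _ ? _ ?].
  - by have := spec_pairs s.1 z l; rewrite /z (negPf ly).
  - by apply: specV => //; [exact: tr_neq0 | have := spec_pairs s.1 z l; rewrite /z (negPf ly)].
  - exact: spec1.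
  - exact: specB.
  - exact: specM.
have e2 : spec (pairs s.1 z) g.[s.1 y] g.[z y].
  rewrite !horner_coef; apply: spec_sum => // l; apply: specM => //.
    by apply: own; apply: lau_mono (gR l) => l' // /andP[].
  by apply: specX => //; exact: spec_pairs.
rewrite fE in e1; have := spec_uniq HZ FZ e1 e2.
rewrite /z eqxx horner_coef0 expr0n subn_eq0 leqNgt dm mulr0 => /esym/eqP.
by rewrite (negPf g0).
Qed.

Theorem laurent_frozen s w k (Y : pred I) : good s -> all (predC Y) w ->
  lau s.1 predT (predC Y) ((smuts s w).1 k).
Proof.
move=> gs Yw.
suff H (r : seq I) : all Y r -> lau s.1 predT (fun l => l \notin r) ((smuts s w).1 k).
  have := H (filter Y (enum I)); rewrite filter_all => /(_ isT).
  by apply: lau_mono => // l; rewrite mem_filter mem_enum andbT.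
elim: r => [_|y r IH /= /andP[Yy Yr]].
  by apply: lau_mono (laurent_phenomenon w k gs).
have [yr|yr] := boolP (y \in r).
  apply: lau_mono (IH Yr) => // l lr; rewrite inE negb_or lr andbT.
  by apply: contraNneq lr => ->.
have yw : y \notin w by apply: contraL Yy; exact: (allP Yw).
apply: lau_mono (lau_frozen1 gs yw _ (IH Yr)) => // l.
by rewrite /offp inE negb_or andbC.
Qed.
End Frozen.

(** * Standard monomials *)

Section Standard.
Variables (F : fieldType) (I : finType) (x : I -> F) (B : I -> I -> int) (rk : I -> nat).
Hypothesis gs : good (x, B).
Implicit Types (Y eps : pred I) (m : seq I).

Let c0 : char0 F. Proof. by case: gs. Qed.
Let tr : tr_indep x. Proof. by case: gs. Qed.
Let sk : skew B. Proof. by case: gs. Qed.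
Let nz l : x l != 0. Proof. exact: tr_neq0. Qed.

Definition inm l := mon x (fun j => pospart (- B l j)).
Definition outm l := mon x (fun j => pospart (B l j)).
(* [eps l = false] drops the outgoing monomial, which vanishes as soon as one of its
   variables does. *)
Definition exvar eps l := (inm l + if eps l then outm l else 0) / x l.
(* A negative exponent stands for a power of the neighbour of the variable. *)
Definition stdmon eps m (a : I -> int) := \prod_(l <- m) (if 0 <= a l then x l else exvar eps l) ^+ `|a l|%N.

(** Largest ranks come first: under [compat], the head occurs in no incoming monomial of the later
    variables. *)
Fixpoint desc m :=
  if m is n :: m' then [&& all (fun l => (rk l <= rk n)%N) m', n \notin m' & desc m'] else true.

Definition compat m Y eps := forall l, l \in m ->
  (forall j, B l j < 0 -> Y j \/ (j \in m /\ (rk j < rk l)%N)) /\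
  (eps l -> forall j, 0 < B l j -> Y j \/ j \in m).

Lemma inm_neq0 l : inm l != 0. Proof. exact: mon_neq0. Qed.
Lemma in_out_neq0 eps l : inm l + (if eps l then outm l else 0) != 0.
Proof.
case: (eps l); last by rewrite addr0 inm_neq0.
by rewrite addrC; exact: expoly_neq0.
Qed.

(** Induction on m through the lowest power of its head x_n. At x_n = 0, incoming monomials of the
    other variables are untouched and the outgoing ones that contain x_n disappear (hence [eps']);
    the terms of lowest degree form a relation between standard monomials in the remaining
    variables. *)
Lemma indep m eps Y (T : eqType) (s : seq T) (a : T -> I -> int) (c : T -> F) :
  desc m -> (forall l, l \in m -> ~~ Y l) -> compat m Y eps -> uniq s ->
  (forall t t', t \in s -> t' \in s -> t != t' -> exists2 l, l \in m & a t l != a t' l) ->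
  (forall t, t \in s -> lau x Y pred0 (c t)) ->
  \sum_(t <- s) c t * stdmon eps m (a t) = 0 -> forall t, t \in s -> c t = 0.
Proof.
elim: m eps s => [|n m IHm] eps s.
  move=> _ _ _; case: s => [|t [|t' s]] //.
    by move=> _ _ _; rewrite big_seq1 /stdmon big_nil mulr1 => h t'; rewrite inE => /eqP ->.
  rewrite [uniq _]/= inE negb_or -andbA => /andP[tt' _] /(_ t t').
  by rewrite !inE !eqxx orbT => /(_ isT isT tt')[].
move=> dm Ym cm; have [k] := ubnP (size s); elim: k s => // k IHk s sk' us ds cs s0.
case: (pselect (exists t, t \in s)) => [[t0 t0s]|nos]; last by move=> t ts; case: nos; exists t.
have /and3P[rkn nm dm'] := dm.
(* Multiplication by x_n^K clears denominators: an exponent -k stands for (P_n / x_n)^k, where P_n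
   does not involve x_n, and contributes x_n^(K - k). *)
pose K := (\max_(t <- s) `|a t n|)%N.
have aK t : t \in s -> 0 <= a t n + K%:Z.
  move=> ts; have : (`|a t n| <= K)%N by exact: (@leq_bigmax_seq _ s predT (fun t => `|a t n|%N)).
  lia.
pose deg t := `|(a t n + K%:Z)%R|%N.
have exd : exists d, has (fun t => deg t == d) s by exists (deg t0); apply/hasP; exists t0.
case: (ex_minnP exd) => d /hasP[t1 t1s /eqP t1d] dmin.
have degd t : t \in s -> (d <= deg t)%N by move=> ts; apply: dmin; apply/hasP; exists t.
pose eps' l := eps l && ~~ (0 < B l n).
pose Rn := lau x (off n) (off n).
have HR : isring Rn by exact: lau_ring.
have mn l : l \in m -> l != n by apply: contraTneq => ->.
pose e l : {poly F} := (inm l / x l)%:P +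
  (if eps l then (mon x (fun j => if j == n then 0 else pospart (B l j)) / x l)%:P * 'X^(`|pospart (B l n)|%N) else 0).
have eE l : (e l).[x n] = exvar eps l.
  rewrite /e /exvar hornerD hornerC mulrDl; case: (eps l); last by rewrite horner0 mul0r.
  rewrite hornerM hornerC hornerXn /outm (mon_pull x (fun j => pospart (B l j)) n); congr (_ + _).
  have -> : x n ^ pospart (B l n) = x n ^+ `|pospart (B l n)|%N.
    by rewrite exprnP; congr (_ ^ _); have := pospart_ge0 (B l n); lia.
  by rewrite mulrAC [X in X / _]mulrC.
have e0 l : (e l).[0] = exvar eps' l.
  rewrite /e /exvar hornerD hornerC mulrDl /eps'; congr (_ + _); case: (eps l); last by rewrite horner0 mul0r.
  rewrite hornerM hornerC hornerXn expr0n /=; have := pospartP (B l n).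
  case: ltrP => bn h.
    have -> : `|pospart (B l n)|%N == 0%N = false by apply/negbTE; lia.
    by rewrite mulr0 mul0r.
  have p0 : pospart (B l n) = 0 by lia.
  by rewrite p0 mulr1; congr (_ / _); apply: eq_mon => j; case: eqP => // ->; rewrite p0.
have eR l : l \in m -> polyr Rn (e l).
  move=> lm; have ln := mn _ lm; apply: (polyrD HR).
    apply: (polyrC HR); apply: (ringM HR); last exact: lau_inV.
    apply: lau_mon_off; have [h1 _] := cm l (mem_behead (s := n :: m) lm).
    have := pospartP (- B l n); suff: ~ B l n < 0 by lia.
    move=> /h1[|[_]]; first by apply/negP/Ym; rewrite inE eqxx.
    by have /allP/(_ l lm) := rkn; lia.
  case: (eps l); last by move=> ?; rewrite coef0; exact: ring0.
  apply: (polyrM HR); last exact: polyrXn.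
  apply: (polyrC HR); apply: (ringM HR); last exact: lau_inV.
  by apply: lau_mon_off; rewrite eqxx.
pose q t := \prod_(l <- m) (if 0 <= a t l then (x l)%:P else e l) ^+ `|a t l|%N.
have qE t : (q t).[x n] = stdmon eps m (a t).
  by rewrite horner_prod; apply: eq_bigr => l _; rewrite horner_exp; case: ifP; rewrite ?hornerC ?eE.
have q0 t : (q t)`_0 = stdmon eps' m (a t).
  by rewrite -horner_coef0 horner_prod; apply: eq_bigr => l _; rewrite horner_exp; case: ifP; rewrite ?hornerC ?e0.
have qR t : polyr Rn (q t).
  rewrite /q big_seq; elim/big_ind: _ => [|p1 p2|l lm]; first exact: (polyrC HR (ring1 HR)).
    exact: polyrM.
  apply: (polyrE HR); case: ifP => _; last exact: eR.
  by apply: (polyrC HR); apply: lau_in; exact: mn.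
pose Pn := inm n + if eps n then outm n else 0.
have PnR : Rn Pn.
  have bn := skew_diag n sk; apply: (ringD HR); first by apply: lau_mon_off; rewrite bn.
  by case: (eps n); [apply: lau_mon_off; rewrite bn | exact: ring0].
have Pn0 : Pn != 0 by exact: in_out_neq0.
pose w t := if 0 <= a t n then 1 else Pn ^+ `|a t n|%N.
pose r t := (c t * w t)%:P * q t * 'X^(deg t).
have wn0 t : w t != 0 by rewrite /w; case: ifP => _; rewrite ?oner_eq0 ?expf_neq0.
have rE t : t \in s -> (r t).[x n] = c t * stdmon eps (n :: m) (a t) * x n ^+ K.
  move=> ts; rewrite /r !hornerM hornerC hornerXn qE /stdmon big_cons -!mulrA; congr (_ * _).
  rewrite [in RHS]mulrCA [in LHS]mulrCA; congr (_ * _); rewrite /w /deg; have := aK t ts.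
  case: ifP => an h; first by rewrite mul1r -exprD; congr (_ ^+ _); lia.
  rewrite /exvar -/Pn expr_div_n -mulrA; congr (_ * _).
  have -> : x n ^+ K = x n ^+ `|a t n|%N * x n ^+ `|(a t n + K%:Z)%R|%N by rewrite -exprD; congr (_ ^+ _); lia.
  by rewrite mulKf // expf_neq0.
have YR b : lau x Y pred0 b -> Rn b.
  by apply: lau_mono => // l Yl; rewrite /off /=; apply: contraTneq Yl => ->; apply: Ym; rewrite inE eqxx.
have rR t : t \in s -> polyr Rn (r t).
  move=> ts; apply: (polyrM HR); last exact: polyrXn.
  apply: (polyrM HR) => //; apply: (polyrC HR); apply: (ringM HR); first exact/YR/cs.
  by rewrite /w; case: ifP => _; [exact: ring1 | exact: ringX].
have rsum : \sum_(t <- s) r t = 0.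
  apply: (tr (i := n)).
    rewrite big_seq; elim/big_ind: _ => [|p1 p2|t ts]; last exact: rR.
      by apply: (polyrC HR); exact: ring0.
    exact: polyrD.
  rewrite horner_sum; apply: etrans (_ : (\sum_(t <- s) c t * stdmon eps (n :: m) (a t)) * x n ^+ K = 0).
    by rewrite big_distrl /= !big_seq; apply: eq_bigr => t /rE.
  by rewrite s0 mul0r.
pose s1 := filter (fun t => deg t == d) s.
have adn t : t \in s1 -> a t n = d%:Z - K%:Z.
  by rewrite mem_filter => /andP[/eqP td ts]; have := aK t ts; rewrite /deg in td; lia.
have sub1 t : t \in s1 -> t \in s by rewrite mem_filter => /andP[].
have z1 t : t \in s1 -> c t = 0.
  apply: (IHm eps' s1) => //.
  - by move=> l lm; apply: Ym; rewrite inE lm orbT.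
  - move=> l lm; have [h1 h2] := cm l (mem_behead (s := n :: m) lm); split.
      move=> j /h1[->|[jm rjl]]; [by left | right; split=> //].
      by move: jm; rewrite inE => /orP[/eqP jn|//]; have /allP/(_ l lm) := rkn; rewrite -jn; lia.
    move=> /andP[el bn] j bj; case: (h2 el j bj) => [->|]; first by left.
    by rewrite inE => /orP[/eqP jn|jm]; [rewrite -jn bj in bn | right].
  - exact: filter_uniq.
  - move=> t2 t' ts ts' tt'; have [l] := ds t2 t' (sub1 _ ts) (sub1 _ ts') tt'.
    by rewrite inE => /orP[/eqP ->|lm]; [rewrite !adn // eqxx | exists l].
  - by move=> t' /sub1/cs.
  have := congr1 (fun p : {poly F} => p`_d) rsum; rewrite coef0 coef_sum.
  rewrite (bigID (fun t => deg t == d)) /= [X in _ + X]big1_seq ?addr0; last first.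
    move=> t' /andP[td /degd dt]; rewrite /r coefMXn ltn_neqAle eq_sym td dt //.
  rewrite -big_filter -/s1 => E.
  apply: (mulIf (wn0 t1)); rewrite mul0r -[RHS]E big_distrl /= !big_seq; apply: eq_bigr => t' ts'.
  have -> : w t1 = w t' by rewrite /w !adn // mem_filter t1d eqxx.
  have td : deg t' = d by move: ts'; rewrite mem_filter => /andP[/eqP].
  by rewrite /r coefMXn td ltnn subnn coefCM q0 mulrAC.
have z2 t : t \in [seq t <- s | deg t != d] -> c t = 0.
  have sub2 t' : t' \in [seq t <- s | deg t != d] -> t' \in s by rewrite mem_filter => /andP[].
  apply: (IHk [seq t <- s | deg t != d]).
  - rewrite -ltnS; apply: leq_trans sk'; rewrite ltnS size_filter -(count_predC (fun t => deg t != d)) -addn1 leq_add2l.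
    by rewrite -has_count; apply/hasP; exists t1 => //=; rewrite t1d eqxx.
  - exact: filter_uniq.
  - by move=> t' t'' /sub2 h1 /sub2 h2; exact: ds.
  - by move=> t' /sub2/cs.
  rewrite big_filter; rewrite (bigID (fun t => deg t == d)) /= in s0.
  move: s0; rewrite [X in X + _]big1_seq ?add0r // => t' /andP[td ts'].
  by rewrite z1 ?mul0r // mem_filter td.
move=> t ts; have [td|td] := boolP (deg t == d); first by apply: z1; rewrite mem_filter td.
by apply: z2; rewrite mem_filter td.
Qed.
End Standard.

Section Span.
Variables (F : fieldType) (I : finType) (x : I -> F) (B : I -> I -> int) (rk : I -> nat).
Hypothesis gs : good (x, B).
Implicit Types (Y : pred I) (m : seq I).
Add Ring F_ring3 : (comring_theory F).

Let c0 : char0 F. Proof. by case: gs. Qed.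
Let tr : tr_indep x. Proof. by case: gs. Qed.
Let sk : skew B. Proof. by case: gs. Qed.
Let nz l : x l != 0. Proof. exact: tr_neq0. Qed.
Local Notation xp l := (exvar x B predT l).
Local Notation sm := (stdmon x B predT).
Local Notation compat m Y := (compat B rk m Y predT).
Local Notation ZY Y := (lau x Y pred0).

Definition lower Y m := gen (fun a => (exists2 l, Y l || (l \in m) & a = x l) \/ (exists2 l, l \in m & a = xp l)).

Lemma lower_ring Y m : isring (lower Y m). Proof. exact: gen_ring. Qed.
Lemma lower_in Y m l : Y l || (l \in m) -> lower Y m (x l).
Proof. by move=> h; apply: gen_in; left; exists l. Qed.
Lemma lower_xp Y m l : l \in m -> lower Y m (xp l).
Proof. by move=> h; apply: gen_in; right; exists l. Qed.
Lemma lower_mono Y m Y' m' : (forall l, Y l || (l \in m) -> Y' l || (l \in m')) -> {subset m <= m'} ->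
  forall a, lower Y m a -> lower Y' m' a.
Proof.
by move=> h1 h2; apply: gen_mono => a [[l /h1 lm ->]|[l /h2 lm ->]]; [exact: lower_in | exact: lower_xp].
Qed.
Lemma lower_ZY Y m a : ZY Y a -> lower Y m a.
Proof. by apply: gen_mono => b [[l Yl ->]|[//]]; apply: lower_in; rewrite Yl. Qed.

Lemma lower_mon Y m (a : I -> int) : (forall l, 0 <= a l) -> (forall l, a l != 0 -> Y l || (l \in m)) ->
  lower Y m (mon x a).
Proof.
move=> a0 h; have : lau x (fun l => Y l || (l \in m)) pred0 (mon x a).
  by apply: lau_mon => l; [move=> al; apply: h; lia | have := a0 l; lia].
by apply: gen_mono => b [[l Yl ->]|[//]]; exact: lower_in.
Qed.

Lemma xpE l : x l * xp l = inm x B l + outm x B l.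
Proof. by rewrite mulrC mulfVK. Qed.

Lemma lower_sm Y m a : lower Y m (sm m a).
Proof.
have HL := lower_ring Y m; rewrite /stdmon big_seq; elim/big_ind: _ => [|p1 p2|l lm].
- exact: (ring1 HL).
- exact: (ringM HL).
apply: (ringX HL); case: ifP => _; [apply: lower_in; rewrite lm orbT // | exact: lower_xp].
Qed.

Inductive span Y m : F -> Prop :=
| span0 : span Y m 0
| span_B f g : span Y m f -> span Y m g -> span Y m (f - g)
| span_in r a : ZY Y r -> span Y m (r * sm m a).

Lemma span_sum (T : Type) (s : seq T) Y m (f : T -> F) : (forall t, span Y m (f t)) -> span Y m (\sum_(t <- s) f t).
Proof.
move=> h; elim: s => [|t s IH]; rewrite ?big_nil ?big_cons; first exact: span0.
rewrite -[\sum_(_ <- _) _]opprK; apply: span_B => //; rewrite -sub0r; apply: span_B => //; exact: span0.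
Qed.

Lemma eq_sm m (a b : I -> int) : {in m, a =1 b} -> sm m a = sm m b.
Proof. by move=> e; apply: eq_big_seq => l lm; rewrite e. Qed.

(** Elements are polynomials in the new variable of n over the lower bound with n frozen. A product
    of x_n with its new variable is replaced by the exchange polynomial, which lies in that smaller
    ring, so the degree in the new variable drops. *)
Lemma lower_span m Y f : desc rk m -> (forall l, l \in m -> ~~ Y l) -> compat m Y ->
  lower Y m f -> span Y m f.
Proof.
elim: m Y f => [|n m IH] Y f.
  move=> _ _ _ fL; have -> : f = f * sm [::] (fun=> 0) by rewrite /stdmon big_nil mulr1.
  by apply: span_in; apply: gen_mono fL => a [[l + ->]|[l //]]; rewrite orbF => Yl; exact: lau_in.
move=> /and3P[rkn nm dm] Ym cm fL; pose Y' := predU1 n Y.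
have HA := lower_ring Y' m.
have nY : ~~ Y n by apply: Ym; rewrite inE eqxx.
have {fL} : gen (fun b => lower Y' m b \/ b = xp n) f.
  apply: gen_mono fL => a [[l lY ->]|[l lm ->]]; apply: gen_in.
    by left; apply: lower_in; move: lY; rewrite /Y' inE /= orbCA orbA.
  by move: lm; rewrite inE => /orP[/eqP -> |lm]; [right | left; exact: lower_xp].
have zspan z : lower Y' m z -> span Y' m z.
  apply: IH => // [l lm|l lm].
    rewrite /Y' /= negb_or Ym ?inE ?lm ?orbT // andbT.
    by apply: contraNneq nm => <-.
  have [h1 h2] := cm l (mem_behead (s := n :: m) lm); split.
    move=> j /h1[Yj|[jm rjl]]; first by left; rewrite /Y' /= Yj orbT.
    move: jm; rewrite inE => /orP[/eqP jn|jm]; last by right.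
    by have /allP/(_ l lm) := rkn; rewrite -jn leqNgt rjl.
  move=> _ j /(h2 isT) [Yj|]; first by left; rewrite /Y' /= Yj orbT.
  by rewrite inE => /orP[/eqP ->|]; [left; rewrite /Y' /= eqxx | right].
have PA : lower Y' m (inm x B n + outm x B n).
  have [h1 h2] := cm n (mem_head n m); have bn := skew_diag n sk.
  apply: (ringD HA); apply: lower_mon => l; rewrite ?pospart_ge0 // => bl; rewrite /Y' /=.
    have : B n l < 0 by have := pospartP (- B n l); lia.
    by move=> /h1[->|[+ _]]; rewrite ?orbT // inE orbAC => ->.
  have : 0 < B n l by have := pospartP (B n l); lia.
  by move=> /(h2 isT)[->|]; rewrite ?orbT // inE orbAC => ->.
have smn a k : sm (n :: m) (fun l => if l == n then k else a l) =
    (if 0 <= k then x n else xp n) ^+ `|k|%N * sm m a.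
  rewrite /stdmon big_cons eqxx; congr (_ * _); apply: eq_sm => l lm.
  by case: eqP => // ln; rewrite -ln lm in nm.
move=> /(gen_horner HA) [p pA ->]; rewrite horner_coef; apply: span_sum => k.
move: (nat_of_ord k) (p`_k) (pA k) => {pA p}k z zA; elim: k z zA => [|k IHk] z /[dup] zA /zspan.
  rewrite expr0 mulr1; elim=> {z zA} [|f1 g1 _ hf _ hg|r a rY]; first exact: span0.
    exact: span_B.
  have {rY} : gen (fun b => ZY Y b \/ b = x n) r.
    apply: gen_mono rY => b [[l lY ->]|[//]]; apply: gen_in; move: lY => /= /orP[/eqP ->|lY]; first by right.
    by left; exact: lau_in.
  move=> /(gen_horner (lau_ring _ _ _)) [p pY ->]; rewrite horner_coef big_distrl; apply: span_sum => e /=.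
  have := smn a e; rewrite /= => E.
  by rewrite -mulrA -E; exact: span_in.
elim=> {z zA} [|f1 g1 _ hf _ hg|r a rY]; first by rewrite mul0r; exact: span0.
  by rewrite mulrBl; exact: span_B.
have {rY} : gen (fun b => ZY Y b \/ b = x n) r.
  apply: gen_mono rY => b [[l lY ->]|[//]]; apply: gen_in; move: lY => /= /orP[/eqP ->|lY]; first by right.
  by left; exact: lau_in.
move=> /(gen_horner (lau_ring _ _ _)) [p pY ->]; rewrite horner_coef -mulrA big_distrl; apply: span_sum => -[e /= _].
have YA b : ZY Y b -> lower Y' m b.
  by move=> bY; apply: lower_ZY; apply: lau_mono bY => // l lY; rewrite /Y' /= lY orbT.
case: e => [|e].
  have E := smn a (- k.+1%:Z); rewrite abszN absz_nat oppr_ge0 /= in E.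
  by rewrite expr0 mulr1 [sm m a * _]mulrC -E; exact: span_in.
have -> : p`_e.+1 * x n ^+ e.+1 * (sm m a * xp n ^+ k.+1) =
   p`_e.+1 * x n ^+ e * sm m a * (x n * xp n) * xp n ^+ k by move: (sm m a) (xp n) (p`_e.+1) => u v w; cring F.
apply: IHk; rewrite xpE; apply: (ringM HA) => //; apply: (ringM HA); last exact: lower_sm.
apply: (ringM HA); first exact: YA.
by apply: (ringX HA); apply: lower_in; rewrite /Y' /= eqxx.
Qed.

Definition zero_off m (t : {ffun I -> int}) := forall l, l \notin m -> t l = 0.

Lemma big_zero_off (T : eqType) (s s' : seq T) (g : T -> F) : uniq s -> uniq s' -> {subset s <= s'} ->
  (forall t, t \notin s -> g t = 0) -> \sum_(t <- s) g t = \sum_(t <- s') g t.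
Proof.
move=> us us' ss g0; rewrite [RHS](bigID (mem s)) /= [X in _ + X]big1 ?addr0 => [|t /g0 //].
rewrite -[RHS]big_filter; apply: perm_big; apply: uniq_perm => //; first exact: filter_uniq.
by move=> t; rewrite mem_filter /=; have [/ss|] := boolP (t \in s).
Qed.

(** Expansions whose coefficients vanish off the list can be rewritten over a larger list, and so
    compared term by term. *)
Definition srep Y m (s : seq {ffun I -> int}) (c : {ffun I -> int} -> F) f :=
  [/\ forall t, ZY Y (c t), forall t, t \notin s -> c t = 0 & f = \sum_(t <- s) c t * sm m t].

Lemma srep_widen Y m s s' c f : uniq s -> uniq s' -> {subset s <= s'} -> srep Y m s c f -> srep Y m s' c f.
Proof.
move=> us us' ss [cY c00 ->]; split=> // [t ts'|]; first by apply: c00; apply: contraNN ts' => /ss.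
by apply: big_zero_off => // t /c00 ->; rewrite mul0r.
Qed.

Lemma span_rep Y m f : span Y m f ->
  exists s c, [/\ uniq s, forall t, t \in s -> zero_off m t & srep Y m s c f].
Proof.
have HY := lau_ring x Y pred0.
elim=> {f} [|f g _ [s [c [us zs rs]]] _ [s' [c' [us' zs' rs']]]|r a rY].
- exists [::], (fun=> 0); split=> //; split=> // [t|]; first exact: (ring0 HY).
  by rewrite big_nil.
- have uu := undup_uniq (s ++ s').
  have r1 : srep Y m (undup (s ++ s')) c f.
    by apply: srep_widen rs => // t ts; rewrite mem_undup mem_cat ts.
  have r2 : srep Y m (undup (s ++ s')) c' g.
    by apply: srep_widen rs' => // t ts; rewrite mem_undup mem_cat ts orbT.
  exists (undup (s ++ s')), (fun t => c t - c' t); split=> //.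
    by move=> t; rewrite mem_undup mem_cat => /orP[/zs|/zs'].
  case: r1 r2 => cY c00 -> [cY' c00' ->]; split=> [t|t ts|]; first exact: (ringB HY).
    by rewrite c00 ?c00' // subrr.
  by rewrite -sumrB; apply: eq_bigr => t _; rewrite mulrBl.
pose t : {ffun I -> int} := [ffun l => if l \in m then a l else 0].
exists [:: t], (fun t' => if t' == t then r else 0); split=> //.
  by move=> t'; rewrite inE => /eqP -> l lm; rewrite ffunE (negPf lm).
split=> [t'|t'|]; first by case: eqP => // _; exact: (ring0 HY).
  by rewrite inE => /negPf ->.
rewrite big_seq1 eqxx; congr (_ * _); apply: eq_sm => l lm; by rewrite ffunE lm.
Qed.

(** M does not involve y, so the term of c of degree 0 in y must vanish. *)
Lemma ZY_dvd Y y M c d : Y y -> lau x (offp Y y) pred0 M -> M != 0 -> ZY Y c -> ZY Y d ->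
  M * c = x y * d -> exists c', ZY Y c' /\ c = x y * c'.
Proof.
move=> Yy MR M0 cY dY E; have HR := lau_ring x (offp Y y) pred0.
have ex b : ZY Y b -> exists2 p, polyr (lau x (offp Y y) pred0) p & b = p.[x y].
  move=> bY; apply: (gen_horner HR); apply: gen_mono bY => {}b [[l Yl ->]|[//]].
  have [->|ly] := eqVneq l y; apply: gen_in; first by right.
  by left; apply: lau_in; rewrite /offp Yl.
have [p pR pE] := ex c cY; have [q qR qE] := ex d dY.
have sub b : lau x (offp Y y) pred0 b -> lau x (off y) (off y) b by apply: lau_mono => // l /andP[].
have E' : M%:P * p = 'X * q.
  apply: (transc_eq (lau_ring x (off y) (off y)) (tr (i := y))).
  - by apply: (polyrM (lau_ring _ _ _)); [apply: (polyrC (lau_ring _ _ _)); exact: sub | move=> k; exact: sub].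
  - by apply: (polyrM (lau_ring _ _ _)); [exact: (polyrX (lau_ring _ _ _)) | move=> k; exact: sub].
  by rewrite !hornerM hornerC hornerX -pE -qE.
have p0 : p`_0 = 0.
  apply: (mulfI M0); rewrite mulr0; have := congr1 (fun r : {poly F} => r`_0) E'.
  by rewrite coefCM coefXM.
exists (drop_poly 1 p).[x y]; split.
  apply: (polyr_horner (lau_ring x Y pred0)); last exact: lau_in.
  by move=> k; rewrite coef_drop_poly; apply: lau_mono (pR _) => // l /andP[].
rewrite pE -[p in LHS](poly_take_drop 1) hornerD hornerM hornerXn expr1 mulrC.
have -> : take_poly 1 p = 0.
  by apply/polyP => k; rewrite coef_take_poly coef0; case: k => // ; rewrite p0.
by rewrite horner0 add0r.
Qed.

(** Independence of the standard monomials splits the equation into one equation for each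
    coefficient, to which [ZY_dvd] applies. *)
Lemma lower_dvd Y m y M g h : desc rk m -> (forall l, l \in m -> ~~ Y l) -> compat m Y ->
  Y y -> lau x (offp Y y) pred0 M -> M != 0 -> lower Y m g -> lower Y m h -> M * g = x y * h ->
  lower Y m (g / x y).
Proof.
move=> dm Ym cm Yy MR M0 gL hL E.
have [s [c [us zs rs]]] := span_rep (lower_span dm Ym cm gL).
have [s' [d [us' zs' rs']]] := span_rep (lower_span dm Ym cm hL).
have uu := undup_uniq (s ++ s'); set S := undup (s ++ s') in uu.
have [cY c00 gE] : srep Y m S c g.
  by apply: srep_widen rs => // t ts; rewrite mem_undup mem_cat ts.
have [dY d00 hE] : srep Y m S d h.
  by apply: srep_widen rs' => // t ts; rewrite mem_undup mem_cat ts orbT.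
have HY := lau_ring x Y pred0.
have MY : ZY Y M by apply: lau_mono MR => // l /andP[].
have cd t : t \in S -> M * c t = x y * d t.
  move=> tS; apply/eqP; rewrite -subr_eq0; apply/eqP.
  apply: (indep (s := S) (a := fun t => t) (c := fun t => M * c t - x y * d t) gs dm Ym cm uu) => //.
  - move=> t1 t2 h1 h2; apply: contra_neqP => nex; apply/ffunP => l.
    have zS t' : t' \in S -> zero_off m t' by rewrite mem_undup mem_cat => /orP[/zs|/zs'].
    have [lm|lm] := boolP (l \in m); last by rewrite !zS.
    by apply/eqP; apply: contra_notT nex => ne; exists l.
  - by move=> t' _; apply: (ringB HY); apply: (ringM HY) => //; exact: lau_in.
  transitivity (M * g - x y * h); last by rewrite E subrr.
  rewrite gE hE !mulr_sumr -sumrB; apply: eq_bigr => t' _; by rewrite mulrBl !mulrA.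
have /choice[c' cH] : forall t, exists c', t \in S -> ZY Y c' /\ c t = x y * c'.
  move=> t; case: (boolP (t \in S)) => tS; last by exists 0.
  by have [c' ?] := ZY_dvd Yy MR M0 (cY t) (dY t) (cd t tS); exists c'.
have HL := lower_ring Y m.
have -> : g / x y = \sum_(t <- S) (if t \in S then c' t else 0) * sm m t.
  apply: (mulIf (nz y)); rewrite mulfVK // gE big_distrl /= !big_seq; apply: eq_bigr => t tS.
  by rewrite tS; have [_ ->] := cH t tS; rewrite -mulrA mulrC.
apply: (ring_sum HL) => t _; apply: (ringM HL); last exact: lower_sm.
case: ifP => tS; last exact: (ring0 HL).
by apply: lower_ZY; have [] := cH t tS.
Qed.

Lemma desc_sort m : uniq m -> desc rk (sort (fun i j => (rk j <= rk i)%N) m).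
Proof.
move=> um; have tot : total (fun i j => (rk j <= rk i)%N) by move=> i j; exact: leq_total.
have trans : transitive (fun i j => (rk j <= rk i)%N) by move=> i j k h1 h2; exact: leq_trans h2 h1.
have : uniq (sort (fun i j => (rk j <= rk i)%N) m) by rewrite sort_uniq.
have := sort_sorted tot m; elim: (sort _ m) => //= n s IH ps /andP[ns us].
by rewrite ns IH ?(path_sorted ps) //; have := order_path_min trans ps => ->.
Qed.

(** The monomial is cancelled one variable at a time by [lower_dvd]; M, free of the variables of
    [Y'], is the multiplier each time. *)
Lemma lower_saturated Y (Y' : pred I) m M f (a : I -> int) : uniq m -> (forall l, l \in m -> ~~ Y l) -> compat m Y ->
  subpred Y' Y -> lau x (fun l => Y l && ~~ Y' l) pred0 M -> M != 0 ->
  (forall l, 0 <= a l) -> (forall l, a l != 0 -> Y' l) ->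
  lower Y m (f * mon x a) -> lower Y m (f * M) -> lower Y m f.
Proof.
move=> um Ym cm YY MR M0; pose m' := sort (fun i j => (rk j <= rk i)%N) m.
have dm : desc rk m' by exact: desc_sort.
have mm : m' =i m by move=> l; rewrite mem_sort.
have LL g : lower Y m g <-> lower Y m' g.
  by split; apply: lower_mono => l; rewrite mm.
have Ym' l : l \in m' -> ~~ Y l by rewrite mm; exact: Ym.
have cm' : compat m' Y by move=> l; rewrite mm => /cm[h1 h2]; split=> [j /h1|h j /(h2 h)]; rewrite mm.
have HL := lower_ring Y m'.
have [k] := ubnP (\sum_l `|a l|)%N; elim: k a => // k IH a ak a0 aY h fM.
case: (pselect (forall l, a l = 0)) => [az|/existsNP[y /eqP ay]].
  by move: h; rewrite /mon big1 ?mulr1 // => l _; rewrite az.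
pose b l := a l - (l == y)%:Z.
have ab : mon x a = mon x b * x y.
  by rewrite -[x y](mon_delta x y) -monD //; apply: eq_mon => l; rewrite subrK.
have b0 l : 0 <= b l by rewrite /b; have := a0 l; case: (l =P y) => [->|_] /=; lia.
have bY l : b l != 0 -> Y' l.
  rewrite /b; case: (l =P y) => [-> _|_]; first exact: aY.
  by rewrite subr0; exact: aY.
have Yy : Y y by apply: YY; exact: aY.
apply: (IH b) => //.
  rewrite -ltnS; apply: leq_trans ak; rewrite ltnS (bigD1 y) // [X in (_ < X)%N](bigD1 y) //= -addSn.
  apply: leq_add; first by rewrite /b eqxx; have := a0 y; lia.
  by apply: leq_sum => l /negPf ly; rewrite /b ly subr0.
apply/LL; rewrite -(mulfK (nz y) (f * mon x b)) -[f * mon x b * x y]mulrA -ab.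
apply: (lower_dvd (M := M) (h := mon x b * (f * M)) dm Ym' cm' Yy _ M0).
- by apply: lau_mono MR => // l /andP[Yl nYl]; rewrite /offp Yl; apply: contraNneq nYl => ->; exact: aY.
- exact/LL.
- apply: (ringM HL); last exact/LL.
  by apply: lower_mon => // l /bY/YY ->.
by rewrite ab; cring F.
Qed.
End Span.

(** * Upper and lower bounds *)

Section Binomial.
Variables (F : fieldType) (R : F -> Prop).
Hypothesis HR : isring R.
Add Ring F_ring4 : (comring_theory F).

(** In each term of the binomial expansion, the power of u is at least N or that of v is at least
    M. *)
Lemma ring_binomial f u v N M : R u -> R v -> R (f * u ^+ N) -> R (f * v ^+ M) ->
  R (f * (u + v) ^+ (N + M)).
Proof.
move=> uR vR fu fv; rewrite exprDn big_distrr; apply: (ring_sum HR) => k _ /=.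
rewrite mulrnAr -mulr_natr; apply: (ringM HR); last first.
  by elim: 'C(_, _) => [|n IH]; [exact: ring0 | rewrite -natr1; apply: (ringD HR) => //; exact: ring1].
have [kM|Mk] := leqP k M.
  have -> : (N + M - k = N + (M - k))%N by rewrite addnBA.
  rewrite exprD -[u ^+ N * _ * _]mulrA mulrA; apply: (ringM HR) => //.
  by apply: (ringM HR); exact: (ringX HR).
have -> : u ^+ (N + M - k) * v ^+ k = v ^+ M * (u ^+ (N + M - k) * v ^+ (k - M)).
  by rewrite mulrCA -exprD subnKC // ltnW.
rewrite mulrA; apply: (ringM HR) => //.
by apply: (ringM HR); exact: (ringX HR).
Qed.
End Binomial.

Section Fractions.
Variables (F : fieldType) (R : F -> Prop).
Hypothesis HR : isring R.
Add Ring F_ring5 : (comring_theory F).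

(** The fraction field of R inside F, a common coefficient field for decompositions obtained over
    different rings. *)
Definition fracr a := exists b, [/\ R b, b != 0 & R (a * b)].

Lemma fracr_in a : R a -> fracr a.
Proof. by move=> aR; exists 1; rewrite mulr1 oner_neq0; split=> //; exact: ring1. Qed.

Lemma fracr_ring : isring fracr.
Proof.
split; first by apply: fracr_in; exact: ring1.
  move=> a a' [b [bR b0 abR]] [b' [bR' b0' abR']]; exists (b * b'); rewrite mulf_neq0 //; split=> //.
    exact: (ringM HR).
  have -> : (a - a') * (b * b') = a * b * b' - a' * b' * b by cring F.
  by apply: (ringB HR); exact: (ringM HR).
move=> a a' [b [bR b0 abR]] [b' [bR' b0' abR']]; exists (b * b'); rewrite mulf_neq0 //; split=> //.
  exact: (ringM HR).
by rewrite mulrACA; exact: (ringM HR).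
Qed.

Lemma fracrV a : fracr a -> fracr a^-1.
Proof.
have [->|a0] := eqVneq a 0; first by rewrite invr0.
move=> [b [bR b0 abR]]; exists (a * b); rewrite mulf_neq0 //; split=> //.
by rewrite mulKf.
Qed.

Lemma transc_fracr t : transc R t -> transc fracr t.
Proof.
move=> tr p /choice[b bH] p0.
pose c := \prod_(k < size p) b k.
have c0 : c != 0 by apply/prodf_neq0 => k _; case: (bH k).
have : c%:P * p = 0.
  apply: tr => [k|]; last by rewrite hornerM p0 mulr0.
  rewrite coefCM; have [kp|kp] := ltnP k (size p); last by rewrite nth_default // mulr0; exact: ring0.
  rewrite /c (bigD1 (Ordinal kp)) //= mulrAC mulrC [b k * _]mulrC; apply: (ringM HR).
    by apply: (ring_prod HR) => j _; case: (bH j).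
  by case: (bH k).
by move/eqP; rewrite mulf_eq0 polyC_eq0 (negPf c0) => /eqP.
Qed.
End Fractions.

Section Split.
Variables (F : fieldType) (K : F -> Prop) (t P : F).
Hypothesis HK : isring K.
Hypothesis trt : transc K t.
Hypothesis KP : K P.
Hypothesis P0 : P != 0.
Add Ring F_ring6 : (comring_theory F).
Let t0 : t != 0. Proof. exact: transc_neq0 trt. Qed.

(** After multiplication by t^(s + 1), the first summand has only terms of degree at least s + 1 and
    the second only terms of degree at most s. *)
Lemma split_unique (a b : {poly F}) : polyr K a -> polyr K b ->
  a.[t] + P / t * b.[P / t] = 0 -> a = 0 /\ b = 0.
Proof.
move=> aK bK E; pose s := size b; pose W := \poly_(k < s.+1) (b`_(s - k) * P ^+ (s - k)).
have WE : W.[t] = b.[P / t] * t ^+ s by apply: horner_rev.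
have WK : polyr K W.
  move=> k; rewrite coef_poly; case: ifP => _; last exact: ring0.
  by apply: (ringM HK) => //; exact: (ringX HK).
have Z : a * 'X^(s.+1) + P%:P * W = 0.
  apply: trt.
    apply: (polyrD HK); apply: (polyrM HK) => //; first exact: polyrXn.
    exact: polyrC.
  rewrite hornerD !hornerM hornerXn hornerC WE exprS.
  have -> : P * (b.[P / t] * t ^+ s) = P / t * b.[P / t] * (t * t ^+ s).
    by rewrite -{1}(mulfVK t0 P); move: (P / t) (t ^+ s) (b.[_]) => u v w; cring F.
  by rewrite -mulrDl E mul0r.
have b0 : b = 0.
  apply/polyP => k; rewrite coef0; have [ks|ks] := ltnP k s; last by rewrite nth_default.
  have := congr1 (fun r : {poly F} => r`_(s - k)) Z.
  rewrite coefD coefMXn coefCM coef_poly coef0 ltnS leq_subr subKn ?(ltnW ks) // add0r.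
  by move/eqP; rewrite !mulf_eq0 expf_eq0 (negPf P0) andbF orbF => /eqP.
split=> //; move: Z; rewrite /W b0; have -> : \poly_(k < s.+1) ((0 : {poly F})`_(s - k) * P ^+ (s - k)) = 0.
  by apply/polyP => k; rewrite coef_poly !coef0 mul0r if_same.
by rewrite mulr0 addr0 => /eqP; rewrite mulf_eq0 expf_eq0 polyX_eq0 andbF orbF => /eqP.
Qed.

(** Comparison of the two expansions gives p_k = q_(M + N - k) P^(N - k) for k <= N, so negative
    powers of t come with the powers of P that turn them into powers of P / t. *)
Lemma split_exists (R : F -> Prop) f N M p q : isring R -> (forall a, R a -> K a) ->
  polyr R p -> polyr R q -> f * t ^+ N = p.[t] -> f * (P / t) ^+ M = q.[P / t] ->
  exists a b, [/\ polyr R a, polyr R b & f = a.[t] + P / t * b.[P / t]].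
Proof.
move=> HR RK pR qR pE qE; pose s := size q; pose T := (N + M + s)%N.
pose W := \poly_(k < T.+1) (q`_(T - k) * P ^+ (T - k)).
have WE : W.[t] = q.[P / t] * t ^+ T by apply: horner_rev => //; rewrite leqW // leq_addl.
have E : (P ^+ M)%:P * p * 'X^s = W.
  apply: (transc_eq HK trt).
  - apply: (polyrM HK); last exact: polyrXn.
    by apply: (polyrM HK); [apply: (polyrC HK); exact: (ringX HK) | move=> k; exact: RK].
  - move=> k; rewrite coef_poly; case: ifP => _; last exact: ring0.
    by apply: (ringM HK); [exact: RK | exact: (ringX HK)].
  rewrite WE !hornerM hornerC hornerXn -pE -qE expr_div_n /T !exprD.
  have tM : t ^+ M != 0 by rewrite expf_neq0.
  by rewrite -[P ^+ M in LHS](mulfVK tM); move: (P ^+ M / t ^+ M) (t ^+ N) (t ^+ s) (t ^+ M) => u1 u2 u3 u4; cring F.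
have pq k : (k <= N)%N -> p`_k = q`_(M + (N - k)) * P ^+ (N - k).
  move=> kN; apply: (mulfI (expf_neq0 M P0)).
  have := congr1 (fun r : {poly F} => r`_(k + s)) E.
  rewrite coefMXn ltnNge leq_addl /= addnK coefCM coef_poly.
  have -> : (k + s < T.+1)%N by rewrite /T; lia.
  have -> : (T - (k + s) = M + (N - k))%N by rewrite /T; lia.
  by rewrite exprD => ->; rewrite mulrCA.
exists (drop_poly N p), (\poly_(e < N) q`_(M + e.+1)); split.
- by move=> k; rewrite coef_drop_poly.
- by move=> k; rewrite coef_poly; case: ifP => _ //; exact: ring0.
apply: (mulIf (expf_neq0 N t0)); rewrite pE mulrDl -[p in LHS](poly_take_drop N) hornerD hornerM hornerXn addrC.
congr (_ + _); rewrite horner_poly /take_poly horner_poly mulr_sumr mulr_suml.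
rewrite (reindex_inj rev_ord_inj); apply: eq_bigr => k _ /=.
have kN := ltn_ord k; rewrite pq; last by lia.
have -> : (N - (N - k.+1) = k.+1)%N by lia.
rewrite mulrCA -exprS expr_div_n -!mulrA; congr (_ * (_ * _)).
have -> : t ^+ N = t ^+ k.+1 * t ^+ (N - k.+1) by rewrite -exprD; congr (_ ^+ _); lia.
by rewrite mulKf // expf_neq0.
Qed.
End Split.

Section Upper.
Variables (F : fieldType) (I : finType) (x : I -> F) (B : I -> I -> int) (rk : I -> nat).
Hypothesis gs : good (x, B).
Implicit Types (Y : pred I) (m : seq I) (Z : {set I}).
Add Ring F_ring7 : (comring_theory F).

Let c0 : char0 F. Proof. by case: gs. Qed.
Let tr : tr_indep x. Proof. by case: gs. Qed.
Let sk : skew B. Proof. by case: gs. Qed.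
Let nz l : x l != 0. Proof. exact: tr_neq0. Qed.
Let bl0 l : B l l = 0. Proof. exact: skew_diag. Qed.
Local Notation xp l := (exvar x B predT l).
Local Notation lower := (lower x B).

Definition xz Z l := if l \in Z then expoly x (B l) / x l else x l.

Definition stable Z := {in Z &, forall j l, B j l = 0}.

(* The variables of [Y] are frozen and not inverted. *)
Definition upper Y m f := forall Z, {subset Z <= m} -> stable Z ->
  lau (xz Z) (fun l => Y l || (l \in m)) (fun l => l \in m) f.

Definition acyclic_on Y m := [/\ uniq m, forall l, l \in m -> ~~ Y l,
  forall l j, l \in m -> B l j != 0 -> Y j || (j \in m) &
  forall j l, Y j || (j \in m) -> Y l || (l \in m) -> 0 < B j l -> (rk j < rk l)%N].

Lemma xz_neq0 Z l : xz Z l != 0.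
Proof. by rewrite /xz; case: ifP => _ //; rewrite mulf_neq0 ?invr_eq0 // expoly_neq0. Qed.

Lemma xp_expoly l : xp l = expoly x (B l) / x l.
Proof. by rewrite /exvar addrC. Qed.

Lemma acyclic_compat Y m : acyclic_on Y m -> compat B rk m Y predT.
Proof.
move=> [um Ym rows rank] l lm; split=> [j bl|_ j bl].
  have jY : Y j || (j \in m) by apply: (rows l) => //; lia.
  case/orP: (jY) => [|jm]; [by left | right; split=> //].
  by apply: rank => //; [rewrite lm orbT | rewrite sk; lia].
by apply/orP; apply: (rows l) => //; lia.
Qed.

Lemma acyclic_freeze Y m j : acyclic_on Y m -> j \in m ->
  acyclic_on (predU1 j Y) [seq l <- m | l != j].
Proof.
move=> [um Ym rows rank] jm.
have E l : predU1 j Y l || (l \in [seq l <- m | l != j]) = Y l || (l \in m).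
  by rewrite mem_filter /=; case: (eqVneq l j) => [->|_] /=; rewrite ?jm ?orbT.
split; first exact: filter_uniq.
- by move=> l; rewrite mem_filter /= negb_or => /andP[-> /Ym].
- by move=> l k; rewrite E mem_filter => /andP[_]; exact: rows.
- by move=> k l; rewrite !E; exact: rank.
Qed.

(** Freezing j forbids its inverse, which is cleared by a power of x_j; the stable sets are finitely
    many, so one exponent serves all. *)
Lemma upper_freeze Y m j f : upper Y m f -> j \in m ->
  exists N, upper (predU1 j Y) [seq l <- m | l != j] (f * x j ^+ N).
Proof.
move=> fU jm; set m' := [seq l <- m | l != j].
have mE l : (l \in m') = (l != j) && (l \in m) by rewrite mem_filter.
have mm l : l \in m' -> (l != j) && (l \in m) by rewrite mE.
have H Z : exists N, {subset Z <= m'} -> stable Z ->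
    lau (xz Z) (fun l => predU1 j Y l || (l \in m')) (fun l => l \in m') (f * x j ^+ N).
  case: (pselect ({subset Z <= m'} /\ stable Z)) => [[Zm Zs]|]; last by move=> h; exists 0%N => *; case: h.
  have jZ : (j \in Z) = false by apply/negP => /Zm/mm; rewrite eqxx.
  have xj : xz Z j = x j by rewrite /xz jZ.
  have [N [p [pR pE]]] := lau_lift (xz_neq0 Z j) (fU Z (fun l h => proj2 (andP (mm l (Zm l h)))) Zs).
  exists N => _ _; rewrite xj in pE; rewrite pE -xj.
  apply: (polyr_horner (lau_ring _ _ _)); last by apply: lau_in; rewrite /= eqxx.
  move=> k; apply: lau_mono (pR k) => l /andP[lm lj]; rewrite /= mE lj ?lm //=.
  by rewrite (negPf lj).
have /choice[N HN] := H; exists (\max_Z N Z)%N => Z Zm Zs.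
have le : (N Z <= \max_Z N Z)%N by exact: leq_bigmax.
rewrite -(subnKC le) exprD mulrA; apply: (ringM (lau_ring _ _ _)); first exact: HN.
apply: (ringX (lau_ring _ _ _)).
have jZ : (j \in Z) = false by apply/negP => /Zm/mm; rewrite eqxx.
by have := lau_in (xz Z) (D := fun l => predU1 j Y l || (l \in m')) (fun l => l \in m') (l := j); rewrite /xz jZ /= eqxx; exact.
Qed.

(** As i can be added to any stable set Z without i, f has Laurent expansions in x_i and in its new
    variable. The decomposition that they yield depends on Z a priori, but its uniqueness over the
    fraction field makes the coefficients common to all Z. *)
Lemma upper_isolated Y m i f : acyclic_on Y m -> i \in m -> {in m, forall l, B l i = 0} -> upper Y m f ->
  let m' := [seq l <- m | l != i] in
  exists a b : {poly F}, [/\ forall k, upper Y m' a`_k, forall k, upper Y m' b`_k &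
    f = a.[x i] + xp i * b.[xp i]].
Proof.
move=> [um Ym rows rank] im iso fU m'.
have mE l : (l \in m') = (l != i) && (l \in m) by rewrite mem_filter.
have mm l : l \in m' -> (l != i) && (l \in m) by rewrite mE.
have HO := lau_ring x (off i) (off i).
pose K := fracr (lau x (off i) (off i)).
have HK : isring K by exact: fracr_ring.
have trK : transc K (x i) by apply: transc_fracr.
pose P := expoly x (B i); have P0 : P != 0 by exact: expoly_neq0.
have KP : K P by apply: fracr_in => //; exact: lau_expoly_off.
pose R Z := lau (xz Z) (fun l => Y l || (l \in m')) (fun l => l \in m').
have iY : ~~ Y i by exact: Ym.
have RK Z : {subset Z <= m'} -> forall a, R Z a -> K a.
  move=> Zm; have xK l : l != i -> K (xz Z l).
    move=> li; have Kx : K (x l) by apply: fracr_in => //; exact: lau_in.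
    rewrite /xz; case: ifP => // lZ; apply: (ringM HK); last exact: fracrV.
    apply: fracr_in => //; apply: lau_expoly_off; have := Zm l lZ => /mm/andP[_ lm]; exact: iso.
  apply: gen_sub => // a [[l lY ->]|[l lm ->]].
    by apply: xK; case/orP: lY => [Yl|/mm/andP[]//]; apply: contraTneq Yl => ->.
  by apply: fracrV; apply: xK; have /andP[] := mm l lm.
have main Z : {subset Z <= m'} -> stable Z -> exists a b : {poly F},
    [/\ polyr (R Z) a, polyr (R Z) b & f = a.[x i] + P / x i * b.[P / x i]].
  move=> Zm Zs; have Zm0 l : l \in Z -> l \in m by move=> /Zm/mm/andP[].
  have iZ : (i \in Z) = false by apply/negP => /Zm/mm; rewrite eqxx.
  have Zm1 : {subset i |: Z <= m} by move=> l; rewrite !inE => /orP[/eqP -> //|/Zm0].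
  have Zs1 : stable (i |: Z).
    move=> j l; rewrite !inE => /orP[/eqP ->|jZ] /orP[/eqP ->|lZ]; rewrite ?bl0 //.
    - by rewrite sk iso ?oppr0 //; exact: Zm0.
    - by apply: iso; exact: Zm0.
    - exact: Zs.
  have [N [p [pR pE]]] := lau_lift (xz_neq0 Z i) (fU Z Zm0 Zs).
  have [M [q [qR qE]]] := lau_lift (xz_neq0 (i |: Z) i) (fU (i |: Z) Zm1 Zs1).
  rewrite {1 2}/xz iZ in pE; rewrite {1 2}/xz setU11 -/P in qE.
  apply: (split_exists HK trK KP P0 (lau_ring _ _ _) (RK Z Zm) _ _ pE qE).
    by move=> k; apply: lau_mono (pR k) => l /andP[lm li]; rewrite /= mE li.
  move=> k; have := qR k; apply: lau_sub => l /andP[lm li].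
    have -> : xz (i |: Z) l = xz Z l by rewrite /xz !inE (negPf li).
    by apply: lau_in; rewrite mE li.
  have -> : xz (i |: Z) l = xz Z l by rewrite /xz !inE (negPf li).
  by apply: lau_inV; rewrite mE li.
have s0 : {subset (finset.set0 : {set I}) <= m'} by move=> l; rewrite inE.
have [|a [b [aR bR ab]]] := main finset.set0 s0; first by move=> j l; rewrite inE.
exists a, b; suff H Z : {subset Z <= m'} -> stable Z -> polyr (R Z) a /\ polyr (R Z) b.
  by split=> [k Z Zm Zs|k Z Zm Zs|]; [case: (H Z Zm Zs) => + _; exact | case: (H Z Zm Zs) => _; exact | rewrite xp_expoly].
move=> Zm Zs; have [a' [b' [aR' bR' ab']]] := main Z Zm Zs.
have [] := @split_unique _ K (x i) P HK trK KP P0 (a - a') (b - b').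
- by apply: (polyrB HK) => k; [exact: (RK _ s0) | exact: (RK _ Zm)].
- by apply: (polyrB HK) => k; [exact: (RK _ s0) | exact: (RK _ Zm)].
- rewrite !hornerD !hornerN mulrBr addrACA -opprD -ab -ab' subrr //.
by move=> /eqP; rewrite subr_eq0 => /eqP -> /eqP; rewrite subr_eq0 => /eqP ->.
Qed.

Lemma mon_minus (a : I -> int) j : mon x a = x j * mon x (fun l => a l - (l == j)%:Z).
Proof. by rewrite -{1}(mon_delta x j) -monD //; apply: eq_mon => l; rewrite addrC subrK. Qed.

(** The exchange monomial of i that does not contain x_j is x_i times its new variable minus a
    multiple of x_j, and powers of x_i and x_j bring f into the lower bound. The sign s selects the
    monomial. *)
Lemma lower_mon_exch Y m i j (s : int) f N M : i \in m -> j \in m -> s = 1 \/ s = -1 ->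
  (forall l, B i l != 0 -> Y l || (l \in m)) -> 0 < s * B i j ->
  lower Y m (f * x i ^+ N) -> lower Y m (f * x j ^+ M) ->
  lower Y m (f * mon x (fun l => pospart (- (s * B i l))) ^+ (N + M)).
Proof.
move=> im jm s1 rows sij fi fj; have HL := lower_ring x B Y m.
pose a l := pospart (s * B i l) - (l == j)%:Z.
have aL : lower Y m (mon x a).
  apply: lower_mon => // l; rewrite /a.
    by have := pospartP (s * B i l); case: (l =P j) => [->|_] /=; lia.
  case: (l =P j) => [->|_ /=]; first by rewrite jm orbT.
  rewrite subr0 => h; apply: rows; apply: contraNneq h => ->; by rewrite mulr0.
have -> : mon x (fun l => pospart (- (s * B i l))) = x i * xp i + - (x j * mon x a).
  rewrite (mulrC (x i)) mulfVK // -mon_minus /inm /outm; case: s1 => ->.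
    rewrite (eq_mon _ (b := fun l => pospart (- B i l))); last by move=> l; rewrite mul1r.
    rewrite [X in _ - X](eq_mon _ (b := fun l => pospart (B i l))) ?addrK // => l; by rewrite mul1r.
  rewrite (eq_mon _ (b := fun l => pospart (B i l))); last by move=> l; rewrite mulN1r opprK.
  rewrite [X in _ - X](eq_mon _ (b := fun l => pospart (- B i l))); last by move=> l; rewrite mulN1r.
  by rewrite addrAC subrr add0r.
apply: (ring_binomial HL).
- by apply: (ringM HL); [apply: lower_in; rewrite im orbT | exact: lower_xp].
- by apply: (ringN HL); apply: (ringM HL) => //; apply: lower_in; rewrite jm orbT.
- by rewrite exprMn mulrA; apply: (ringM HL) => //; apply: (ringX HL); exact: lower_xp.
have -> : - (x j * mon x a) = x j * (- mon x a) by cring F.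
by rewrite exprMn mulrA; apply: (ringM HL) => //; apply: (ringX HL); exact: (ringN HL).
Qed.

(** If m is linked, let i be of least rank among the sources of arrows inside m and k of largest
    rank among their targets. The incoming monomial of i and the outgoing one of k involve only Y,
    and powers of both bring f into the lower bound. A common variable q would give rk k < rk q < rk
    i < rk k, so they are coprime and the first one can be cancelled. *)
Theorem upper_lower Y m f : acyclic_on Y m -> upper Y m f -> lower Y m f.
Proof.
have [n] := ubnP (size m); elim: n m Y f => // n IH m Y f mn am fU.
have [um Ym rows rank] := am.
have lt i : i \in m -> (size [seq l <- m | l != i] < n)%N.
  move=> im; rewrite -ltnS; apply: leq_trans mn; rewrite ltnS size_filter.
  rewrite -(count_predC (fun l => l != i) m) -addn1 leq_add2l -has_count.
  by apply/hasP; exists i => //=; rewrite eqxx.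
case: m => [|i0 m0] in mn am fU um Ym rows rank lt *.
  have s0 : {subset (finset.set0 : {set I}) <= [::]} by move=> l; rewrite inE.
  have st0 : stable finset.set0 by move=> j l; rewrite inE.
  have := fU _ s0 st0; apply: gen_mono => a [[l lY ->]|[l //]].
  by rewrite /xz inE; exact: lower_in.
set m := i0 :: m0 in mn am fU um Ym rows rank lt *.
case: (pselect (exists j l, [/\ j \in m, l \in m & 0 < B j l])) => [[j0 [l0 [jm lm jl]]]|noe]; last first.
  have im : i0 \in m by exact: mem_head.
  have iso : {in m, forall l, B l i0 = 0}.
    move=> l lm; apply/eqP/negPn/negP => h; apply: noe.
    have [p|p] := ltrP 0 (B l i0); first by exists l, i0.
    by exists i0, l; split=> //; rewrite sk; lia.
  have [a [b [aU bU ->]]] := upper_isolated am im iso fU.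
  have am' : acyclic_on Y [seq l <- m | l != i0].
    split=> [|l|l j|j l]; rewrite ?mem_filter; first exact: filter_uniq.
    - by move=> /andP[_ /Ym].
    - move=> /andP[_ lm] h; have := rows l j lm h; case: (eqVneq j i0) => // e.
      by rewrite e iso // eqxx in h.
    - by move=> h1 h2; apply: rank; [case/orP: h1 => [->|/andP[_ ->]] | case/orP: h2 => [->|/andP[_ ->]]]; rewrite ?orbT.
  have HL := lower_ring x B Y m.
  have mono c : lower Y [seq l <- m | l != i0] c -> lower Y m c.
    apply: lower_mono => [l|l]; last by rewrite mem_filter => /andP[].
    by case/orP => [->//|]; rewrite mem_filter => /andP[_ ->]; rewrite orbT.
  apply: (ringD HL).
    apply: (polyr_horner HL); last by apply: lower_in; rewrite im orbT.
    by move=> k; apply/mono/IH => //; exact: lt.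
  apply: (ringM HL); first exact: lower_xp.
  apply: (polyr_horner HL); last exact: lower_xp.
  by move=> k; apply/mono/IH => //; exact: lt.
have freeze j : j \in m -> exists N, lower Y m (f * x j ^+ N).
  move=> jm'; have [N NU] := upper_freeze fU jm'; exists N.
  have := IH _ _ _ (lt j jm') (acyclic_freeze am jm') NU; apply: lower_mono => [l|l].
    by rewrite mem_filter /=; case: (eqVneq l j) => [->|_]; rewrite ?jm' ?orbT.
  by rewrite mem_filter => /andP[].
pose src i := (i \in m) && has (fun l => 0 < B i l) m.
pose snk k := (k \in m) && has (fun l => 0 < B l k) m.
have srcj : src j0 by rewrite /src jm; apply/hasP; exists l0.
have snkl : snk l0 by rewrite /snk lm; apply/hasP; exists j0.
case: (arg_minnP rk srcj) => i /andP[im /hasP[j jm' ij]] imin.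
case: (arg_maxnP rk snkl) => k /andP[km /hasP[l lm' lk]] kmax.
have ik : (rk i < rk k)%N.
  apply: (@leq_trans (rk j)); first by apply: rank; rewrite ?im ?jm' ?orbT.
  by apply: kmax; rewrite /snk jm'; apply/hasP; exists i.
have isrc q : B i q < 0 -> Y q.
  move=> h; have qi : 0 < B q i by rewrite sk; lia.
  have /orP[//|] : Y q || (q \in m) by apply: (rows i) => //; lia.
  move=> qm; have : (rk i <= rk q)%N by apply: imin; rewrite /src qm; apply/hasP; exists i.
  by rewrite leqNgt rank ?im ?qm ?orbT.
have ksnk q : 0 < B k q -> Y q.
  move=> h; have /orP[//|] : Y q || (q \in m) by apply: (rows k) => //; lia.
  move=> qm; have : (rk q <= rk k)%N by apply: kmax; rewrite /snk qm; apply/hasP; exists k.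
  by rewrite leqNgt rank ?km ?qm ?orbT.
have [Ni Hi] := freeze i im; have [Nj Hj] := freeze j jm'.
have [Nk Hk] := freeze k km; have [Nl Hl] := freeze l lm'.
have h1 : lower Y m (f * mon x (fun q => pospart (- (1 * B i q))) ^+ (Ni + Nj)).
  apply: (lower_mon_exch im jm' _ _ _ Hi Hj) => //; [by left | by move=> q; exact: rows | by rewrite mul1r].
have h2 : lower Y m (f * mon x (fun q => pospart (- (- 1 * B k q))) ^+ (Nk + Nl)).
  apply: (lower_mon_exch km lm' _ _ _ Hk Hl) => //; [by right | by move=> q; exact: rows |].
  by rewrite sk; lia.
rewrite -monX in h1.
apply: (@lower_saturated _ _ x B rk gs Y (fun q => Y q && (B i q < 0)) m _ f _ um Ym (acyclic_compat am) _ _ _ _ _ h1 h2).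
- by move=> q /andP[].
- apply: (ringX (lau_ring _ _ _)); apply: lau_mon => q; last by have := pospart_ge0 (- (- 1 * B k q)); lia.
  move=> h; have kq : 0 < B k q by have := pospartP (- (- 1 * B k q)); lia.
  rewrite ksnk //=; apply/negP => iq.
  have qi : 0 < B q i by rewrite sk; lia.
  have h3 : (rk k < rk q)%N by apply: rank; rewrite ?km ?(ksnk q) ?orbT.
  have h4 : (rk q < rk i)%N by apply: rank; rewrite ?im ?(ksnk q) ?orbT.
  by have := ltn_trans h3 (ltn_trans h4 ik); rewrite ltnn.
- by rewrite expf_neq0 // mon_neq0.
- by move=> q; rewrite mulr_ge0 // pospart_ge0.
- move=> q; rewrite mulf_eq0 negb_or => /andP[h _].
  have iq : B i q < 0 by have := pospartP (- (1 * B i q)); lia.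
  by rewrite iq isrc.
Qed.
End Upper.

(** * Specialisation of a cluster variable *)

Section Independent.
Variables (F : fieldType) (I : finType).
Implicit Types (x : I -> F).

Lemma alg_independent_char0 x : alg_independent x -> char0 F.
Proof.
move=> xi n; apply/eqP => n0.
have : (n.+1)%:R = 0 :> {malg int[{cmonom I}]} by apply: xi; rewrite /poly_eval rmorph_nat.
move=> /(congr1 (mcoeff (mone : {cmonom I}))); rewrite mcoeff0 raddfMn /= mcoeff1 eqxx /=.
by move=> /eqP; rewrite pnatr_eq0.
Qed.

Lemma functional_independent (K : fieldType) x (z : I -> K) : alg_independent x -> functional (pairs x z).
Proof.
move=> xi p pR.
have [q ->] : exists q, p = (poly_eval x q, poly_eval z q).
  elim: {p} pR => [_ [l ->]||a b _ [q ->] _ [r ->]|a b _ [q ->] _ [r ->]].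
  - by exists << ucm l >>; rewrite !poly_evalU !cmonom_evalU.
  - by exists 1; rewrite !poly_eval1.
  - by exists (q - r); rewrite (poly_evalB x q r) (poly_evalB z q r).
  - by exists (q * r); rewrite (poly_evalM x q r) (poly_evalM z q r).
by move=> /= /xi ->; rewrite /poly_eval rmorph0.
Qed.

(** The place that sends x_i to a new indeterminate and the other variables to constants gives
    p(x_i) the value p itself. *)
Lemma alg_independent_tr x : alg_independent x -> tr_indep x.
Proof.
move=> xi i p pR p0; have nz l : x l != 0 by exact: alg_independent_neq0.
pose G : fieldType := {fraction {poly F}}.
pose hm : {rmorphism F -> G} := @tofrac {poly F} \o polyC.
pose X : G := tofrac 'X.
pose z l : G := if l == i then X else hm (x l).
have HZ := pairs_ring x z; have FZ : functional (pairs x z) by exact: functional_independent.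
have own a : lau x (off i) (off i) a -> spec (pairs x z) a (hm a).
  elim=> {a} [a [[l li ->]|[l li ->]]||a b _ ? _ ?|a b _ ? _ ?].
  - by have := spec_pairs x z l; rewrite /z (negPf li).
  - rewrite fmorphV; apply: specV => //; first by rewrite fmorph_eq0.
    by have := spec_pairs x z l; rewrite /z (negPf li).
  - by rewrite rmorph1; exact: spec1.
  - by rewrite rmorphB; exact: specB.
  - by rewrite rmorphM; exact: specM.
have e : spec (pairs x z) p.[x i] (\sum_(k < size p) hm p`_k * X ^+ k).
  rewrite horner_coef; apply: spec_sum => // k; apply: specM => //; first exact/own/pR.
  by apply: specX => //; have := spec_pairs x z i; rewrite /z eqxx.
rewrite p0 in e; have := spec_uniq HZ FZ e (spec0 HZ).
have -> : \sum_(k < size p) hm p`_k * X ^+ k = @tofrac {poly F} p.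
  rewrite -[p in RHS](coefK p) poly_def rmorph_sum; apply: eq_bigr => k _.
  by rewrite -mul_polyC rmorphM rmorphXn.
by move=> /eqP; rewrite tofrac_eq0 => /eqP.
Qed.
End Independent.

Lemma mutated_matrixE (I : eqType) (B : I -> I -> int) i j k :
  (if (i == j) || (i == k) then - B j k
   else B j k + ((`|B j i| * B i k + B j i * `|B i k|) %/ 2)%Z) = matmut B i j k.
Proof.
rewrite /matmut; case: ifP => // _; rewrite -addrA; congr (_ + _).
move: (B j i) (B i k) => a b.
have ge0 (c : int) : 0 <= c -> pospart c = c /\ pospart (- c) = 0.
  by move=> h; have := pospartP c; have := pospartP (- c); lia.
have le0 (c : int) : c <= 0 -> pospart c = 0 /\ pospart (- c) = - c.
  by move=> h; have := pospartP c; have := pospartP (- c); lia.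
have E (c : int) : ((c + c) %/ 2)%Z = c by lia.
have [a0|/ltW a0] := lerP 0 a; have [b0|/ltW b0] := lerP 0 b.
- have [-> ->] := ge0 _ a0; have [-> ->] := ge0 _ b0.
  by rewrite !ger0_norm // E mul0r subr0.
- have [-> ->] := ge0 _ a0; have [-> ->] := le0 _ b0.
  by rewrite ger0_norm // ler0_norm // mulrN subrr mulr0 mul0r subrr.
- have [-> ->] := le0 _ a0; have [-> ->] := ge0 _ b0.
  by rewrite ler0_norm // ger0_norm // mulNr addNr mulr0 mul0r subrr.
have [-> ->] := le0 _ a0; have [-> ->] := le0 _ b0.
by rewrite !ler0_norm // mulNr mulrN E mul0r sub0r mulrNN.
Qed.

(** * Translation of the seed data *)

Section Convert.
Variables (F : fieldType) (I : finType).
Implicit Types (S : seed_data F I) (w : seq I).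

Lemma mutated_variableE S i : mutated_variable S i = expoly (cluster S) (emat S i) / cluster S i.
Proof.
congr (_ / _); rewrite /expoly /mon; congr (_ + _).
  rewrite -(@bigfs _ _ _ _ (index_enum I) (fun k => 0 < emat S i k) _ (index_enum_uniq I)); last first.
    by move=> k _; rewrite mem_index_enum.
  rewrite big_mkcond; apply: eq_bigr => k _; case: ifP => bk; have := pospartP (emat S i k).
    by move=> h; rewrite exprnP; congr (_ ^ _); lia.
  by move=> h; have -> : pospart (emat S i k) = 0 by lia.
rewrite -(@bigfs _ _ _ _ (index_enum I) (fun k => emat S i k < 0) _ (index_enum_uniq I)); last first.
  by move=> k _; rewrite mem_index_enum.
rewrite big_mkcond; apply: eq_bigr => k _; case: ifP => bk; have := pospartP (- emat S i k).
  by move=> h; rewrite exprnP; congr (_ ^ _); lia.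
by move=> h; have -> : pospart (- emat S i k) = 0 by lia.
Qed.

Lemma mutate_smut S i : (cluster (mutate S i), emat (mutate S i)) = smut (cluster S, emat S) i.
Proof.
congr (_, _); last by apply/funext => j; apply/funext => k; exact: mutated_matrixE.
by apply/funext => j; rewrite /= /vmut; case: eqP => // _; exact: mutated_variableE.
Qed.

Lemma mutate_seq_smuts S w :
  (cluster (mutate_seq S w), emat (mutate_seq S w)) = smuts (cluster S, emat S) w.
Proof. by elim: w S => [//|i w IH S]; have := IH (mutate S i); rewrite mutate_smut. Qed.

Lemma cluster_mutate_seq S w : cluster (mutate_seq S w) = (smuts (cluster S, emat S) w).1.
Proof. by rewrite -mutate_seq_smuts. Qed.

Lemma exch_mutate_seq S w : exch (mutate_seq S w) = exch S.
Proof. by elim: w S => [//|i w IH S]; have := IH (mutate S i). Qed.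

Lemma admissibleE S w : admissible S w = all (exch S) w.
Proof. by elim: w S => //= i w IH S; rewrite IH. Qed.

Lemma smuts_matrix (x : I -> F) (B : I -> I -> int) w : (smuts (x, B) w).2 = foldl (@matmut I) B w.
Proof. by elim: w x B => //= i w IH x B; rewrite IH. Qed.
End Convert.

Lemma subring_generatedE (F : fieldType) (G : set F) a : subring_generated G a <-> gen G a.
Proof.
have [h1 hB hM] := subring_generated_closed G; split.
  apply: (smallest_sub (T := F)); last by move=> b Gb; exact: gen_in.
  split; first by rewrite in_setE; exact: gen_1.
  - by move=> b c; rewrite !in_setE; exact: gen_B.
  - by move=> b c; rewrite !in_setE; exact: gen_M.
apply: gen_sub => [|b Gb]; last by apply: sub_gen_smallest.
split; first by rewrite -in_setE.
- by move=> b c hb hc; have := hB b c; rewrite !in_setE; exact.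
- by move=> b c hb hc; have := hM b c; rewrite !in_setE; exact.
Qed.

Lemma acyclic_rank (I : finType) (e : rel I) : (forall c, cycle e c -> c = [::]) ->
  exists rk : I -> nat, forall j k, e j k -> (rk j < rk k)%N.
Proof.
move=> ac; exists (fun j => #|[set l | connect e l j]%SET|) => j k jk.
apply: proper_card; apply/properP; split.
  by apply/fintype.subsetP => l; rewrite !inE => /connect_trans; apply; exact: connect1.
exists k; rewrite !inE ?connect0 //; apply/negP => /connectP[p kp jE].
have := ac (k :: p); rewrite /= rcons_path kp -jE jk => /(_ isT) //.
Qed.

Section Prelim.
Variables (F : fieldType) (I : finType).
Implicit Types (x : I -> F) (B : I -> I -> int) (z w : seq I).

Lemma tr_indep_inj (J : finType) (phi : J -> I) x : injective phi -> tr_indep x -> tr_indep (fun j => x (phi j)).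
Proof.
move=> inj tr j; apply: transc_mono (tr (phi j)); apply: gen_mono => a [[l lj ->]|[l lj ->]];
  [apply: lau_in | apply: lau_inV]; by rewrite /off /= (inj_eq inj).
Qed.

Lemma stable_smuts x B z l : skew B -> uniq z -> {in z &, forall j k, B j k = 0} ->
  (smuts (x, B) z).1 l = if l \in z then expoly x (B l) / x l else x l.
Proof.
elim: z x B => [//|i z IH] x B sk /= /andP[iz uz] st.
have p0 : pospart 0 = 0 by [].
have zi j : j \in z -> j != i by apply: contraTneq => ->.
have zB j : j \in z -> B j i = 0 by move=> jz; apply: st; rewrite inE ?jz ?eqxx ?orbT.
have rowE j : j \in z -> matmut B i j =1 B j.
  move=> jz k; have [->|ki] := eqVneq k i; first by rewrite matmut_col zB ?oppr0.
  by rewrite (matmutE _ (zi _ jz) ki) (zB _ jz) oppr0 p0 !mul0r addr0 subr0.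
rewrite /smut /= IH //; last 2 first.
- exact: skew_matmut.
- by move=> j k jz kz; rewrite rowE // st ?inE ?jz ?kz ?orbT.
rewrite inE; case: (boolP (l \in z)) => lz; last first.
  by rewrite orbF /vmut; case: eqP => // ->.
rewrite orbT vmutE ?zi // (eq_expoly _ (rowE _ lz)); congr (_ / _).
by apply: eq_expoly_in => k bk; rewrite vmutE //; apply: contraNneq bk => ->; rewrite zB.
Qed.

Lemma foldl_matmutK B w : foldl (@matmut I) (foldl (@matmut I) B w) (rev w) = B.
Proof. by elim: w B => //= i w IH B; rewrite rev_cons -cats1 foldl_cat IH /= matmutK. Qed.

Lemma skew_foldl B w : skew B -> skew (foldl (@matmut I) B w).
Proof. by elim: w B => //= i w IH B sk; apply: IH; exact: skew_matmut. Qed.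

Lemma smuts_cat (s : (I -> F) * (I -> I -> int)) w w' : smuts s (w ++ w') = smuts (smuts s w) w'.
Proof. exact: foldl_cat. Qed.

Lemma smutsK (s : (I -> F) * (I -> I -> int)) w : good s -> smuts (smuts s w) (rev w) = s.
Proof.
elim: w s => //= i w IH s gs; rewrite rev_cons -cats1 smuts_cat IH; last exact: good_smut.
by rewrite /= smutK.
Qed.

(** Mutation at k in E changes an entry only by entries in the row and the column of k, so the
    entries with both indices outside E do not influence the others. *)
Lemma matmut_agree (E : pred I) B B' w : all E w ->
  (forall j l, E j || E l -> B j l = B' j l) ->
  forall j l, E j || E l -> foldl (@matmut I) B w j l = foldl (@matmut I) B' w j l.
Proof.
elim: w B B' => //= k w IH B B' /andP[Ek Ew] BB; apply: IH => // j l jl.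
by rewrite /matmut !BB // ?Ek ?orbT.
Qed.
End Prelim.

(** * The specialisation of the algebra of a seed with finitely many variables *)

Section Main.
Variables (F : fieldType) (I : finType) (S T : seed_data F I) (s : seq I) (i : I).
Hypothesis hS : is_seed S.
Hypothesis sS : admissible S s.
Hypothesis ST : mutate_seq S s = T.
Hypothesis skT : skew_symmetric_seed T.
Hypothesis acT : acyclic_seed T.

Let x := cluster S.
Let B := emat S.
Let E := exch S.
Let J : finType := {l : I | l != i}.
Let vl : J -> I := val.
Let x1 l : F := if l == i then 1 else x l.
Let R := pairs x x1.

Let xi : alg_independent x. Proof. by case: hS. Qed.
Let BT : emat T = foldl (@matmut I) B s.
Proof. by rewrite -(smuts_matrix x) -mutate_seq_smuts -ST. Qed.
Let Es : all E s. Proof. by rewrite -admissibleE. Qed.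
Let ET : exch T = E. Proof. by rewrite -ST exch_mutate_seq. Qed.
Let skB : skew B.
Proof. by rewrite -(foldl_matmutK B s) -BT; apply: skew_foldl; exact: skT. Qed.
Let gs : good (x, B).
Proof. by split=> //; [exact: alg_independent_char0 xi | exact: alg_independent_tr]. Qed.
Let HR : isring R. Proof. exact: pairs_ring. Qed.
Let FR : functional R. Proof. by case: gs => ? ? _; exact: functional_pairs. Qed.

Let D := restr vl (x1, B).
Let gD : good D.
Proof.
case: gs => c0 tr _; split; [exact: c0 | | by move=> j l; exact: skB].
rewrite /=; have -> : (fun l : J => x1 (vl l)) = fun l => x (vl l).
  by apply/funext => l; rewrite /x1 (negPf (valP l)).
by apply: tr_indep_inj => //; exact: val_inj.
Qed.
Let vo (l : J) : vl l != i. Proof. by case: l. Qed.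
Let vP l : l != i -> exists l0 : J, l = vl l0. Proof. by move=> li; exists (exist _ l li). Qed.
Let inj : injective vl. Proof. exact: val_inj. Qed.
Let x1i : (x1, B).1 i = 1. Proof. by rewrite /= /x1 eqxx. Qed.

(** The word starts at T: [rev s] leads back to S, possibly through i, and the word found after it
    avoids i. The vertex i belongs neither to [A] nor to [Y], so nothing is asserted about its
    arrows. *)
Let good_acyclic : exists (u : seq J) (C : I -> I -> int) (rk : I -> nat),
  [/\ all (fun j => E (vl j)) u, skew C,
      forall j l, E j || E l -> foldl (@matmut I) B (map vl u) j l = C j l &
      forall j l, j != i -> l != i -> 0 < C j l -> (rk j < rk l)%N].
Proof.
(* Arrows between frozen vertices, about which the acyclicity of T says nothing, are erased. *)
pose B0 j k := if E j || E k then emat T j k else 0.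
have sk0 : skew B0 by move=> j k; rewrite /B0 orbC skT; case: ifP; rewrite ?oppr0.
have [rk rkP] := acyclic_rank acT.
have ac0 j k : 0 < B0 j k -> (rk j < rk k)%N.
  by rewrite /B0; case: ifP => // jk h; apply: rkP; rewrite /mobile_arrow ET h.
pose A l := E l && (l != i); pose Y l := ~~ E l && (l != i).
have AY l : A l -> ~~ Y l by rewrite /A /Y => /andP[-> _].
have Yw : all (predC Y) (rev s).
  by rewrite all_rev; apply: sub_all Es => l El; rewrite /= /Y El.
have [w [Aw [rk' rkP']]] := acyclic_deletion sk0 ac0 AY Yw.
have [u uE] : exists u : seq J, w = map vl u.
  elim: (w) Aw => [|l w' IH] /=; first by exists [::].
  by move=> /andP[/andP[_ li] /IH[u ->]]; exists (exist _ l li :: u).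
exists u, (foldl (@matmut I) B0 (rev s ++ w)), rk'; split.
- rewrite uE all_map in Aw; by apply: sub_all Aw => j /andP[].
- exact: skew_foldl.
- move=> j l jl; rewrite -(foldl_matmutK B s) -BT -uE -foldl_cat.
  apply: (@matmut_agree _ E) => //; last by move=> j' l' h; rewrite /B0 h.
  by rewrite all_cat all_rev Es; apply: sub_all Aw => l' /andP[].
move=> j l ji li; apply: rkP'; rewrite /A /Y ?ji ?li !andbT; exact: orbN.
Qed.

Let spec_word (w : seq J) l : spec R ((smuts (x, B) (map vl w)).1 l) ((smuts (x1, B) (map vl w)).1 l).
Proof.
have [|_ ] := spec_smuts HR FR (s := (x, B)) (t := (x1, B)) (w := map vl w) (erefl _) (spec_pairs x x1).
  by apply: (@nonvanishing_drop _ _ _ vl i inj vo vP (x1, B) _ x1i); exact: gD.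
exact.
Qed.

Let word_drop (w : seq J) : (smuts (x1, B) (map vl w)).1 i = 1 /\
  (fun j : J => (smuts (x1, B) (map vl w)).1 (vl j)) = (smuts D w).1.
Proof. by have [<- h] := @smuts_drop _ _ _ vl i inj vo vP (x1, B) w x1i. Qed.

(** The variable i is not mutated, so it has the value 1 in the specialised cluster and may be
    inverted. *)
Let lau_word (w : seq J) f : all (fun j => E (vl j)) w ->
  lau (smuts (x, B) (map vl w)).1 predT E f ->
  exists c, spec R f c /\ lau (smuts D w).1 predT (fun j => E (vl j)) c.
Proof.
move=> Ew; have [hi hD] := word_drop w; have gw := good_smuts w gD.
set L := lau (smuts D w).1 predT _; have HL : isring L by exact: lau_ring.
have val1 l : l != i -> exists2 j : J, l = vl j & (smuts (x1, B) (map vl w)).1 l = (smuts D w).1 j.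
  by move=> /vP[j ->]; exists j => //; rewrite -hD.
elim=> {f} [f [[l _ ->]|[l lE ->]]||a b _ [c [cS cL]] _ [d [dS dL]]|a b _ [c [cS cL]] _ [d [dS dL]]].
- exists ((smuts (x1, B) (map vl w)).1 l); split; first exact: spec_word.
  have [->|/val1[j _ ->]] := eqVneq l i; first by rewrite hi; exact: (ring1 HL).
  exact: lau_in.
- exists ((smuts (x1, B) (map vl w)).1 l)^-1; split.
    apply: specV => //.
    have [->|/val1[j _ ->]] := eqVneq l i; first by rewrite hi oner_neq0.
    exact: (good_neq0 j gw).
  have [->|/val1[j lj ->]] := eqVneq l i; first by rewrite hi invr1; exact: (ring1 HL).
  by apply: lau_inV; rewrite -lj.
- by exists 1; split; [exact: spec1 | exact: (ring1 HL)].
- by exists (c - d); split; [exact: specB | exact: (ringB HL)].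
- by exists (c * d); split; [exact: specM | exact: (ringM HL)].
Qed.

(** For each stable Z the value is computed in the cluster reached by u followed by Z. Values at a
    place are unique, so a single element is Laurent in all these clusters: it lies in the upper
    bound, hence in the lower bound, whose generators are cluster variables of the deletion. *)
Let cluster_variable_spec f : cluster_variables S f ->
  exists c, spec R f c /\ gen (cluster_variables (delete S i)) c.
Proof.
move=> [_ [v /= vS <-] [k _ <-]]; rewrite admissibleE in vS; rewrite cluster_mutate_seq -/x -/B.
set f0 := (smuts _ v).1 k.
have [u [C [rk [Eu skC BC rkC]]]] := good_acyclic.
pose x0 := (smuts D u).1.
pose C0 (j l : J) := C (vl j) (vl l).
have gD' := good_smuts u gD.
have E0 j l : E (vl j) || E (vl l) -> (smuts D u).2 j l = C0 j l.
  move=> jl; rewrite /C0 -BC // -(smuts_matrix x1).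
  by have [<- _] := @smuts_drop _ _ _ vl i inj vo vP (x1, B) u x1i.
have g0 : good (x0, C0).
  by case: gD' => c0 tr _; split=> // j l; exact: skC.
pose m := filter (fun j : J => E (vl j)) (enum J).
pose Y (j : J) := ~~ E (vl j).
have mE j : (j \in m) = E (vl j) by rewrite mem_filter mem_enum andbT.
have YmT j : Y j || (j \in m) by rewrite mE orNb.
have am : acyclic_on C0 (fun j => rk (vl j)) Y m.
  split=> //; first by rewrite filter_uniq // enum_uniq.
    by move=> l; rewrite mE /Y negbK.
  by move=> j l _ _; apply: rkC.
have main (Z : {set J}) : {subset Z <= m} -> stable C0 Z ->
    exists c, spec R f0 c /\ lau (xz x0 C0 Z) (fun l => Y l || (l \in m)) (fun l => l \in m) c.
  move=> Zm Zs; have Ez : all (fun j => E (vl j)) (enum Z).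
    by apply/allP => j; rewrite mem_enum => /Zm; rewrite mE.
  pose W := u ++ enum Z; have EW : all (fun j => E (vl j)) W by rewrite all_cat Eu.
  have EWv : all E (map vl W) by rewrite all_map.
  (* The variable is reached from the cluster at W by going back along W, then along v. *)
  have fW : f0 = (smuts (smuts (x, B) (map vl W)) (rev (map vl W) ++ v)).1 k.
    by rewrite smuts_cat smutsK.
  have fL : lau (smuts (x, B) (map vl W)).1 predT E f0.
    rewrite fW; apply: lau_mono (laurent_frozen (Y := predC E) k _ _) => //.
    - by move=> l; rewrite /= negbK.
    - exact: good_smuts.
    - by rewrite all_cat all_rev; apply/andP; split; [apply: sub_all EWv | apply: sub_all vS] => l El;
        rewrite /= negbK.
  have [c [cS cL]] := lau_word EW fL; exists c; split=> //.
  have -> : xz x0 C0 Z = (smuts D W).1.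
    apply/funext => l; rewrite smuts_cat.
    have skD : skew (smuts D u).2 by case: gD'.
    rewrite [smuts D u]surjective_pairing stable_smuts ?enum_uniq //; last first.
      move=> j l'; rewrite !mem_enum => jZ lZ; rewrite E0 ?Zs //.
      by have := Zm _ jZ; rewrite mE => ->.
    rewrite mem_enum /xz; case: ifP => // lZ; congr (_ / _); apply: eq_expoly => j.
    by rewrite E0 //; have := Zm _ lZ; rewrite mE => ->.
  by apply: lau_mono cL => // l; rewrite mE.
have [] := main finset.set0; [by move=> j; rewrite inE | by move=> j l; rewrite inE |].
move=> c [cS _]; exists c; split=> //.
have cU : upper x0 C0 Y m c.
  by move=> Z Zm Zs; have [c' [cS' cL']] := main Z Zm Zs; rewrite (spec_uniq HR FR cS cS').
have := upper_lower g0 am cU; apply: gen_mono => a.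
have Dseed : D = (cluster (delete S i), emat (delete S i)).
  by congr (_, _); apply/funext => l; rewrite /= /x1 (negPf (valP l)).
case=> -[l lm ->]; apply: gen_in.
  exists (mutate_seq (delete S i) u); first by exists u => //; rewrite /= admissibleE.
  by exists l => //; rewrite cluster_mutate_seq -Dseed.
have El : E (vl l) by rewrite -mE.
exists (mutate_seq (delete S i) (rcons u l)).
  by exists (rcons u l) => //; rewrite /= admissibleE all_rcons; apply/andP.
exists l => //; rewrite cluster_mutate_seq -Dseed -cats1 smuts_cat /= vmut_id xp_expoly //.
congr (_ / _); apply: eq_expoly => j; by rewrite E0 // El.
Qed.

Let laurentE a : laurent_ring S a <-> lau x predT predT a.
Proof.
rewrite /laurent_ring; split=> [/subring_generatedE|h].
  by apply: gen_mono => b [[j _ <-]|[j _ <-]]; [exact: lau_in | exact: lau_inV].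
apply/subring_generatedE; apply: gen_mono h => b [[j _ ->]|[j _ ->]]; apply: gen_in.
  by left; exists j.
by right; exists j.
Qed.

Let algebra_spec a : cluster_algebra S a ->
  lau x predT predT a /\ exists c, spec R a c /\ cluster_algebra (delete S i) c.
Proof.
have HL := lau_ring x predT predT.
move=> /subring_generatedE; elim=> {a} [a aS||a b _ [aL [c [cS /subring_generatedE cA]]] _ [bL [d [dS /subring_generatedE dA]]]|
  a b _ [aL [c [cS /subring_generatedE cA]]] _ [bL [d [dS /subring_generatedE dA]]]].
- split; last by have [c [cS cA]] := cluster_variable_spec aS; exists c; split=> //; exact/subring_generatedE.
  move: aS => [_ [v _ <-] [k _ <-]]; rewrite cluster_mutate_seq; exact: laurent_phenomenon v k gs.
- split; first exact: (ring1 HL).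
  by exists 1; split; [exact: spec1 | apply/subring_generatedE; exact: gen_1].
- split; first exact: (ringB HL).
  by exists (c - d); split; [exact: specB | apply/subring_generatedE; exact: gen_B].
- split; first exact: (ringM HL).
  by exists (c * d); split; [exact: specM | apply/subring_generatedE; exact: gen_M].
Qed.

(** The homomorphism and the place agree on the variables and their inverses, hence on the Laurent
    ring; its values can then be compared with those found above by uniqueness. *)
Let specialisation_spec a : lau x predT predT a -> spec R a (specialisation S i a).
Proof.
have [f1 fD fM fi fj] := specialisationP i hS; set f := specialisation S i in f1 fD fM fi fj *.
have HL := lau_ring x predT predT.
have fx l : f (x l) = x1 l by rewrite /x1; case: eqP => [->//|/eqP li]; exact: fj.
have x1n l : x1 l != 0.
  by rewrite /x1; case: (l =P i) => _; [exact: oner_neq0 | exact: (good_neq0 l gs)].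
have f0 : f 0 = 0.
  apply: (@addrI _ (f 0)); rewrite -fD ?addr0 //; apply/laurentE; exact: (ring0 HL).
elim=> {a} [a [[l _ ->]|[l _ ->]]||a b aL IHa bL IHb|a b aL IHa bL IHb].
- by rewrite fx; exact: spec_pairs.
- have -> : f (x l)^-1 = (x1 l)^-1.
    apply: (mulfI (x1n l)); rewrite divff // -fx -fM ?divff //; first exact: (good_neq0 l gs).
      by apply/laurentE; exact: lau_in.
    by apply/laurentE; exact: lau_inV.
  by apply: specV => //; exact: spec_pairs.
- by rewrite f1; exact: spec1.
- have -> : f (a - b) = f a - f b; last exact: specB.
  apply: (@addIr _ (f b)); rewrite subrK -fD ?subrK //; apply/laurentE => //; exact: (ringB HL).
by rewrite fM; [exact: specM | exact/laurentE | exact/laurentE].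
Qed.

Lemma specialisation_sub a : cluster_algebra S a -> cluster_algebra (delete S i) (specialisation S i a).
Proof.
move=> /algebra_spec[aL [c [cS cA]]].
by rewrite (spec_uniq HR FR (specialisation_spec aL) cS).
Qed.
End Main.

Lemma rat_span_in (F : fieldType) (A : set F) a : A a -> rat_span A a.
Proof.
move=> Aa; exists 1%N, (fun=> 1), (fun=> a); split=> //.
by rewrite big_ord1 /ratr (_ : numq 1 = 1) // (_ : denq 1 = 1) // divr1 mul1r.
Qed.

Lemma mutate_seq_unmutated (F : fieldType) (I : countType) (S : seed_data F I) w j :
  j \notin w -> cluster (mutate_seq S w) j = cluster S j.
Proof.
elim: w S => [//|k w IH] S; rewrite inE negb_or => /andP[jk jw].
by rewrite [LHS](IH (mutate S k)) //= (negPf jk).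
Qed.

Lemma alg_independent_inj (F : fieldType) (I : choiceType) (x : I -> F) : alg_independent x -> injective x.
Proof.
move=> xi j k e; apply/eqP; apply/negPn/negP => jk.
pose p : {malg int[{cmonom I}]} := << ucm j >> - << ucm k >>.
have pE (v : I -> F) : poly_eval v p = v j - v k.
  apply: (etrans (poly_evalB v << ucm j >> << ucm k >>)).
  have U l : poly_eval v << ucm l >> = v l := etrans (poly_evalU v (ucm l)) (cmonom_evalU v l).
  exact: (congr2 (fun a b => a - b) (U j) (U k)).
pose v l : F := (l == j)%:R.
have p0 : p = 0 by apply: xi; rewrite pE e subrr.
have := pE v; rewrite p0 /poly_eval raddf0 /v eqxx eq_sym (negPf jk) subr0 => /esym/eqP.
by rewrite oner_eq0.
Qed.

(** Indices that do not occur in w keep their variables, which are distinct by independence and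
    belong to a finite set; the other indices occur in w. *)
Lemma finite_index (F : fieldType) (I : countType) (S : seed_data F I) w :
  alg_independent (cluster S) -> finite_seed (mutate_seq S w) -> exists e : seq I, Finite.axiom e.
Proof.
move=> xi fS; pose A : set I := [set l | l \notin w].
have Afin : finite_set A.
  have inj : {in A &, injective (cluster (mutate_seq S w))}.
    move=> j k; rewrite !in_setE /= => jw kw; rewrite !mutate_seq_unmutated //.
    exact: alg_independent_inj.
  rewrite -(eq_finite_set (inj_card_eq inj)); apply: sub_finite_set fS => _ [j _ <-].
  by exists j.
have /finite_seqP[s sE] := Afin; exists (undup (s ++ w)) => j.
rewrite count_uniq_mem ?undup_uniq // mem_undup mem_cat.
have [jw|jw] := boolP (j \in w); first by rewrite orbT.
by have : A j by []; rewrite sE /= => ->.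
Qed.

Theorem theorem6p13 (F : fieldType) (I : countType) (S : seed_data F I)
    (hS : is_seed S)
    (hmut : exists T : seed_data F I,
      [/\ mutation_equivalent S T, finite_seed T, skew_symmetric_seed T
        & acyclic_seed T])
    (i : I) :
  specialisation S i @` cluster_algebra S
    `<=` rat_span (cluster_algebra (delete S i)).
Proof.
move=> _ [a aS <-]; apply: rat_span_in; move: hmut => [T [[s sS ST] fT skT acT]].
have [e eP] : exists e : seq I, Finite.axiom e.
  by case: hS => xi _ _; apply: (finite_index (w := s) xi); rewrite ST.
case: I => C c in S hS i a aS T s sS ST fT skT acT e eP *.
(* The finite structure is built over the given countable one, so that the seed data are used
   unchanged. *)
pose J : finType := HB.pack C c (isFinite.Build (Countable.Pack c) eP).
exact: (@specialisation_sub F J S T s i hS sS ST skT acT a aS).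
Qed.
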